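(* Let $n\ge 2$, let $u\in S^{n-1}$, let $H=u^\perp$ be oriented with $u\in H^+$, let $\mathcal{E}=\mathcal{C}^n$ or $\mathcal{E}=\mathcal{L}^n$, and suppose that $\diamondsuit:\mathcal{E}\to\mathcal{L}^n$ is monotonic, measure preserving, perimeter preserving on convex bodies, and invariant on $H$-symmetric unions of two disjoint balls. Then $\diamondsuit$ essentially equals $\mathrm{Id}$, $\dagger$, $\diamondsuit_{P_H}$, or $\diamondsuit_{P_H}^\dagger$.
   Context: $\mathcal{H}^n$ is $n$-dimensional Hausdorff (Lebesgue) measure on $\mathbb{R}^n$; two set maps are essentially equal if for each set in their domain the two images agree up to a set of $\mathcal{H}^n$-measure zero. $\mathcal{L}^n$ is the class of $\mathcal{H}^n$-measurable sets of finite $\mathcal{H}^n$-measure in $\mathbb{R}^n$; $\mathcal{C}^n$ is the class of nonempty compact sets; $\mathcal{K}^n_n$ is the class of convex bodies (compact convex sets with interior points). $S^{n-1}$ is the unit sphere and $u^\perp$ is the hyperplane through the origin orthogonal to $u$. ''Ball'' means closed $n$-dimensional ball (positive radius). $H^+$ is the closed half-space bounded by $H$ containing $u$, and $H^-$ is the other closed half-space. $x^\dagger$ and $A^\dagger$ denote the reflections in $H$ of a point $x$ and a set $A$; $A$ is $H$-symmetric if $A^\dagger=A$; $\dagger$ as a set map is $A\mapsto A^\dagger$. The polarization $\diamondsuit_{P_H}A$ of a set $A$ is the set with: for $x\in H^+$, $x\in\diamondsuit_{P_H}A$ iff $\{x,x^\dagger\}\cap A\ne\emptyset$; for $x\in H^-$,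 $x\in\diamondsuit_{P_H}A$ iff $\{x,x^\dagger\}\subset A$. The map $\diamondsuit_{P_H}^\dagger$ is $A\mapsto(\diamondsuit_{P_H}A)^\dagger$. Properties of $\diamondsuit:\mathcal{E}\to\mathcal{L}^n$, required for all $K,L\in\mathcal{E}$, with sets of $\mathcal{H}^n$-measure zero ignored in all inclusions and equalities of sets: - monotonic: $K\subset L\Rightarrow\diamondsuit K\subset\diamondsuit L$; - measure preserving: $\mathcal{H}^n(\diamondsuit K)=\mathcal{H}^n(K)$; - perimeter preserving on convex bodies: for each $K\in\mathcal{K}^n_n$, $\diamondsuit K$ is a set of finite perimeter and $S(\diamondsuit K)=S(K)$, where $S$ denotes perimeter (in the sense of De Giorgi; for a convex body $S(K)$ is its surface area); - invariant on $H$-symmetric unions of two disjoint balls: if $K$ is $H$-symmetric and is the union of two disjoint balls, then $\diamondsuit K=K$. *)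

(* Defs.v *)
From HB Require Import structures.
From mathcomp Require Import all_boot all_order all_algebra.
From mathcomp Require Import all_classical all_reals all_analysis.

Set Implicit Arguments.
Unset Strict Implicit.
Unset Printing Implicit Defensive.
Import Order.TTheory GRing.Theory Num.Theory.
Import numFieldNormedType.Exports.

Local Open Scope classical_set_scope.
Local Open Scope ring_scope.

(* The norm that the library puts on 'rV[R]_n is the sup norm: it serves only
   for the topology and for derivatives, while unit vectors, balls and
   reflections refer to the Euclidean structure below. *)
Section euclidean.
Context {R : realType} {n : nat}.
Implicit Types (x y u : 'rV[R]_n) (A : set 'rV[R]_n).

Definition dot x y : R := \sum_(i < n) x ord0 i * y ord0 i.

Definition enorm x : R := Num.sqrt (dot x x).

Definition is_ball A : Prop :=
  exists (c : 'rV[R]_n) (r : R), 0 < r /\ A = [set x | enorm (x - c) <= r].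

Definition half_space_pos u : set 'rV[R]_n := [set x | 0 <= dot x u].

Definition half_space_neg u : set 'rV[R]_n := [set x | dot x u <= 0].

(* for a unit vector u *)
Definition hrefl u x : 'rV[R]_n := x - (2 * dot x u) *: u.

Definition hrefl_set u A : set 'rV[R]_n := hrefl u @` A.

Definition polarization u A : set 'rV[R]_n :=
  [set x | half_space_pos u x /\ [set x; hrefl u x] `&` A !=set0] `|`
  [set x | half_space_neg u x /\ [set x; hrefl u x] `<=` A].

Definition convex_body A : Prop :=
  [/\ compact A, @convex_set R 'rV[R]_n A & A° !=set0].

End euclidean.

(* Lebesgue measure on R^(n+1), defined as the outer measure obtained from countable
   covers by closed boxes; in dimension 0 the empty set could not be covered
   at zero cost. *)
Section lebesgue_outer.
Context (R : realType) (n : nat).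
Local Notation V := 'rV[R]_n.+1.
Local Open Scope ereal_scope.

Definition box (ab : V * V) : set V :=
  [set x | forall i, (ab.1 ord0 i <= x ord0 i <= ab.2 ord0 i)%R].

Definition box_volume (ab : V * V) : R :=
  (\prod_(i < n.+1) Num.max 0 (ab.2 ord0 i - ab.1 ord0 i))%R.

Definition lebesgue_outer (A : set V) : \bar R :=
  ereal_inf [set \sum_(k <oo) (box_volume (B k))%:E |
             B in [set B : nat -> V * V | A `<=` \bigcup_k box (B k)]].

Lemma box_volume_ge0 ab : 0 <= (box_volume ab)%:E.
Proof.
by rewrite lee_fin; apply: prodr_ge0 => i _; rewrite le_max lexx.
Qed.

Lemma lebesgue_outer_ge0 A : 0 <= lebesgue_outer A.
Proof.
apply: le_ereal_inf_tmp => _ [B AB <-].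
by apply: nneseries_ge0 => k _ _; exact: box_volume_ge0.
Qed.

Lemma lebesgue_outer0 : lebesgue_outer set0 = 0.
Proof.
apply/eqP; rewrite eq_le lebesgue_outer_ge0 andbT.
apply: ereal_inf_lbound; exists (fun=> (0%R, 0%R)) => //=.
rewrite eseries0// => k _ _.
by rewrite /box_volume big_ord_recl /= subrr maxxx mul0r.
Qed.

Lemma le_lebesgue_outer : {homo lebesgue_outer : A B / A `<=` B >-> A <= B}.
Proof.
move=> A B AB; apply: ereal_inf_le_tmp => _ [C BC <-].
by exists C => //; exact: subset_trans AB BC.
Qed.

Lemma lebesgue_outer_sigma_subadditive : sigma_subadditive lebesgue_outer.
Proof.
move=> A; have [[i ioo]|] := pselect (exists i, lebesgue_outer (A i) = +oo).
  rewrite (eseries_pinfty _ _ ioo) ?leey// => k _.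
  by rewrite -ltNye (lt_le_trans _ (lebesgue_outer_ge0 _)).
rewrite -forallNE => Aoo.
suff add2e (e : {posnum R}) : lebesgue_outer (\bigcup_n A n) <=
    \sum_(i <oo) lebesgue_outer (A i) + e%:num%:E.
  by apply/lee_addgt0Pr => _/posnumP[].
rewrite (le_trans _ (epsilon_trick _ _ _))//; last first.
  by move=> k; exact: lebesgue_outer_ge0.
pose P k (B : nat -> V * V) := A k `<=` \bigcup_j box (B j) /\
  \sum_(j <oo) (box_volume (B j))%:E <=
  lebesgue_outer (A k) + (e%:num / (2 ^ k.+1)%:R)%:E.
have [G PG] : {G : nat -> nat -> V * V & forall k, P k (G k)}.
  apply: (@choice _ _ P) => k; rewrite /P /lebesgue_outer.
  set S := (X in ereal_inf X); move infS : (ereal_inf S) => iS.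
  case: iS infS => [r Sr|Soo|Soo].
  - have en1 : (0 < e%:num / (2 ^ k.+1)%:R)%R by [].
    have /(lb_ereal_inf_adherent en1) : ereal_inf S \is a fin_num by rewrite Sr.
    by move=> [x [B AB <-] xS]; exists B; split => //; rewrite -Sr; exact/ltW.
  - by have := Aoo k; rewrite /lebesgue_outer Soo.
  - suff : lbound S 0 by move/le_ereal_inf_tmp; rewrite Soo.
    move=> /= _ [B AB <-]; apply: nneseries_ge0 => j _ _.
    exact: box_volume_ge0.
pose v (p : nat * nat) : \bar R := (box_volume (G p.1 p.2))%:E.
have v_ge0 p : 0 <= v p by exact: box_volume_ge0.
apply: (@le_trans _ _ (\esum_(p in setT) v p)).
  apply: ereal_inf_lbound => /=.
  have /card_esym/ppcard_eqP[f] := card_nat2.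
  exists (fun k => G (f k).1 (f k).2).
    move=> t [i _ Ait]; have [j _ Gijt] := (PG i).1 _ Ait.
    by exists (f^-1%FUN (i, j)) => //=; rewrite invK ?inE.
  rewrite -[LHS]/(\sum_(k <oo) (v \o f) k).
  rewrite -(esum_pred_image v f xpredT) ?[fun=> _]set_true//.
  by rewrite image_eq.
rewrite (_ : esum _ _ = \sum_(i <oo) \sum_(j <oo) v (i, j)); last first.
  pose J : nat -> set (nat * nat) := fun i => [set (i, j) | j in setT].
  rewrite (_ : setT = \bigcup_k J k); last first.
    by rewrite predeqE => -[a b]; split => // _; exists a => //; exists b.
  rewrite esum_bigcupT //=; last first.
    apply/trivIsetP => i j _ _ ij.
    rewrite predeqE => -[k m] /=; split => //= -[] [_] _ [<-{k} _].
    by move=> [m' _] [] /esym/eqP; rewrite (negbTE ij).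
  rewrite -(image_id [set: nat]) -fun_true esum_pred_image//; last first.
    by move=> k _; exact: esum_ge0.
  apply: eq_eseriesr => /= j _.
  rewrite -(esum_pred_image v (pair j) predT)//=; last first.
    by move=> ? ? _ _; exact: (@can_inj _ _ _ snd).
  by congr esum; rewrite predeqE => -[a b]; split; move=> [i _ <-]; exists i.
apply: lee_lim.
- by apply: is_cvg_nneseries => k *; apply: nneseries_ge0.
- apply: is_cvg_nneseries => k *; apply: adde_ge0 => //.
  exact: lebesgue_outer_ge0.
- by near=> k; apply: lee_sum => i _; exact: (PG i).2.
Unshelve. all: by end_near. Qed.

HB.instance Definition _ := isOuterMeasure.Build R V lebesgue_outer
  lebesgue_outer0 lebesgue_outer_ge0 le_lebesgue_outer
  lebesgue_outer_sigma_subadditive.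

End lebesgue_outer.

Arguments lebesgue_outer {R n}.

(* lebesgue_outer as a measure on the sigma-algebra of all Lebesgue measurable
   sets *)
Section lebesgue.
Context (R : realType) (n : nat).
Local Notation mu := (@lebesgue_outer R n).
Local Notation T := (caratheodory_type mu).

Definition lebesgue : set T -> \bar R := mu.

HB.instance Definition _ := isMeasure.Build _ T R lebesgue
  (@caratheodory_measure0 R _ mu) (@caratheodory_measure_ge0 R _ mu)
  (@caratheodory_measure_sigma_additive R _ mu).

End lebesgue.

Arguments lebesgue {R n}.

Section perimeter.
Context {R : realType} {n : nat}.
Local Notation V := 'rV[R]_n.+1.

Definition C1 (f : V -> R) : Prop := forall j : 'I_n.+1,
  (forall x, derivable f x (delta_mx ord0 j)) /\
  continuous (fun x => 'D_(delta_mx ord0 j) f x).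

Definition divergence (phi : V -> V) (x : V) : R :=
  \sum_(i < n.+1) 'D_(delta_mx ord0 i) (fun y => phi y ord0 i) x.

Definition test_field (phi : V -> V) : Prop :=
  [/\ forall i : 'I_n.+1, C1 (fun x => phi x ord0 i),
      compact (closure [set x | phi x != 0]) &
      forall x, enorm (phi x) <= 1].

Definition perimeter (A : set V) : \bar R :=
  ereal_sup [set (\int[lebesgue]_(x in A) (divergence phi x)%:E)%E |
             phi in test_field].

Definition finite_perimeter (A : set V) : Prop :=
  lebesgue_outer.-caratheodory A /\ (perimeter A < +oo)%E.

End perimeter.

Section set_maps.
Context {R : realType} {n : nat}.
Local Notation V := 'rV[R]_n.+1.
Implicit Types (A B K L : set V) (E : set (set V)) (D : set V -> set V).

Definition compact_class : set (set V) := [set A | compact A /\ A !=set0].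

Definition measurable_class : set (set V) :=
  [set A | lebesgue_outer.-caratheodory A /\ (lebesgue_outer A < +oo)%E].

Definition ess_subset A B : Prop := lebesgue_outer (A `\` B) = 0%E.

Definition ess_eq A B : Prop := lebesgue_outer ((A `\` B) `|` (B `\` A)) = 0%E.

(* A set map defined on the class E is a function on all sets, of which only
   the values on E matter. *)
Definition maps_into E D : Prop := forall K, E K -> measurable_class (D K).

Definition monotonic E D : Prop :=
  forall K L, E K -> E L -> ess_subset K L -> ess_subset (D K) (D L).

Definition measure_preserving E D : Prop :=
  forall K, E K -> lebesgue_outer (D K) = lebesgue_outer K.

Definition perimeter_preserving_on_convex_bodies E D : Prop :=
  forall K, E K -> convex_body K ->
    finite_perimeter (D K) /\ perimeter (D K) = perimeter K.

Definition invariant_on_symmetric_ball_pairs E (u : V) D : Prop :=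
  forall K B1 B2, E K -> is_ball B1 -> is_ball B2 -> B1 `&` B2 = set0 ->
    K = B1 `|` B2 -> hrefl_set u K = K -> ess_eq (D K) K.

Definition ess_equal_maps E (D1 D2 : set V -> set V) : Prop :=
  forall K, E K -> ess_eq (D1 K) (D2 K).

End set_maps.

(* Main.v *)
Require Import Defs.
From HB Require Import structures.
From mathcomp Require Import all_boot all_order all_algebra.
From mathcomp Require Import all_classical all_reals all_analysis.
From mathcomp Require Import measurable_realfun.
From mathcomp Require Import ring lra zify.

Set Implicit Arguments.
Unset Strict Implicit.
Unset Printing Implicit Defensive.
Import Order.TTheory GRing.Theory Num.Theory.
Import numFieldNormedType.Exports.

Local Open Scope classical_set_scope.
Local Open Scope ring_scope.

(** Why the classification holds. Let [T] be the reflection in the hyperplane.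

    A closed ball [B] in an open half-space and its mirror image [T B] form an invariant
    pair, so by monotonicity the image of [B] is a set [A] that lies in the union of [B]
    and [T B] and has the measure and the perimeter of [B]. Such a set is [B] or [T B]
    ([two_balls_dichotomy]). The proof calibrates the ball of centre [c] and radius [r] by
    the field [(x - c) / r], which has constant divergence and is the outer normal on the
    boundary: the perimeter of the ball is at most [(n + 1) / r] times its measure
    ([perimeter_cball_le]). Tested on [A], the calibrating fields of [B] and [T B] already
    reach this value. Inside the balls their norm is less than 1, so they may be perturbed
    by any small field supported there, whose divergence must therefore have integral zero
    over [A] ([split_ball_stationary]). It follows that all translates of a small cube
    inside [B] meet [A] in the same measure; so [A] is null or full in each cube
    ([cube_dichotomy]) and, by connectedness, in [B] ([ball_dichotomy]).

    Two balls in a half-space lie in a third one, and monotonicity then forces the same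
    choice between [B] and [T B] for all balls of that half-space ([half_choice]). Finite
    unions of balls approximate compact sets from outside, compact sets exhaust measurable
    sets from inside, and the preservation of measure turns inclusions into equalities; so
    the choice extends to all sets in the half-space ([image_compact], [image_lower]). For
    the same reasons, the part of [K] that is symmetric about the hyperplane lies in the
    image of [K] ([symmetric_lower]).

    The choices for the two half-spaces make four cases. If they agree, the image is [K] or
    [T K]. If not, the image contains the images of the two halves of [K] and the symmetric
    part of [K], which make up the polarization with respect to [u] or to [- u]
    ([polarization_case]), and the latter is the mirror image of the former
    ([mirror_polarization]).

    About Lebesgue measure, given by covers with boxes, the main tool is a comparison on
    small cubes ([lebesgue_outer_dominates]): it yields both the invariance under [T]
    ([lebesgue_outer_hrefl]) and the dichotomy in cubes. *)

(** * Lebesgue outer measure: dilations, Borel sets *)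

Section measure_basics.
Context {R : realType} {n : nat}.
Local Notation V := 'rV[R]_n.+1.
Local Notation mu := (@lebesgue_outer R n).
Local Notation M := (lebesgue_outer.-caratheodory).
Implicit Types (A B : set V) (a b v : V).

Definition dilate (s : R) (v : V) : V -> V := fun x => s *: x + v.

Lemma dilateK s v : s != 0 -> cancel (dilate s v) (dilate s^-1 (- (s^-1 *: v))).
Proof. by move=> s0 x; rewrite /dilate scalerDr scalerA mulVf// scale1r addrK. Qed.

Lemma box_volume_nonneg (ab : V * V) : 0 <= box_volume ab.
Proof. by apply: prodr_ge0 => i _; rewrite le_max lexx. Qed.

Lemma box_volume_dilate s v (ab : V * V) : 0 < s ->
  box_volume (dilate s v ab.1, dilate s v ab.2) = s ^+ n.+1 * box_volume ab.
Proof.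
move=> s0; rewrite /box_volume -[in s ^+ _](card_ord n.+1) -prodr_const -big_split/=.
apply: eq_bigr => i _; rewrite /dilate !mxE opprD addrACA subrr addr0 -mulrBr.
by rewrite -{1}(mulr0 s) maxr_pMr// ltW.
Qed.

Lemma box_dilate s v (ab : V * V) : 0 < s ->
  dilate s v @` box ab `<=` box (dilate s v ab.1, dilate s v ab.2).
Proof.
by move=> s0 _ [x abx <-] i; rewrite /dilate !mxE !lerD2r !ler_pM2l//; exact: abx.
Qed.

Lemma lebesgue_outer_dilate_le s v A : 0 < s ->
  (mu (dilate s v @` A) <= (s ^+ n.+1)%:E * mu A)%E.
Proof.
move=> s0; have sn0 : 0 < s ^+ n.+1 by rewrite exprn_gt0.
rewrite -lee_pdivrMl//; apply: le_ereal_inf_tmp => _ [B AB <-].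
rewrite lee_pdivrMl//.
rewrite -nneseriesZl//; last by move=> k _; exact: box_volume_ge0.
apply: ereal_inf_lbound; exists (fun k => (dilate s v (B k).1, dilate s v (B k).2)).
  move=> _ [x Ax <-]; have [k _ Bkx] := AB _ Ax.
  by exists k => //; apply: box_dilate => //; exists x.
by apply: eq_eseriesr => k _; rewrite box_volume_dilate// EFinM.
Qed.

Lemma lebesgue_outer_dilate s v A : 0 < s ->
  mu (dilate s v @` A) = ((s ^+ n.+1)%:E * mu A)%E.
Proof.
move=> s0; apply/eqP; rewrite eq_le lebesgue_outer_dilate_le//=.
have sn0 : 0 < s ^+ n.+1 by rewrite exprn_gt0.
rewrite -lee_pdivlMl// -exprVn.
have -> : A = dilate s^-1 (- (s^-1 *: v)) @` (dilate s v @` A).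
  rewrite image_comp -[LHS]image_id; apply: eq_imagel => x _ /=.
  by rewrite dilateK// gt_eqF.
rewrite [X in (_ <= _ * mu X)%E](_ : _ = dilate s v @` A); last first.
  congr image; rewrite image_comp -[RHS]image_id; apply: eq_imagel => x _ /=.
  by rewrite dilateK// gt_eqF.
by apply: lebesgue_outer_dilate_le; rewrite invr_gt0.
Qed.

Lemma lebesgue_outer_shift v A : mu [set x + v | x in A] = mu A.
Proof.
have := lebesgue_outer_dilate v A (@ltr01 R).
rewrite expr1n mul1e => <-; congr (mu _); apply: eq_imagel => x _.
by rewrite /dilate scale1r.
Qed.

Lemma lebesgue_outer_box (ab : V * V) : (mu (box ab) <= (box_volume ab)%:E)%E.
Proof.
apply: ereal_inf_lbound; exists (fun k => if k == 0%N then ab else (0, 0)).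
  by move=> x abx; exists 0%N.
rewrite (@nneseriesD1 _ _ 0%N)//=; last by move=> k _; exact: box_volume_ge0.
rewrite eseries0 ?adde0// => k _ /negPf ->.
by rewrite /box_volume big_ord_recl /= subrr maxxx mul0r.
Qed.

Definition coord_le (i : 'I_n.+1) (c : R) : set V := [set x | x ord0 i <= c].

(** A coordinate hyperplane cuts a box into two boxes whose volumes add up, so it cuts
    any cover by boxes into two covers. *)
Lemma coord_le_measurable i c : M (coord_le i c).
Proof.
apply: le_caratheodory_measurable => X.
apply: le_ereal_inf_tmp => _ [B XB <-].
pose lo (ab : V * V) : V * V :=
  (ab.1, \row_j if j == i then Num.min (ab.2 ord0 j) c else ab.2 ord0 j).
pose hi (ab : V * V) : V * V :=
  (\row_j (if j == i then Num.max (ab.1 ord0 j) c else ab.1 ord0 j), ab.2).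
have volE ab : (box_volume ab)%:E =
    ((box_volume (lo ab))%:E + (box_volume (hi ab))%:E)%E.
  have bvE (cd : V * V) : box_volume cd =
      Num.max 0 (cd.2 ord0 i - cd.1 ord0 i) *
      \prod_(j < n.+1 | j != i) Num.max 0 (cd.2 ord0 j - cd.1 ord0 j).
    by rewrite /box_volume (bigD1 i).
  rewrite -EFinD !bvE /=; congr EFin; rewrite !mxE eqxx.
  under [in RHS]eq_bigr => j ji do rewrite mxE (negbTE ji).
  under [in X in _ = _ + X]eq_bigr => j ji do rewrite mxE (negbTE ji).
  rewrite -mulrDl; congr (_ * _).
  by rewrite /Num.max /Num.min; do ! case: ifPn; lra.
under eq_eseriesr do rewrite volE.
rewrite nneseriesD; try by move=> k _ _; exact: box_volume_ge0.
apply: leeD; apply: ereal_inf_lbound;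
  [exists (lo \o B) => //|exists (hi \o B) => //].
- move=> x [Xx xc]; have [k _ Bkx] := XB _ Xx; exists k => // j.
  by rewrite /= !mxE; have := Bkx j; case: eqP => // -> /andP[-> xb]; rewrite le_min xb.
- move=> x [Xx /= /negP]; rewrite -ltNge => /ltW xc.
  have [k _ Bkx] := XB _ Xx; exists k => // j.
  by rewrite /= !mxE; have := Bkx j; case: eqP => // -> /andP[xb ->]; rewrite ge_max xb xc.
Qed.

(** Half-open, so that adjacent boxes are disjoint and tile larger ones. *)
Definition hbox a b : set V := [set x | forall i, a ord0 i < x ord0 i <= b ord0 i].

Lemma hbox_measurable a b : M (hbox a b).
Proof.
suff -> : hbox a b = \bigcap_(i in [set: 'I_n.+1])
    (coord_le i (b ord0 i) `\` coord_le i (a ord0 i)).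
  have /= := @fin_bigcap_measurable _ (caratheodory_type mu) _ setT
    (fun i => coord_le i (b ord0 i) `\` coord_le i (a ord0 i)).
  apply; first exact: finite_finset.
  move=> i _; apply: measurableD; exact: coord_le_measurable.
apply/seteqP; split=> [x abx i _|x abx i].
  by split => /=; have /andP[ax xb] := abx i => //; apply/negP; rewrite -ltNge.
by have [/= -> /negP] := abx i I; rewrite -ltNge => ->.
Qed.

Lemma nbhs_ballinf (x : V) (U : set V) : nbhs x U <->
  exists2 e, 0 < e & [set y : V | forall i, `|x ord0 i - y ord0 i| < e] `<=` U.
Proof.
split.
- move/nbhs_ballP => [e e0 eU]; exists e => // y xy; apply: eU.
  split=> // i j; rewrite ord1; exact: xy.
- move=> [e e0 eU]; apply/nbhs_ballP; exists e => // y [_ xy]; apply: eU => i.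
  exact: xy.
Qed.

Lemma hbox00 : hbox 0 0 = set0.
Proof.
by apply/seteqP; split=> // x /(_ ord0); rewrite !mxE => /andP[/lt_le_trans/[apply]]; rewrite ltxx.
Qed.

(** Boxes with rational corners: a countable basis makes open sets measurable and turns
    local nullity into nullity. *)
Lemma hbox_basis : exists F : nat -> V * V, forall (U : set V) x, open U -> U x ->
  exists2 k, hbox (F k).1 (F k).2 x & hbox (F k).1 (F k).2 `<=` U.
Proof.
exists (fun k => if unpickle k is Some ab
  then (map_mx ratr (ab : 'rV[rat]_n.+1 * 'rV[rat]_n.+1).1, map_mx ratr ab.2)
  else (0, 0)) => U x oU Ux.
have /nbhs_ballinf[e e0 eU] : nbhs x U by exact: open_nbhs_nbhs.
have /choice[a ha] : forall i, exists q : rat, x ord0 i - e < ratr q < x ord0 i.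
  move=> i; have /rat_in_itvoo[q] : x ord0 i - e < x ord0 i by lra.
  by rewrite in_itv/= => ?; exists q.
have /choice[b hb] : forall i, exists q : rat, x ord0 i < ratr q < x ord0 i + e.
  move=> i; have /rat_in_itvoo[q] : x ord0 i < x ord0 i + e by lra.
  by rewrite in_itv/= => ?; exists q.
pose ab := (\row_i a i, \row_i b i).
exists (pickle ab); rewrite pickleK /=.
  move=> i; rewrite !mxE.
  by have /andP[_ ->] := ha i; have /andP[/ltW -> _] := hb i.
move=> y aby; apply: eU => i; have := aby i; rewrite !mxE.
have /andP[? ?] := ha i; have /andP[? ?] := hb i => /andP[? ?].
by rewrite real_ltr_norml ?num_real//; apply/andP; split; lra.
Qed.

Lemma open_hbox_cover (U : set V) : open U ->
  exists F : nat -> V * V, U = \bigcup_k hbox (F k).1 (F k).2.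
Proof.
move=> oU; have [F basis] := hbox_basis.
exists (fun k => if `[< hbox (F k).1 (F k).2 `<=` U >] then F k else (0, 0)).
apply/seteqP; split=> [x /(basis _ _ oU)[k Fx FU]|x [k _]].
  by exists k => //; rewrite asboolT.
by case: asboolP => /= [FU /FU//|_]; rewrite hbox00.
Qed.

Lemma open_measurable_outer (U : set V) : open U -> M U.
Proof.
move=> /open_hbox_cover[F ->]; apply: caratheodory_measurable_bigcup => k.
exact: hbox_measurable.
Qed.

Lemma closed_measurable_outer (U : set V) : closed U -> M U.
Proof.
move=> cU; rewrite -(setCK U); apply: caratheodory_measurable_setC.
by apply: open_measurable_outer; exact: closed_openC.
Qed.

Lemma continuous_measurable_outer (f : V -> R) : continuous f ->
  measurable_fun (setT : set (caratheodory_type mu)) f.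
Proof.
move=> /continuousP cf; apply: (measurability _ (measurable_realfun.RGenOpens.measurableE R)).
move=> _ [_ [a [b ->] <-]]; rewrite setTI; apply: open_measurable_outer; apply: cf.
exact: interval_open.
Qed.

End measure_basics.

(** * Euclidean geometry *)

Lemma cvg_bigsum {R : realType} {T : Type} {I : finType} (F : set_system T)
    {FF : Filter F} (P : pred I) (f : I -> T -> R) (l : I -> R) :
  (forall i, P i -> f i x @[x --> F] --> l i) ->
  \sum_(i | P i) f i x @[x --> F] --> \sum_(i | P i) l i.
Proof.
move=> fl; rewrite [X in X @ _](_ : _ = \sum_(i | P i) f i); last first.
  by apply/funext => x; rewrite fct_sumE.
elim/big_ind2: _ => [|g a h b ga hb|i /fl//]; first exact: cvg_cst.
exact: cvgD.
Qed.

Section euclid.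
Context {R : realType} {n : nat}.
Local Notation V := 'rV[R]_n.
Implicit Types (x y z u c : V) (A B : set V).

Lemma dotC x y : dot x y = dot y x.
Proof. by apply: eq_bigr => i _; rewrite mulrC. Qed.

Lemma dotDl x y z : dot (x + y) z = dot x z + dot y z.
Proof. by rewrite /dot -big_split; apply: eq_bigr => i _; rewrite !mxE mulrDl. Qed.

Lemma dotZl (a : R) x y : dot (a *: x) y = a * dot x y.
Proof. by rewrite /dot big_distrr/=; apply: eq_bigr => i _; rewrite !mxE mulrA. Qed.

Lemma dotDr x y z : dot x (y + z) = dot x y + dot x z.
Proof. by rewrite dotC dotDl !(dotC x). Qed.

Lemma dotZr (a : R) x y : dot x (a *: y) = a * dot x y.
Proof. by rewrite dotC dotZl dotC. Qed.

Lemma dotNl x y : dot (- x) y = - dot x y.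
Proof. by rewrite -scaleN1r dotZl mulN1r. Qed.

Lemma dotNr x y : dot x (- y) = - dot x y.
Proof. by rewrite dotC dotNl dotC. Qed.

Definition dotE := (dotDl, dotDr, dotNl, dotNr, dotZl, dotZr).

Lemma dot_ge0 x : 0 <= dot x x.
Proof. by apply: sumr_ge0 => i _; rewrite -expr2 sqr_ge0. Qed.

Lemma dot0 x : dot 0 x = 0.
Proof. by rewrite -(scale0r x) dotZl mul0r. Qed.

Lemma dot_delta x i : dot x (delta_mx ord0 i) = x ord0 i.
Proof.
rewrite /dot (bigD1 i)//= !mxE !eqxx mulr1 big1 ?addr0// => j ji.
by rewrite mxE (negbTE ji) andbF mulr0.
Qed.

Lemma enorm_ge0 x : 0 <= enorm x.
Proof. exact: sqrtr_ge0. Qed.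

Lemma enorm_sqr x : enorm x ^+ 2 = dot x x.
Proof. by rewrite sqr_sqrtr// dot_ge0. Qed.

Lemma enorm0 : enorm (0 : V) = 0.
Proof. by rewrite /enorm dot0 sqrtr0. Qed.

Lemma enormN x : enorm (- x) = enorm x.
Proof. by rewrite /enorm !dotE opprK. Qed.

Lemma enormB x y : enorm (x - y) = enorm (y - x).
Proof. by rewrite -enormN opprB. Qed.

Lemma enormZ (a : R) x : enorm (a *: x) = `|a| * enorm x.
Proof.
by rewrite /enorm !dotE mulrA -expr2 sqrtrM ?sqr_ge0// sqrtr_sqr.
Qed.

Lemma le_coord_enorm x i : `|x ord0 i| <= enorm x.
Proof.
rewrite -(ler_pXn2r (ltn0Sn 1)) ?nnegrE ?enorm_ge0//.
rewrite real_normK ?num_real// enorm_sqr /dot (bigD1 i)//= -expr2 lerDl.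
by apply: sumr_ge0 => j _; rewrite -expr2 sqr_ge0.
Qed.

Lemma enorm_eq0 x : enorm x = 0 -> x = 0.
Proof.
move=> x0; apply/rowP => i; rewrite mxE; apply/normr0_eq0/eqP.
by rewrite eq_le normr_ge0 andbT -[X in _ <= X]x0 le_coord_enorm.
Qed.

Lemma cauchy_schwarz x y : dot x y <= enorm x * enorm y.
Proof.
have [y0|y0] := eqVneq (enorm y) 0.
  by rewrite y0 mulr0 (enorm_eq0 y0) dotC dot0.
have yy0 : 0 < dot y y by rewrite -enorm_sqr exprn_even_gt0.
have := dot_ge0 (dot y y *: x - dot x y *: y).
rewrite !dotE (dotC y x) => h.
have {}h : dot x y ^+ 2 <= dot x x * dot y y.
  rewrite -(ler_pM2l yy0); lra.
apply: le_trans (ler_norm _) _.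
rewrite -(ler_pXn2r (ltn0Sn 1)) ?nnegrE ?mulr_ge0 ?enorm_ge0//.
by rewrite real_normK ?num_real// exprMn !enorm_sqr.
Qed.

Lemma ler_enormD x y : enorm (x + y) <= enorm x + enorm y.
Proof.
rewrite -(ler_pXn2r (ltn0Sn 1)) ?nnegrE ?addr_ge0 ?enorm_ge0//.
rewrite sqrrD !enorm_sqr !dotE (dotC y x).
by have := cauchy_schwarz x y; lra.
Qed.

Lemma enorm_le_sum x : enorm x <= \sum_i `|x ord0 i|.
Proof.
have -> : enorm x = enorm (\sum_i x ord0 i *: delta_mx ord0 i).
  by congr enorm; apply: row_sum_delta.
elim/big_ind2: _ => [|a b c d ab cd|i _]; first by rewrite enorm0.
- exact: le_trans (ler_enormD _ _) (lerD ab cd).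
- rewrite enormZ /enorm dot_delta mxE !eqxx sqrtr1 mulr1; exact: lexx.
Qed.

Lemma dot_continuous u : continuous (fun x => dot x u).
Proof.
move=> x; apply: (@cvg_bigsum R V _ (nbhs x) _) => i _; apply: (@continuousM R V).
- exact: coord_continuous.
- exact: cst_continuous.
Qed.

Lemma sqdist_continuous c : continuous (fun x => dot (x - c) (x - c)).
Proof.
move=> x; rewrite /dot; apply: (@cvg_bigsum R V _ (nbhs x) _) => i _.
have cc : continuous (fun x : V => (x - c) ord0 i).
  move=> y; under eq_fun do rewrite !mxE.
  apply: (@continuousB R R V); [exact: coord_continuous|exact: cst_continuous].
by apply: (@continuousM R V); exact: cc.
Qed.

Lemma enorm_continuous c : continuous (fun x => enorm (x - c)).
Proof.
move=> x; rewrite /enorm.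
exact: (continuous_comp (@sqdist_continuous c x) (@sqrt_continuous _ _)).
Qed.

Definition cball c (r : R) : set V := [set x | enorm (x - c) <= r].
Definition oball c (r : R) : set V := [set x | enorm (x - c) < r].

Lemma cball_closed c r : closed (cball c r).
Proof.
rewrite (_ : cball c r = (fun x => enorm (x - c)) @^-1` [set t | t <= r])//.
by apply: closed_comp => [x _|]; [exact: enorm_continuous|exact: closed_le].
Qed.

Lemma oball_open c r : open (oball c r).
Proof.
rewrite (_ : oball c r = (fun x => enorm (x - c)) @^-1` [set t | t < r])//.
by apply: open_comp => [x _|]; [exact: enorm_continuous|exact: open_lt].
Qed.

Lemma oball_sub_cball c r : oball c r `<=` cball c r.
Proof. by move=> x /ltW. Qed.

Lemma cball_center c r : 0 <= r -> cball c r c.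
Proof. by rewrite /cball/= subrr enorm0. Qed.

Lemma oball_center c r : 0 < r -> oball c r c.
Proof. by rewrite /oball/= subrr enorm0. Qed.

Lemma cball_subset c d r s : enorm (c - d) + r <= s -> cball c r `<=` cball d s.
Proof.
move=> h x; rewrite /cball/= => xc; apply: le_trans h.
by rewrite -(subrKA c) (le_trans (ler_enormD _ _))// addrC lerD2l.
Qed.

Section reflection.
Context (u : V) (u1 : enorm u = 1).

Let uu : dot u u = 1. Proof. by rewrite -enorm_sqr u1 expr1n. Qed.

Lemma hreflB x y : hrefl u (x - y) = hrefl u x - hrefl u y.
Proof. by apply/rowP => i; rewrite /hrefl !dotE !mxE; ring. Qed.

Lemma hreflD x y : hrefl u (x + y) = hrefl u x + hrefl u y.
Proof. by apply/rowP => i; rewrite /hrefl !dotE !mxE; ring. Qed.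

Lemma hreflZ (a : R) x : hrefl u (a *: x) = a *: hrefl u x.
Proof. by apply/rowP => i; rewrite /hrefl !dotE !mxE; ring. Qed.

Lemma dot_hrefl x : dot (hrefl u x) u = - dot x u.
Proof. by rewrite /hrefl !dotE uu; ring. Qed.

Lemma hreflK : involutive (hrefl u).
Proof.
by move=> x; rewrite {1}/hrefl dot_hrefl /hrefl mulrN scaleNr opprK subrK.
Qed.

Lemma enorm_hrefl x : enorm (hrefl u x) = enorm x.
Proof. by rewrite /enorm /hrefl !dotE uu (dotC u x); congr Num.sqrt; ring. Qed.

Lemma hrefl_setE A : hrefl_set u A = hrefl u @^-1` A.
Proof.
apply/seteqP; split=> [_ [y Ay <-]|x Ax]; first by rewrite /preimage/= hreflK.
by exists (hrefl u x) => //; rewrite hreflK.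
Qed.

Lemma hrefl_set_cball c r : hrefl_set u (cball c r) = cball (hrefl u c) r.
Proof.
rewrite hrefl_setE; apply/seteqP; split=> x; rewrite /cball/=;
  by rewrite -[in X in X -> _]enorm_hrefl hreflB hreflK.
Qed.

End reflection.

Lemma hreflNu u : hrefl (- u) = hrefl u.
Proof. by apply/funext => x; apply/rowP => i; rewrite /hrefl !dotE !mxE; ring. Qed.

End euclid.

Lemma norm_le_enorm {R : realType} {n} (x : 'rV[R]_n) : `|x| <= enorm x.
Proof.
rewrite [leLHS]/Num.norm /= mx_normrE; apply: bigmax_le; first exact: enorm_ge0.
by move=> [i j] _ /=; rewrite ord1 le_coord_enorm.
Qed.

Lemma compact_cball {R : realType} {n} (c : 'rV[R]_n) r : compact (cball c r).
Proof.
apply: bounded_closed_compact; last exact: cball_closed.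
exists (r + enorm c); split; first exact: num_real.
move=> M hM x xc /=; apply/ltW/(le_lt_trans _ hM).
apply: (le_trans (norm_le_enorm _)); rewrite -(subrK c x).
by rewrite (le_trans (ler_enormD _ _))// lerD2r.
Qed.

(** * Null sets *)

Section null_sets.
Context {R : realType} {n : nat}.
Local Notation V := 'rV[R]_n.+1.
Local Notation mu := (@lebesgue_outer R n).
Local Notation M := (lebesgue_outer.-caratheodory).
Implicit Types (A B X : set V).

Lemma outer_le A B : A `<=` B -> (mu A <= mu B)%E.
Proof. exact: le_lebesgue_outer. Qed.

Lemma outer_ge0 A : (0 <= mu A)%E.
Proof. exact: lebesgue_outer_ge0. Qed.

Lemma outerU A B : (mu (A `|` B) <= mu A + mu B)%E.
Proof. exact: (outer_measureU2 (@lebesgue_outer R n)). Qed.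

Lemma outer_split B X : M B -> mu X = (mu (X `&` B) + mu (X `\` B))%E.
Proof. by move=> mB; exact: mB. Qed.

Lemma null_subset A B : A `<=` B -> mu B = 0%E -> mu A = 0%E.
Proof. by move=> AB B0; apply/eqP; rewrite eq_le outer_ge0 andbT -B0 outer_le. Qed.

Lemma null_bigcup (F : nat -> set V) :
  (forall k, mu (F k) = 0%E) -> mu (\bigcup_k F k) = 0%E.
Proof.
move=> F0; apply/eqP; rewrite eq_le outer_ge0 andbT.
rewrite (le_trans (lebesgue_outer_sigma_subadditive F))//.
by rewrite eseries0// => k _ _; exact: F0.
Qed.

Lemma nullU A B : mu A = 0%E -> mu B = 0%E -> mu (A `|` B) = 0%E.
Proof.
by move=> A0 B0; apply/eqP; rewrite eq_le outer_ge0 andbT (le_trans (outerU _ _))// A0 B0 adde0.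
Qed.

Lemma outer_null_diff A B : mu (A `\` B) = 0%E -> (mu A <= mu B)%E.
Proof.
move=> AB0; have : A `<=` B `|` (A `\` B) by move=> x Ax; have [|] := pselect (B x); [left|right].
move/outer_le/le_trans; apply; rewrite (le_trans (outerU _ _))//.
by rewrite AB0 adde0.
Qed.

Lemma outer_fin A B : A `<=` B -> (mu B < +oo)%E -> mu A \is a fin_num.
Proof.
by move=> AB Boo; rewrite ge0_fin_numE ?outer_ge0// (le_lt_trans _ Boo)// outer_le.
Qed.

Lemma cball_fin (c : V) r : (mu (cball c r) < +oo)%E.
Proof.
pose ab : V * V := (\row_i (c ord0 i - r), \row_i (c ord0 i + r)).
apply: (@le_lt_trans _ _ (mu (box ab))).
  apply: outer_le => x xc i; rewrite !mxE /=.
  have := le_trans (le_coord_enorm (x - c) i) xc.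
  by rewrite !mxE ler_norml => /andP[? ?]; apply/andP; split; lra.
by rewrite (le_lt_trans (lebesgue_outer_box _))// ltry.
Qed.

Lemma compact_fin (C : set V) : compact C -> exists r : R, C `<=` cball 0 r.
Proof.
move=> /compact_bounded[r [rr hr]]; exists (n.+1%:R * (r + 1)) => x Cx.
rewrite /cball/= subr0 (le_trans (enorm_le_sum _))//.
rewrite [leRHS](_ : _ = \sum_(i < n.+1) (r + 1)); last first.
  by rewrite sumr_const card_ord mulr_natl.
apply: ler_sum => i _; apply: (@le_trans _ _ `|x|).
  rewrite [leRHS]/Num.norm/= mx_normrE.
  exact: (@le_bigmax _ _ _ 0 (fun i => `|x i.1 i.2|) (ord0, i)).
by apply: hr => //; rewrite ltrDl.
Qed.

(** Infinitely many disjoint sets, all of measure above one positive bound, do not fit in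
    a set of finite measure. *)
Lemma disjoint_copies_null (F : nat -> set V) B A : (mu B < +oo)%E ->
  (forall k, M (F k)) -> (forall k, F k `<=` B) ->
  (forall j k, (j < k)%N -> F j `&` F k = set0) ->
  (forall k, (mu A <= mu (F k))%E) -> mu A = 0%E.
Proof.
move=> Boo mF FB dF AF.
have ABle : (mu A <= mu B)%E by rewrite (le_trans (AF 0%N))// outer_le.
have [a aE] : exists a, mu A = a%:E.
  by exists (fine (mu A)); rewrite fineK// ge0_fin_numE ?outer_ge0// (le_lt_trans ABle).
have [b bE] : exists b, mu B = b%:E.
  by exists (fine (mu B)); rewrite fineK// ge0_fin_numE ?outer_ge0.
have key m : forall X, (forall k, (k < m)%N -> F k `<=` X) ->
    ((m%:R * a)%:E <= mu X)%E.
  elim: m => [|m IH] X FX; first by rewrite mul0r outer_ge0.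
  rewrite (outer_split X (mF m)) -natr1 mulrDl mul1r addrC EFinD leeD//.
    rewrite -aE (le_trans (AF m))// outer_le// => x Fx; split=> //.
    exact: FX Fx.
  apply: IH => k km x Fkx; split; first by apply: FX Fkx; rewrite ltnW.
  by move=> Fmx; have : (F k `&` F m) x by []; rewrite dF.
apply/eqP; rewrite eq_le outer_ge0 andbT aE lee_fin leNgt; apply/negP => a0.
have := key (Num.truncn (b / a)).+1 B (fun k _ => FB k).
rewrite bE lee_fin leNgt => /negP; apply.
by rewrite -ltr_pdivrMr// truncnS_gt.
Qed.

End null_sets.

(** * Comparison with Lebesgue measure *)

Lemma cvg_bigprod {R : realType} {T : Type} {I : finType} (F : set_system T)
    {FF : Filter F} (P : pred I) (f : I -> T -> R) (l : I -> R) :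
  (forall i, P i -> f i x @[x --> F] --> l i) ->
  \prod_(i | P i) f i x @[x --> F] --> \prod_(i | P i) l i.
Proof.
move=> fl; elim: (index_enum I) => [|i s IH].
  by rewrite big_nil; under eq_fun do rewrite big_nil; exact: cvg_cst.
rewrite big_cons; under eq_fun do rewrite big_cons.
by case: ifPn => // Pi; apply: cvgM => //; exact: fl.
Qed.

Section comparison.
Context {R : realType} {n : nat}.
Local Notation V := 'rV[R]_n.+1.
Local Notation mu := (@lebesgue_outer R n).
Local Notation M := (lebesgue_outer.-caratheodory).
Implicit Types (A B X : set V) (a b : V).

Definition hcube a (s : R) : set V := hbox a (a + const_mx s).

Lemma hcubeP a s x : hcube a s x <-> forall i, a ord0 i < x ord0 i <= a ord0 i + s.
Proof.
by split=> ax i; have := ax i; rewrite !mxE.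
Qed.

Lemma hcube_dilate a s : 0 < s -> hcube a s = dilate s a @` hcube 0 1.
Proof.
move=> s0; apply/seteqP; split=> [x /hcubeP ax|_ [x /hcubeP ax <-]].
  exists (dilate s^-1 (- (s^-1 *: a)) x).
    apply/hcubeP => i; rewrite /dilate !mxE -mulrBr add0r.
    have /andP[? ?] := ax i; apply/andP; split.
      by rewrite pmulr_rgt0 ?invr_gt0// subr_gt0.
    by rewrite ler_pdivrMl// mulr1; lra.
  by rewrite /dilate scalerDr scalerN !scalerA mulfV ?gt_eqF// !scale1r subrK.
apply/hcubeP => i; rewrite /dilate !mxE; have := ax i; rewrite !mxE add0r.
move=> /andP[x0 x1]; rewrite ltrDr pmulr_rgt0// x0/= addrC lerD2l.
by rewrite -[leRHS]mulr1 ler_pM2l.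
Qed.

Definition inflate (ab : V * V) (d : R) : V * V :=
  (ab.1 - const_mx d, ab.2 + const_mx d).

Lemma box_volume_inflate_cvg (ab : V * V) (d : nat -> R) : d @ \oo --> 0 ->
  box_volume (inflate ab (d k)) @[k --> \oo] --> box_volume ab.
Proof.
move=> d0; apply: (@cvg_bigprod _ _ _ \oo _) => i _ /=.
have -> : ab.2 ord0 i - ab.1 ord0 i = (ab.2 ord0 i - ab.1 ord0 i) + (0 + 0) by rewrite !addr0.
under eq_fun do rewrite !mxE.
apply: continuous_cvg.
  apply: continuous_max; [exact: cst_continuous|exact: cvg_id].
rewrite (_ : (fun x => _) = fun x => (ab.2 ord0 i - ab.1 ord0 i) + (d x + d x)); last first.
  by apply/funext => x; ring.
by apply: cvgD; [exact: cvg_cst|exact: cvgD].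
Qed.

Definition grid_box a (s : R) (m : 'I_n.+1 -> nat) : set V :=
  hbox a (\row_i (a ord0 i + s * (m i)%:R)).

(** A box of side lengths [s * m i] is cut into cubes of side [s], one slice at a time. *)
Lemma grid_ind (s : R) (Q : V -> ('I_n.+1 -> nat) -> Prop) :
  (forall a m i, m i = 0%N -> Q a m) ->
  (forall a, Q a (fun=> 1%N)) ->
  (forall a m i p, m i = p.+2 ->
    Q a (fun j => if j == i then 1%N else m j) ->
    Q (a + s *: delta_mx ord0 i) (fun j => if j == i then p.+1 else m j) ->
    Q a m) ->
  forall a m, Q a m.
Proof.
move=> Q0 Q1 QS a m; have [N] := ubnP (\sum_i m i)%N.
elim: N a m => // N IH a m mN.
have [[i mi0]|m0] := pselect (exists i, m i = 0%N); first exact: Q0 mi0.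
have [[i mi2]|m1] := pselect (exists i, (2 <= m i)%N); last first.
  rewrite (_ : m = fun=> 1%N)//; apply/funext => i; apply/eqP.
  rewrite eqn_leq; apply/andP; split.
    by rewrite leqNgt; apply/negP => ?; apply: m1; exists i.
  by rewrite lt0n; apply/eqP => ?; apply: m0; exists i.
have sumE c : (\sum_j (if j == i then c else m j) + m i = \sum_j m j + c)%N.
  rewrite (bigD1 i)//= eqxx [in RHS](bigD1 i)//=.
  under eq_bigr => j ji do rewrite (negbTE ji).
  lia.
case mip : (m i) mi2 => [|[|p]]// _; apply: (QS a m i p mip); apply: IH.
- rewrite -(ltn_add2r p.+2) -{1}mip sumE addn1 2!addnS 2!ltnS.
  exact: leq_trans (mN : (_ <= N)%N) (leq_addr _ _).
- by rewrite -(ltn_add2r p.+2) -{1}mip sumE [X in (_ < X)%N]addnS ltnS leq_add2r.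
Qed.

Lemma grid_box0 a s m i : m i = 0%N -> grid_box a s m = set0.
Proof.
move=> mi0; apply/seteqP; split => // x /(_ i); rewrite mxE mi0 mulr0 addr0.
by move=> /andP[/lt_le_trans/[apply]]; rewrite ltxx.
Qed.

Lemma grid_box1 a s : grid_box a s (fun=> 1%N) = hcube a s.
Proof.
by rewrite /grid_box /hcube; congr hbox; apply/rowP => i; rewrite !mxE mulr1.
Qed.

Lemma grid_boxS a (s : R) m i p : m i = p.+2 -> 0 <= s ->
  let lo := grid_box a s (fun j => if j == i then 1%N else m j) in
  let hi := grid_box (a + s *: delta_mx ord0 i) s
                     (fun j => if j == i then p.+1 else m j) in
  grid_box a s m = lo `|` hi /\ lo `&` hi = set0.
Proof.
move=> mi s0; move bE : (a + s *: delta_mx ord0 i) => b lo hi.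
have {}bE j : b ord0 j = if j == i then a ord0 i + s else a ord0 j.
  by rewrite -bE !mxE eqxx /=; case: eqP => [->|_]; rewrite ?mulr1// mulr0 addr0.
have gE x : grid_box a s m x <->
    forall j, a ord0 j < x ord0 j <= a ord0 j + s * (m j)%:R.
  by split => h j; have := h j; rewrite !mxE.
have loE x : lo x <-> forall j, a ord0 j < x ord0 j <=
    if j == i then a ord0 i + s else a ord0 j + s * (m j)%:R.
  by split => h j; have := h j; rewrite !mxE; case: eqP => // ->; rewrite mulr1.
have hiE x : hi x <-> forall j, (if j == i then a ord0 i + s else a ord0 j)
    < x ord0 j <= a ord0 j + s * (m j)%:R.
  have aE : a ord0 i + s + s * p.+1%:R = a ord0 i + s * (m i)%:R.
    by rewrite mi -(natr1 p.+1); ring.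
  by split => h j; have := h j; rewrite mxE bE; case: (eqVneq j i) => [->|//]; rewrite aE.
have smi : s <= s * (m i)%:R by rewrite mi ler_peMr// ler1n.
split; last first.
  apply/seteqP; split => [x [lx hx]|//].
  move/loE/(_ i) : lx; move/hiE/(_ i) : hx.
  by rewrite eqxx => /andP[/lt_le_trans h _] /andP[_ /h]; rewrite ltxx.
apply/seteqP; split => [x /gE gx|x [/loE lx|/hiE hx]].
- have [xi|xi] := leP (x ord0 i) (a ord0 i + s); [left; apply/loE|right; apply/hiE];
    move=> j; have := gx j; case: eqVneq => [->|//] /andP[h1 h2].
  + by rewrite h1.
  + by rewrite xi.
- apply/gE => j; have := lx j; case: eqP => // -> /andP[-> xi] /=.
  by rewrite (le_trans xi)// lerD2l.
- apply/gE => j; have := hx j; case: eqP => // -> /andP[xi ->]; rewrite andbT.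
  by rewrite (le_lt_trans _ xi)// lerDl.
Qed.

Lemma natprod_split (m : 'I_n.+1 -> nat) i p : m i = p.+2 ->
  (\prod_j m j = \prod_j (if j == i then 1 else m j) +
                  \prod_j (if j == i then p.+1 else m j))%N.
Proof.
move=> mi; have E c : (\prod_j (if j == i then c else m j) =
    c * \prod_(j | j != i) m j)%N.
  by rewrite (bigD1 i)//= eqxx; congr muln; apply: eq_bigr => j /negPf ->.
by rewrite !E (bigD1 i)//= mi -mulnDl.
Qed.

Lemma grid_box_le (nu : {outer_measure set V -> \bar R}) (s e : R) :
  0 <= s -> 0 <= e -> (forall a, (nu (hcube a s) <= e%:E)%E) ->
  forall a m, (nu (grid_box a s m) <= ((\prod_j m j)%:R * e)%:E)%E.
Proof.
move=> s0 e0 nue; apply: (@grid_ind s) => [a m i mi0|a|a m i p mi IH1 IH2].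
- by rewrite (grid_box0 _ _ mi0) outer_measure0 lee_fin mulr_ge0.
- by rewrite grid_box1 big1// mul1r.
- have [-> _] := grid_boxS a mi s0.
  rewrite (le_trans (outer_measureU2 nu _ _))// (natprod_split mi) natrD mulrDl EFinD.
  exact: leeD.
Qed.

Lemma grid_box_ge (A : set V) (s e : R) a m : 0 <= s ->
  (forall b, hcube b s `<=` grid_box a s m -> (e%:E <= mu (A `&` hcube b s))%E) ->
  (((\prod_j m j)%:R * e)%:E <= mu (A `&` grid_box a s m))%E.
Proof.
move=> s0; move: a m; apply: (@grid_ind s) => [a m i mi0|a|a m i p mi IH1 IH2 hA].
- by rewrite (grid_box0 _ _ mi0) setI0 lebesgue_outer0 (bigD1 i)//= mi0 !mul0r.
- by rewrite grid_box1 big1// mul1r; apply.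
- have [gE d0] := grid_boxS a mi s0.
  rewrite (natprod_split mi) natrD mulrDl EFinD.
  set lo := grid_box a s (fun j => if j == i then 1%N else m j) in gE d0 IH1 *; set hi := grid_box (_ + _) s _ in gE d0 IH2 *.
  have -> : mu (A `&` grid_box a s m) = (mu (A `&` lo) + mu (A `&` hi))%E.
    rewrite [LHS](@outer_split _ _ lo); last exact: hbox_measurable.
    congr adde; apply: (congr1 mu); rewrite gE; apply/seteqP; split => x.
    + by move=> [[Ax _] lx].
    + by move=> [Ax lx]; split => //; split => //; left.
    + by move=> [[Ax [//|hx]] nlx].
    + move=> [Ax hx]; split; first by split => //; right.
      by move=> lx; have : (lo `&` hi) x by []; rewrite d0.
  apply: leeD; [apply: IH1|apply: IH2] => b bs; apply: hA; rewrite gE;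
    by [apply: subset_trans bs _; exact: subsetUl|apply: subset_trans bs _; exact: subsetUr].
Qed.

(** Small grid cells fill a box without much waste, so a bound of [nu] on small cubes
    passes to boxes, and through covers by boxes to all sets. This serves for the
    reflected Lebesgue measure, and for Lebesgue measure restricted to a set that meets
    all small cubes of one size alike. *)
Lemma lebesgue_outer_dominates (nu : {outer_measure set V -> \bar R}) (c L : R)
    (k0 : nat) : 0 <= c -> 0 < L ->
  (forall k a, (k0 <= k)%N ->
    (nu (hcube a (L / k.+1%:R)) <= (c * (L / k.+1%:R) ^+ n.+1)%:E)%E) ->
  forall A, (nu A <= c%:E * mu A)%E.
Proof.
move=> c0 L0 hnu.
suff hbx ab : (nu (box ab) <= (c * box_volume ab)%:E)%E.
  have cover A (B : nat -> V * V) : A `<=` \bigcup_k box (B k) ->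
      (nu A <= c%:E * \sum_(k <oo) (box_volume (B k))%:E)%E.
    move=> AB; rewrite (le_trans (le_outer_measure nu _ _ AB))//.
    rewrite (le_trans (outer_measure_sigma_subadditive nu _))//.
    rewrite -nneseriesZl//; last by move=> k _; exact: box_volume_ge0.
    by apply: lee_nneseries => k *; [exact: outer_measure_ge0|rewrite -EFinM].
  move=> A; have [cE|cn0] := eqVneq c 0.
    have [B AB] : exists B : nat -> V * V, A `<=` \bigcup_k box (B k).
      exists (fun k => (const_mx (- k%:R), const_mx k%:R)) => x _.
      exists (Num.truncn `|x|).+1 => // i; rewrite /= !mxE -ler_norml.
      apply: le_trans (ltW (truncnS_gt _)).
      rewrite [leRHS]/Num.norm/= mx_normrE.
      exact: (@le_bigmax _ _ _ 0 (fun i => `|x i.1 i.2|) (ord0, i)).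
    by have := cover A B AB; rewrite cE !mul0e.
  have cp : 0 < c by rewrite lt_neqAle eq_sym cn0.
  rewrite -lee_pdivrMl//; apply: le_ereal_inf_tmp => _ [B AB <-].
  by rewrite lee_pdivrMl// cover.
have [abp|/existsNP[i /negP]] := pselect (forall i, ab.1 ord0 i <= ab.2 ord0 i); last first.
  rewrite -ltNge => abi; rewrite (_ : box ab = set0) ?outer_measure0 ?lee_fin ?mulr_ge0 ?box_volume_nonneg//.
  by apply/seteqP; split => // x /(_ i) /andP[/le_trans/[apply]]; rewrite leNgt abi.
pose s k : R := L / k.+1%:R.
have s_gt0 k : 0 < s k by rewrite divr_gt0.
have s_cvg : s k @[k --> \oo] --> 0.
  by rewrite -[X in _ --> X](mulr0 L); apply: cvgM; [exact: cvg_cst|exact: cvg_harmonic].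
have bnd k : (k0 <= k)%N -> (nu (box ab) <= (c * box_volume (inflate ab (s k)))%:E)%E.
  move=> k0k; pose m (i : 'I_n.+1) := (Num.truncn ((ab.2 ord0 i - ab.1 ord0 i) / s k)).+2.
  have abm : box ab `<=` grid_box (ab.1 - const_mx (s k)) (s k) m.
    move=> x abx i; rewrite !mxE; have /andP[ax xb] := abx i; apply/andP; split.
      by have := s_gt0 k; lra.
    have := truncnS_gt ((ab.2 ord0 i - ab.1 ord0 i) / s k).
    rewrite ltr_pdivrMr// /m -(natr1 (Num.truncn _).+1); lra.
  rewrite (le_trans (le_outer_measure nu _ _ abm))//.
  have s0 := ltW (s_gt0 k).
  rewrite (le_trans (@grid_box_le nu (s k) (c * s k ^+ n.+1) s0 _ _ _ _))//.
  - by rewrite mulr_ge0// exprn_ge0.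
  - by move=> a; exact: hnu.
  rewrite lee_fin mulrCA ler_wpM2l//.
  rewrite natr_prod -[in s k ^+ _](card_ord n.+1) -prodr_const -big_split/=.
  apply: ler_prod => i _; rewrite mulr_ge0//= le_max !mxE; apply/orP; right.
  have := truncn_le ((ab.2 ord0 i - ab.1 ord0 i) / s k).
  rewrite divr_ge0 ?subr_ge0//; rewrite ler_pdivlMr// /m -(natr1 (Num.truncn _).+1) -(natr1 (Num.truncn _)); lra.
have nufin : nu (box ab) \is a fin_num.
  by rewrite ge0_fin_numE ?outer_measure_ge0// (le_lt_trans (bnd k0 _))// ltry.
rewrite -(fineK nufin) lee_fin.
have cv : c * box_volume (inflate ab (s k)) @[k --> \oo] --> c * box_volume ab.
  by apply: cvgM; [exact: cvg_cst|exact: box_volume_inflate_cvg].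
apply: (cvgr_to_ge cv); near=> k; rewrite -lee_fin fineK//; apply: bnd; near: k; exact: nbhs_infty_ge.
Unshelve. all: by end_near. Qed.

End comparison.

(** * Regularity *)

Section regularity.
Context {R : realType} {n : nat}.
Local Notation V := 'rV[R]_n.+1.
Local Notation mu := (@lebesgue_outer R n).
Local Notation M := (lebesgue_outer.-caratheodory).
Implicit Types (A B X U : set V) (a b : V).

Lemma box_open_superset (ab : V * V) (e : R) : 0 < e -> exists U : set V,
  [/\ open U, box ab `<=` U & (mu U <= (box_volume ab + e)%:E)%E].
Proof.
move=> e0; have /cvgr_lt : box_volume (inflate ab (k.+1%:R^-1)) @[k --> \oo] --> box_volume ab.
  by apply: box_volume_inflate_cvg; exact: cvg_harmonic.
move=> /(_ (box_volume ab + e)); rewrite ltrDl => /(_ e0)[k _ /(_ k (leqnn _)) /= hk].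
have k0 : 0 < k.+1%:R^-1 :> R by rewrite invr_gt0.
set s := k.+1%:R^-1 in hk k0.
exists (box (inflate ab s))°; split.
- exact: open_interior.
- move=> x abx; apply/nbhs_ballinf; exists s => // y /= xy i.
  have := abx i; have := xy i; rewrite !mxE ltr_norml => /andP[? ?] /andP[? ?].
  by apply/andP; split; lra.
- rewrite (le_trans (outer_le (@interior_subset _ _)))//.
  rewrite (le_trans (lebesgue_outer_box _))// lee_fin; exact: ltW.
Qed.

Lemma outer_regular A (e : R) : 0 < e -> (mu A < +oo)%E ->
  exists U, [/\ open U, A `<=` U & (mu U <= mu A + e%:E)%E].
Proof.
move=> e0 Aoo; have e20 : 0 < e / 2 by rewrite divr_gt0.
have Afin : mu A \is a fin_num by rewrite ge0_fin_numE ?outer_ge0.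
have [_ [B AB <-] Blt] := lb_ereal_inf_adherent e20 Afin.
have ek k : 0 < e / 2 / (2 ^ k.+1)%:R by rewrite divr_gt0// ltr0n expn_gt0.
have /choice[U hU] k := box_open_superset (B k) (ek k).
exists (\bigcup_k U k); split.
- by apply: bigcup_open => k _; have [] := hU k.
- by move=> x /AB[k _ Bkx]; exists k => //; have [_ + _] := hU k; apply.
rewrite (le_trans (lebesgue_outer_sigma_subadditive U))//.
apply: (@le_trans _ _ (\sum_(k <oo) ((box_volume (B k))%:E + (e / 2 / (2 ^ k.+1)%:R)%:E))%E).
  apply: lee_nneseries => k *; first exact: outer_ge0.
  by rewrite -EFinD; have [] := hU k.
apply: (le_trans (epsilon_trick _ _ (ltW e20))) => [k|].
- exact: box_volume_ge0.
- rewrite [in leRHS](splitr e) EFinD addeA leeD2r//; exact: ltW.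
Qed.

(** Inside a large ball, the complement of [A] has open supersets of nearly the
    same measure; their complements are the required compact sets. *)
Lemma inner_regular A : M A -> exists C : nat -> nat -> set V,
  [/\ forall j k, compact (C j k), forall j k, C j k `<=` A &
      mu (A `\` \bigcup_j \bigcup_k C j k) = 0%E].
Proof.
move=> mA; pose B j : set V := cball 0 j%:R.
have mB j : M (B j) by apply: closed_measurable_outer; exact: cball_closed.
have mBA j : M (B j `\` A) by exact: caratheodory_measurable_setD.
have finBA j : (mu (B j `\` A) < +oo)%E.
  by rewrite (le_lt_trans (outer_le (@subDsetl _ _ _)))// cball_fin.
have e_gt0 k : 0 < k.+1%:R^-1 :> R by rewrite invr_gt0.
have /choice[U hU] : forall jk : nat * nat, exists U, [/\ open U, B jk.1 `\` A `<=` U &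
    (mu U <= mu (B jk.1 `\` A) + (jk.2.+1%:R^-1)%:E)%E].
  by move=> [j k] /=; exact: outer_regular.
have UE j k : B j `&` A `\` (B j `\` U (j, k)) `<=` U (j, k) `\` (B j `\` A).
  move=> x [[Bx Ax] h]; have Ux : U (j, k) x by apply: contrapT => nUx; apply: h.
  by split => // -[].
exists (fun j k => B j `\` U (j, k)); split.
- move=> j k; apply: (@subclosed_compact _ _ (B j)) => //.
  + by apply: closedI; [exact: cball_closed|apply: open_closedC; have [] := hU (j, k)].
  + exact: compact_cball.
- by move=> j k x [Bx nUx]; apply: contrapT => nAx; apply: nUx;
    have [_ + _] := hU (j, k); apply.
apply: (@null_subset _ _ _ (\bigcup_j (B j `&` A `\` \bigcup_k (B j `\` U (j, k))))).
  move=> x [Ax nx]; exists (Num.truncn (enorm x)).+1 => //; split.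
    by split => //; rewrite /B/cball/= subr0 ltW// truncnS_gt.
  by move=> [k _ h]; apply: nx; exists (Num.truncn (enorm x)).+1 => //; exists k.
apply: null_bigcup => j; apply/eqP; rewrite eq_le outer_ge0 andbT.
apply/lee_addgt0Pr => e e0; rewrite add0e.
have [k ke] : exists k, k.+1%:R^-1 <= e.
  exists (Num.truncn e^-1); rewrite -[leRHS]invrK lef_pV2 ?posrE ?invr_gt0//.
  by rewrite ltW// truncnS_gt.
apply: (@le_trans _ _ (mu (U (j, k) `\` (B j `\` A)))).
  apply: outer_le; apply: subset_trans (UE j k) => x [h1 h2]; split => // h3.
  by apply: h2; exists k.
have [oU BAU] := hU (j, k); rewrite /= (outer_split _ (mBA j)) => hle.
apply: (@le_trans _ _ (k.+1%:R^-1)%:E); last by rewrite lee_fin.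
move: hle; rewrite (_ : U (j, k) `&` (B j `\` A) = B j `\` A); last exact/setIidr.
by rewrite leeD2lE// ge0_fin_numE ?outer_ge0.
Qed.

End regularity.

(** * Invariance under reflections *)

Section reflection_invariance.
Context {R : realType} {n : nat}.
Local Notation V := 'rV[R]_n.+1.
Local Notation mu := (@lebesgue_outer R n).
Local Notation M := (lebesgue_outer.-caratheodory).
Implicit Types (A B X U : set V) (a b c : V).

Lemma cball_dilate c (r s : R) : 0 < s -> cball c (s * r) = dilate s c @` cball 0 r.
Proof.
move=> s0; apply/seteqP; split => [x|_ [x + <-]]; rewrite /cball/=.
- move=> xc; exists (s^-1 *: (x - c)); last first.
    by rewrite /dilate scalerA mulfV ?gt_eqF// scale1r subrK.
  by rewrite /= subr0 enormZ gtr0_norm ?invr_gt0// ler_pdivrMl.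
- by rewrite subr0 /dilate addrK enormZ gtr0_norm// ler_pM2l.
Qed.

Lemma outer_cball c (r s : R) : 0 < s ->
  mu (cball c (s * r)) = ((s ^+ n.+1)%:E * mu (cball 0%R r))%E.
Proof. by move=> s0; rewrite cball_dilate// lebesgue_outer_dilate. Qed.

Lemma outer_cball_center c c' r : mu (cball c r) = mu (cball c' r).
Proof. by rewrite -(mul1r r) !outer_cball. Qed.

(** Lebesgue measure degenerates everywhere or nowhere: this settles the cases in which
    a ball has measure zero. *)
Lemma null_ball_all c r A : 0 < r -> mu (cball c r) = 0%E -> mu A = 0%E.
Proof.
move=> r0 Bnull; apply: (@null_subset _ _ _ (\bigcup_k cball 0 k.+1%:R)).
  move=> x _; exists (Num.truncn (enorm x)) => //.
  by rewrite /cball/= subr0 ltW// truncnS_gt.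
apply: null_bigcup => k; rewrite -[k.+1%:R](divfK (lt0r_neq0 r0)) outer_cball ?divr_gt0//.
by rewrite (outer_cball_center _ c) Bnull mule0.
Qed.

Context (u : V) (u1 : enorm u = 1).

Lemma hrefl_set_dilate s a A :
  hrefl_set u (dilate s a @` A) = dilate s (hrefl u a) @` hrefl_set u A.
Proof.
rewrite /hrefl_set !image_comp; apply: eq_imagel => x _ /=.
by rewrite /dilate hreflD// hreflZ.
Qed.

Let nu A := mu (hrefl_set u A).

Let nu0 : nu set0 = 0%E. Proof. by rewrite /nu /hrefl_set image_set0 lebesgue_outer0. Qed.

Let nu_ge0 A : (0 <= nu A)%E. Proof. exact: outer_ge0. Qed.

Let le_nu : {homo nu : A B / A `<=` B >-> (A <= B)%E}.
Proof. by move=> A B AB; apply: outer_le; exact: image_subset. Qed.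

Let nu_sigma : sigma_subadditive nu.
Proof.
by move=> F; rewrite /nu /hrefl_set image_bigcup; exact: lebesgue_outer_sigma_subadditive.
Qed.

HB.instance Definition _ := isOuterMeasure.Build R V nu nu0 nu_ge0 le_nu nu_sigma.

(** The reflected measure is at most [c] times Lebesgue measure, where [c] is its value on
    the unit cube. A ball inside the cube is reflected onto a translate of itself, so it
    keeps its measure, and the bound on the rest of the cube then forces [c <= 1]. *)
Lemma lebesgue_outer_hrefl_le A : (mu (hrefl_set u A) <= mu A)%E.
Proof.
pose Q : set V := hcube 0 1.
pose m0 : V := const_mx 2^-1.
have [c cE] : exists c : R, nu Q = c%:E.
  exists (fine (nu Q)); rewrite fineK// /nu.
  have QB : Q `<=` cball 0 n.+1%:R.
    move=> x /hcubeP xQ; rewrite /cball/= subr0 (le_trans (enorm_le_sum _))//.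
    rewrite [leRHS](_ : _ = \sum_(i < n.+1) 1); last by rewrite sumr_const card_ord.
    apply: ler_sum => i _; have := xQ i; rewrite mxE add0r => /andP[? ?].
    by rewrite ger0_norm// ltW.
  apply: (@outer_fin _ _ _ (hrefl_set u (cball 0 n.+1%:R))); first exact: image_subset.
  by rewrite hrefl_set_cball// cball_fin.
have c0 : 0 <= c by rewrite -lee_fin -cE.
have nuE s a : 0 < s -> nu (hcube a s) = (c * s ^+ n.+1)%:E.
  move=> s0; rewrite mulrC EFinM -cE hcube_dilate//.
  by rewrite /nu hrefl_set_dilate lebesgue_outer_dilate.
have dom B : (nu B <= c%:E * mu B)%E.
  apply: (@lebesgue_outer_dominates _ _ nu c 1 0%N) => // k a _.
  by rewrite -(nuE _ a)// divr_gt0.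
have [bnull|bpos] := eqVneq (mu (cball m0 4^-1)) 0%E.
  by rewrite (null_ball_all _ _ bnull) ?outer_ge0// (null_ball_all _ _ bnull).
suff c1 : c <= 1.
  rewrite (le_trans (dom A))// -[leRHS]mul1e lee_wpmul2r ?outer_ge0// lee_fin//.
have BQ : cball m0 4^-1 `<=` Q.
  move=> x xB; apply/hcubeP => i; rewrite mxE add0r.
  have := le_trans (le_coord_enorm (x - m0) i) xB; rewrite !mxE ler_norml.
  by move=> /andP[? ?]; apply/andP; split; lra.
have Q1 : (mu Q <= 1)%E.
  apply: (@le_trans _ _ (mu (box (0, const_mx 1)))).
    by apply: outer_le => x /hcubeP xQ i; have := xQ i; rewrite !mxE add0r => /andP[/ltW -> ->].
  rewrite (le_trans (lebesgue_outer_box _))// lee_fin /box_volume/=.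
  by rewrite big1// => i _; rewrite !mxE subr0; apply/max_idPr.
have nuQ : (nu Q <= nu (cball m0 4^-1) + nu (Q `\` cball m0 4^-1))%E.
  apply: le_trans (outerU _ _); apply: outer_le.
  by rewrite /hrefl_set -image_setU; apply: image_subset; rewrite setDUK.
have mball : M (cball m0 4^-1) by apply: closed_measurable_outer; exact: cball_closed.
have /(le_trans nuQ) : (nu (cball m0 4^-1) + nu (Q `\` cball m0 4^-1) <=
    mu (cball m0 4^-1) + c%:E * mu (Q `\` cball m0 4^-1))%E.
  apply: leeD; last exact: dom.
  by rewrite /nu hrefl_set_cball// (outer_cball_center _ m0).
move: Q1; rewrite (outer_split Q mball) (setIidr BQ) cE.
have bfin : mu (cball m0 4^-1) \is a fin_num by rewrite ge0_fin_numE ?outer_ge0// cball_fin.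
have bp : 0 < fine (mu (cball m0 4^-1)).
  by rewrite -lte_fin fineK// lt_neqAle eq_sym bpos outer_ge0.
rewrite -(fineK bfin) => Q1.
have qfin : mu (Q `\` cball m0 4^-1) \is a fin_num.
  rewrite ge0_fin_numE ?outer_ge0// (le_lt_trans _ (ltry 1))//.
  by apply: le_trans Q1; rewrite leeDr// lee_fin ltW.
move: Q1; rewrite -(fineK qfin) -EFinM -!EFinD !lee_fin => Q1 hc.
set b := fine _ in bp Q1 hc; set q := fine _ in Q1 hc.
have : c * b <= b.
  by have := ler_wpM2l c0 Q1; rewrite mulrDr mulr1; lra.
by rewrite -[leRHS]mul1r ler_pM2r.
Qed.

Lemma hrefl_setK A : hrefl_set u (hrefl_set u A) = A.
Proof. by rewrite !hrefl_setE//; apply/seteqP; split => x; rewrite /preimage/= hreflK. Qed.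

Lemma lebesgue_outer_hrefl A : mu (hrefl_set u A) = mu A.
Proof.
apply/eqP; rewrite eq_le lebesgue_outer_hrefl_le/=.
by rewrite -{1}(hrefl_setK A) lebesgue_outer_hrefl_le.
Qed.

Lemma hrefl_set_measurable A : M A -> M (hrefl_set u A).
Proof.
move=> mA X; rewrite -(lebesgue_outer_hrefl X) (mA (hrefl_set u X)).
rewrite -(lebesgue_outer_hrefl (X `&` _)) -(lebesgue_outer_hrefl (X `&` ~` _)).
congr adde; apply: (congr1 mu); rewrite !hrefl_setE//; apply/seteqP; split => x;
  by rewrite /preimage/setI/= hreflK.
Qed.

End reflection_invariance.

(** * Null hypersurfaces *)

Section null_hypersurfaces.
Context {R : realType} {n : nat}.
Local Notation V := 'rV[R]_n.+1.
Local Notation mu := (@lebesgue_outer R n).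
Local Notation M := (lebesgue_outer.-caratheodory).

(** Concentric spheres of radii between [r] and [2 * r] are disjoint dilates, of no
    smaller measure. *)
Lemma null_sphere (c : V) r : 0 < r -> mu (cball c r `\` oball c r) = 0%E.
Proof.
move=> r0; pose s k : R := 1 + k.+1%:R^-1.
have s1 k : 1 < s k by rewrite ltrDl invr_gt0.
have s0 k : 0 < s k by rewrite (lt_trans ltr01).
pose S (t : R) : set V := cball c t `\` oball c t.
have SE t x : S t x <-> enorm (x - c) = t.
  split => [[xc /negP]|<-]; last by split; rewrite /cball /oball/= ?ltxx.
  by rewrite -leNgt => ?; apply/eqP; rewrite eq_le xc.
apply: (@disjoint_copies_null _ _ (fun k => S (s k * r)) (cball c (2 * r))).
- exact: cball_fin.
- move=> k; apply: caratheodory_measurable_setD.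
    by apply: closed_measurable_outer; exact: cball_closed.
  by apply: open_measurable_outer; exact: oball_open.
- move=> k x /SE xE; rewrite /cball/= xE ler_pM2r// /s -[2]/(1 + 1) lerD2l.
  by rewrite invf_le1// ler1n.
- move=> j k jk; apply/seteqP; split => // x [/SE xj /SE xk].
  have : s j * r = s k * r by rewrite -xj.
  move/(mulIf (lt0r_neq0 r0)) /addrI /invr_inj /eqP.
  by rewrite eqr_nat eqSS ltn_eqF.
- move=> k; apply: (@le_trans _ _ (mu (dilate (s k) (c - s k *: c) @` S r))); last first.
    apply: outer_le => _ [x /SE xE <-]; apply/SE.
    have -> : dilate (s k) (c - s k *: c) x - c = s k *: (x - c).
      by apply/rowP => i; rewrite /dilate !mxE; ring.
    by rewrite enormZ gtr0_norm// xE.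
  rewrite lebesgue_outer_dilate// -[leLHS]mul1e lee_wpmul2r ?outer_ge0// lee_fin.
  by rewrite exprn_ege1// ltW.
Qed.

(** A bounded piece has infinitely many disjoint translates in a ball. *)
Lemma null_hyperplane (u : V) : enorm u = 1 -> mu [set x | dot x u = 0] = 0%E.
Proof.
move=> u1; have uu : dot u u = 1 by rewrite -enorm_sqr u1 expr1n.
pose H j t : set V := [set x | dot x u = t] `&` cball (t *: u) j%:R.
have mH j t : M (H j t).
  apply: closed_measurable_outer; apply: closedI; last exact: cball_closed.
  rewrite (_ : [set x | _] = (fun x => dot x u) @^-1` [set t])//.
  by apply: closed_comp => [x _|]; [exact: dot_continuous|exact: closed_eq].
apply: (@null_subset _ _ _ (\bigcup_j H j 0)).
  move=> x Hx; exists (Num.truncn (enorm x)).+1 => //; split => //.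
  by rewrite /cball/= scale0r subr0 ltW// truncnS_gt.
apply: null_bigcup => j.
apply: (@disjoint_copies_null _ _ (fun k => H j k.+1%:R^-1) (cball 0 (1 + j%:R))).
- exact: cball_fin.
- by move=> k; exact: mH.
- move=> k x [_ xu]; apply: cball_subset xu.
  rewrite subr0 enormZ u1 mulr1 lerD2r ger0_norm ?invr_ge0//.
  by rewrite invf_le1// ler1n.
- move=> i k ik; apply/seteqP; split => // x [[/= xi _] [/= + _]].
  by rewrite xi => /invr_inj/eqP; rewrite eqr_nat eqSS ltn_eqF.
- move=> k; rewrite -(lebesgue_outer_shift (k.+1%:R^-1 *: u)).
  apply: outer_le => _ [x [/= x0 xj] <-]; split => /=.
    by rewrite dotDl x0 dotZl uu mulr1 add0r.
  by move: xj; rewrite /cball/= scale0r subr0 addrK.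
Qed.

End null_hypersurfaces.

(** * Continuously differentiable functions *)

Section lines.
Context {R : realType} {V : normedModType R}.
Implicit Types (f : V -> R) (x v : V) (t d : R).

Lemma is_derive_line f x v t d : is_derive (x + t *: v) v f d ->
  is_derive t 1 (fun s => f (x + s *: v)) d.
Proof.
have E : (fun h : R => h^-1 *: (((fun s => f (x + s *: v)) \o shift t) (h *: 1) - f (x + t *: v)))
    = (fun h => h^-1 *: ((f \o shift (x + t *: v)) (h *: v) - f (x + t *: v))).
  apply/funext => h /=; congr (_ *: (f _ - _)).
  by rewrite (_ : h *: 1 = h) ?scalerDl 1?addrCA//; exact: mulr1.
by move=> [df dE]; split; rewrite /derivable/derive E.
Qed.

Lemma is_derive_of_line f x v d : is_derive (0 : R) 1 (fun s : R => f (x + s *: v)) d ->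
  is_derive x v f d.
Proof.
have E : (fun h : R => h^-1 *: (((fun s => f (x + s *: v)) \o shift 0) (h *: 1) - f (x + 0 *: v)))
    = (fun h => h^-1 *: ((f \o shift x) (h *: v) - f x)).
  apply/funext => h /=; rewrite scale0r !addr0; congr (_ *: (f _ - _)).
  by rewrite addrC (_ : h *: 1 = h)//; exact: mulr1.
by move=> [df dE]; split; move: df dE; rewrite /derivable/derive E.
Qed.

(** Along a line this is the chain rule in one variable. *)
Lemma is_derive_chain f (k : R -> R) x v d e : is_derive x v f d ->
  is_derive (f x) 1 k e -> is_derive x v (k \o f) (e * d).
Proof.
move=> fd ke; apply: is_derive_of_line.
have fx0 : f (x + 0 *: v) = f x by rewrite scale0r addr0.
have [l1 l2] : is_derive (0 : R) 1 (fun s : R => f (x + s *: v)) d.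
  by apply: is_derive_line; rewrite scale0r addr0.
have [k1 k2] : is_derive (f (x + 0 *: v)) 1 k e by rewrite fx0.
split.
  apply/derivable1_diffP; apply: (@differentiable_comp _ _ _ _ (fun s : R => f (x + s *: v)) k).
    exact/derivable1_diffP.
  exact/derivable1_diffP.
rewrite -derive1E; change (derive1 (k \o (fun s : R => f (x + s *: v))) 0 = e * d).
by rewrite derive1_comp// !derive1E k2 l2.
Qed.

Lemma MVT_line f (df : V -> R) x v t : (forall y, is_derive y v f (df y)) ->
  exists2 s, `|s| <= `|t| & f (x + t *: v) - f x = t * df (x + s *: v).
Proof.
move=> fd; pose g s := f (x + s *: v); pose dg s := df (x + s *: v).
have gd (s : R) : is_derive s 1 g (dg s) by exact: is_derive_line.
have gc (a b : R) : {within `[a, b], continuous g}.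
  by apply: derivable_within_continuous => s _; have [] := gd s.
have f0 : f x = g 0 by rewrite /g scale0r addr0.
have [t0|/ltW t0] := leP 0 t.
  have [s] := MVT_segment t0 (fun s _ => gd s) (gc _ _).
  rewrite in_itv/= => /andP[s0 st] E; exists s; first by rewrite !ger0_norm.
  by rewrite f0 E subr0 mulrC.
have [s] := MVT_segment t0 (fun s _ => gd s) (gc _ _).
rewrite in_itv/= => /andP[s0 st] E; exists s; first by rewrite !ler0_norm// lerN2.
by rewrite f0 -opprB E sub0r mulrN opprK mulrC.
Qed.

End lines.

Section C1.
Context {R : realType} {n : nat}.
Local Notation V := 'rV[R]_n.+1.
Local Notation e_ j := (delta_mx ord0 j : V).
Implicit Types (f g : V -> R) (df dg : 'I_n.+1 -> V -> R).

(** Consecutive points differ in one coordinate, so that control along the axes, of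
    partial derivatives or of translations, becomes control from [x] to [y]. *)
Definition stair (x y : V) (k : nat) : V :=
  \row_i (if (i < k)%N then y ord0 i else x ord0 i).

Lemma stair0 x y : stair x y 0 = x.
Proof. by apply/rowP => i; rewrite !mxE. Qed.

Lemma stair_end x y : stair x y n.+1 = y.
Proof. by apply/rowP => i; rewrite !mxE ltn_ord. Qed.

Lemma stairS x y (k : 'I_n.+1) :
  stair x y k.+1 = stair x y k + (y ord0 k - x ord0 k) *: e_ k.
Proof.
apply/rowP => i; rewrite !mxE eqxx/= ltnS leq_eqVlt.
have [->|/eqP ik] := eqVneq i k; first by rewrite eqxx/= ltnn mulr1 addrC subrK.
rewrite mulr0 addr0 [X in X || _](_ : _ = false)//.
by apply/eqP => /val_inj.
Qed.

(** The partial derivatives are bounded near [x], and a staircase to a nearby point turns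
    this into a Lipschitz bound. *)
Lemma C1_continuous f : C1 f -> continuous f.
Proof.
move=> fC1 x; pose df j y := 'D_(e_ j) f y.
have [M Mbd] : exists M : R, forall j y, cball x n.+1%:R y -> `|df j y| <= M.
  have : forall j, exists M : R, forall y, cball x n.+1%:R y -> `|df j y| <= M.
    move=> j; have [_ dfc] := fC1 j.
    have /compact_bounded[M [_ hM]] : compact (df j @` cball x n.+1%:R).
      by apply: continuous_compact; [exact: continuous_subspaceT|exact: compact_cball].
    by exists (M + 1) => y xy; apply: hM; [rewrite ltrDl|exists y].
  move=> /choice[M hM]; exists (\big[Num.max/0]_j M j) => j y xy.
  by apply: (le_trans (hM j y xy)); exact: le_bigmax.
have M0 : 0 <= M.
  by apply: le_trans (Mbd ord0 x _) => //; exact: cball_center.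
apply/(@cvgrPdist_le _ _ _ (nbhs x)) => e e0.
pose d := Num.min 1 (e / (n.+1%:R * (M + 1))).
have d0 : 0 < d by rewrite lt_min ltr01 divr_gt0// mulr_gt0// ltr_wpDl.
near=> y.
have {}xy i : `|y ord0 i - x ord0 i| < d.
  rewrite distrC; move: i; near: y; apply/nbhs_ballinf; exists d => //.
have dle1 : d <= 1 by rewrite ge_min lexx.
have := @telescope_sumr _ 0 n.+1 (fun k => f (stair x y k)) (leq0n _).
rewrite /= stair_end stair0 distrC => <-.
rewrite (le_trans (ler_norm_sum _ _ _))// big_mkord.
apply: (@le_trans _ _ (\sum_(k < n.+1) d * (M + 1))); last first.
  rewrite sumr_const card_ord -mulr_natl mulrCA -ler_pdivlMr ?mulr_gt0 ?ltr_wpDl//.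
  by rewrite ge_min lexx orbT.
apply: ler_sum => k _; rewrite stairS.
have [s hs ->] := @MVT_line _ _ f (df k) (stair x y k) (e_ k) (y ord0 k - x ord0 k)
  (fun z => derivableP ((fC1 k).1 z)).
rewrite normrM ler_pM//; [exact/ltW|apply: (@le_trans _ _ M); last by rewrite lerDl].
apply: Mbd; rewrite /cball/= (le_trans (enorm_le_sum _))//.
rewrite [leRHS](_ : _ = \sum_(i < n.+1) 1); last by rewrite sumr_const card_ord.
apply: ler_sum => i _; rewrite !mxE eqxx/=; apply: le_trans dle1.
have [->|ik] := eqVneq i k.
  rewrite ltnn mulr1 addrAC subrr add0r (le_trans hs)//; exact: ltW.
rewrite mulr0 addr0; case: ifP => _; first exact: ltW.
by rewrite subrr normr0 ltW.
Unshelve. all: by end_near. Qed.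

(** Continuity of [f] is kept as a component, to have it at hand for products. *)
Definition has_C1_gradient f df := [/\ continuous f,
  forall j x, is_derive x (e_ j) f (df j x) & forall j, continuous (df j)].

Lemma has_C1_gradient_C1 f df : has_C1_gradient f df -> C1 f.
Proof.
move=> [fc fd dfc] j; split=> [x|]; first by have [] := fd j x.
rewrite (_ : (fun x => 'D_(e_ j) f x) = df j); first exact: dfc.
by apply/funext => x; have [] := fd j x.
Qed.

Lemma C1_has_gradient f : C1 f -> has_C1_gradient f (fun j x => 'D_(e_ j) f x).
Proof.
move=> fC1; split; first exact: C1_continuous.
- by move=> j x; apply: derivableP; exact: (fC1 j).1.
- by move=> j; exact: (fC1 j).2.
Qed.

Lemma gradient_cst (a : R) : has_C1_gradient (cst a) (fun _ _ => 0).
Proof.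
by split => *; [exact: cst_continuous|exact: is_derive_cst|exact: cst_continuous].
Qed.

Lemma gradient_coord i : has_C1_gradient (fun x => x ord0 i) (fun j _ => (i == j)%:R).
Proof.
split=> [|j x|j]; [exact: coord_continuous| |exact: cst_continuous].
apply: is_derive_of_line.
have := @is_deriveD R R R _ _ (0 : R) 1 _ _ (is_derive_cst (x ord0 i) (0 : R) 1)
  (is_deriveZ (i == j)%:R (is_derive_id (0 : R) 1)).
rewrite add0r [_ *: _]mulr1; congr is_derive.
by apply/funext => s /=; rewrite !mxE eqxx/= mulrC.
Qed.

Lemma gradientD f g df dg : has_C1_gradient f df -> has_C1_gradient g dg ->
  has_C1_gradient (f \+ g) (fun j x => df j x + dg j x).
Proof.
move=> [fc fd dfc] [gc gd dgc]; split=> [x|j x|j x].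
- by apply: (@continuousD R R V); [exact: fc|exact: gc].
- exact: is_deriveD.
- by apply: (@continuousD R R V); [exact: dfc|exact: dgc].
Qed.

Lemma gradientM f g df dg : has_C1_gradient f df -> has_C1_gradient g dg ->
  has_C1_gradient (f \* g) (fun j x => f x * dg j x + g x * df j x).
Proof.
move=> [fc fd dfc] [gc gd dgc]; split=> [x|j x|j x].
- by apply: (@continuousM R V); [exact: fc|exact: gc].
- exact: is_deriveM.
- apply: (@continuousD R R V); apply: (@continuousM R V);
  by [exact: fc|exact: gc|exact: dfc|exact: dgc].
Qed.

Lemma gradientZ (a : R) f df : has_C1_gradient f df ->
  has_C1_gradient (fun x => a * f x) (fun j x => a * df j x).
Proof.
move=> fC; have := gradientM (gradient_cst a) fC.
by congr has_C1_gradient; apply/funext => j; apply/funext => x; rewrite mulr0 addr0.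
Qed.

Lemma gradientB f g df dg : has_C1_gradient f df -> has_C1_gradient g dg ->
  has_C1_gradient (f \- g) (fun j x => df j x - dg j x).
Proof.
move=> fC gC; have := gradientD fC (gradientZ (-1) gC).
congr has_C1_gradient; first by apply/funext => x /=; rewrite mulN1r.
by apply/funext => j; apply/funext => x; rewrite mulN1r.
Qed.

Lemma gradient_sum (I : finType) (F : I -> V -> R) (dF : I -> 'I_n.+1 -> V -> R) :
  (forall i, has_C1_gradient (F i) (dF i)) ->
  has_C1_gradient (fun x => \sum_i F i x) (fun j x => \sum_i dF i j x).
Proof.
move=> FC; elim: (index_enum I) => [|i s IH].
  have := gradient_cst 0; congr has_C1_gradient.
    by apply/funext => x; rewrite big_nil.
  by apply/funext => j; apply/funext => x; rewrite big_nil.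
have := gradientD (FC i) IH; congr has_C1_gradient.
  by apply/funext => x; rewrite big_cons.
by apply/funext => j; apply/funext => x; rewrite big_cons.
Qed.

Lemma gradient_chain (k dk : R -> R) f df : has_C1_gradient f df ->
  (forall t : R, is_derive t 1 k (dk t)) -> continuous dk ->
  has_C1_gradient (fun x => k (f x)) (fun j x => dk (f x) * df j x).
Proof.
move=> [fc fd dfc] kd dkc; split=> [x|j x|j x].
- apply: (continuous_comp (fc x)).
  by apply/differentiable_continuous; apply/derivable1_diffP; have [] := kd (f x).
- exact: is_derive_chain.
- apply: (@continuousM R V); [exact: (continuous_comp (fc x) (dkc _))|exact: dfc].
Qed.

End C1.

(** * Smooth steps *)

Section steps.
Context {R : realType}.
Implicit Types (k dk : R -> R) (t d h C : R).

(** Powers of the ramp have a quadratic remainder at every point, the corner included. *)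
Lemma is_derive_quadratic k t d C :
  (forall h, `|h| <= 1 -> `|k (t + h) - k t - h * d| <= C * h ^+ 2) ->
  is_derive t 1 k d.
Proof.
move=> kq; have C0 : 0 <= C.
  by have := kq 1; rewrite normr1 lexx expr1n mulr1 => /(_ isT); exact: le_trans.
suff lim : (fun h : R => h^-1 *: ((k \o shift t) (h *: 1) - k t)) @ 0^' --> d.
  by split; [exact: cvgP lim|exact: cvg_lim lim].
apply/cvgrPdist_le => e e0; pose s := Num.min 1 (e / (C + 1)).
have s0 : 0 < s by rewrite lt_min ltr01 divr_gt0// ltr_wpDl.
near=> h.
have h0 : h != 0 by near: h; exact: nbhs_dnbhs_neq.
have hs : `|h| < s.
  near: h; apply: dnbhs0_lt; exact: s0.
rewrite /= [h *: 1]mulr1 (addrC h).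
rewrite -[h^-1 *: _]/(h^-1 * _).
have -> : d - h^-1 * (k (t + h) - k t) = - (h^-1 * (k (t + h) - k t - h * d)).
  by rewrite [X in _ = - X]mulrBr mulKf// opprB.
rewrite normrN normrM normfV ler_pdivrMl ?normr_gt0//.
apply: (le_trans (kq h _)); first by rewrite ltW// (lt_le_trans hs)// ge_min lexx.
rewrite -real_normK ?num_real// expr2 mulrCA ler_pM2l ?normr_gt0//.
apply: (@le_trans _ _ ((C + 1) * s)).
  by rewrite ler_pM// ?lerDl// ltW.
by rewrite mulrC -ler_pdivlMr ?ltr_wpDl// ge_min lexx orbT.
Unshelve. all: by end_near. Qed.

Definition ramp t := Num.max 0 t.

Lemma ramp_ge0 t : 0 <= ramp t. Proof. by rewrite le_max lexx. Qed.

Lemma ramp_pos t : 0 <= t -> ramp t = t. Proof. by move=> ?; apply/max_idPr. Qed.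

Lemma ramp_neg t : t <= 0 -> ramp t = 0. Proof. by move=> ?; apply/max_idPl. Qed.

Lemma ramp_continuous : continuous ramp.
Proof. by move=> t; apply: continuous_max; [exact: cst_continuous|exact: cvg_id]. Qed.

Lemma is_derive_ramp2 t : is_derive t 1 (fun s => ramp s ^+ 2) (2 * ramp t).
Proof.
apply: (@is_derive_quadratic _ _ _ 1) => h h1.
have := ramp_ge0 t; rewrite ler_norml.
have [t0|t0] := leP 0 t; have [th0|th0] := leP 0 (t + h);
  rewrite ?(ramp_pos t0) ?(ramp_neg (ltW t0)) ?(ramp_pos th0) ?(ramp_neg (ltW th0)) => _;
  apply/andP; split; nra.
Qed.

Lemma is_derive_ramp3 t : is_derive t 1 (fun s => ramp s ^+ 3) (3 * ramp t ^+ 2).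
Proof.
apply: (@is_derive_quadratic _ _ _ (4 + 3 * `|t|)) => h; rewrite ler_norml => /andP[h0 h1].
rewrite ler_norml.
have [t0|t0] := leP 0 t; have [th0|th0] := leP 0 (t + h);
  rewrite ?(ramp_pos t0) ?(ramp_neg (ltW t0)) ?(ramp_pos th0) ?(ramp_neg (ltW th0)).
- rewrite (ger0_norm t0).
  have -> : (t + h) ^+ 3 - t ^+ 3 - h * (3 * t ^+ 2) = (h + 3 * t) * h ^+ 2 by ring.
  have h2 : 0 <= h ^+ 2 by exact: sqr_ge0.
  by apply/andP; split; nra.
- rewrite (ger0_norm t0).
  apply/andP; split; nra.
- rewrite (ltr0_norm t0).
  apply/andP; split; nra.
- rewrite (ltr0_norm t0).
  have h2 : 0 <= h ^+ 2 by exact: sqr_ge0.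
  apply/andP; split; nra.
Qed.

Lemma is_derive_affine k dk (m a : R) : (forall t, is_derive t 1 k (dk t)) ->
  forall t, is_derive t 1 (fun s => k (m * (s - a))) (m * dk (m * (t - a))).
Proof.
move=> kd t; rewrite mulrC.
have fd : is_derive t 1 (fun s : R => m * (s - a)) m.
  have := @is_deriveZ R R R _ m t 1 _ (is_deriveB (is_derive_id t 1) (is_derive_cst a t 1)).
  by rewrite subr0 [_ *: _]mulr1.
exact: (is_derive_chain fd (kd (m * (t - a)))).
Qed.

(** The second difference of [ramp ^+ 2] grows from 0 to a constant, and that of
    [ramp ^+ 3] is proportional to a primitive of it: this gives a C1 step that has an
    explicit primitive. *)
Definition second_diff k t := k t - 2 * k (t - 2^-1) + k (t - 1).

Lemma is_derive_second_diff k dk : (forall t, is_derive t 1 k (dk t)) ->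
  forall t, is_derive t 1 (second_diff k) (second_diff dk t).
Proof.
move=> kd t.
have sh a : is_derive t 1 (fun s => k (s - a)) (dk (t - a)).
  have := is_derive_affine 1 a kd t; rewrite !mul1r; congr is_derive.
  by apply/funext => s; rewrite mul1r.
have := is_deriveD (is_deriveB (kd t) (is_deriveZ 2 (sh 2^-1))) (sh 1).
by [].
Qed.

Definition step t := 2 * second_diff (fun s => ramp s ^+ 2) t.
Definition dstep t := 2 * second_diff (fun s => 2 * ramp s) t.
Definition istep t := 2 / 3 * second_diff (fun s => ramp s ^+ 3) t.

Lemma is_derive_step t : is_derive t 1 step (dstep t).
Proof.
exact: (@is_deriveZ R R R _ 2 t 1 _ (is_derive_second_diff is_derive_ramp2 t)).
Qed.

Lemma is_derive_istep t : is_derive t 1 istep (step t).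
Proof.
have := @is_deriveZ R R R _ (2 / 3) t 1 _ (is_derive_second_diff is_derive_ramp3 t).
congr is_derive; rewrite /step /second_diff -[LHS]/(2 / 3 * _).
by field.
Qed.

Lemma second_diff_continuous k : continuous k -> continuous (second_diff k).
Proof.
move=> kc; have sh a : continuous (fun s : R => k (s - a)).
  move=> s; apply: (@continuous_comp _ _ _ (fun s : R => s - a) k); last exact: kc.
  by apply: (@continuousB R R R); [exact: cvg_id|exact: cst_continuous].
move=> s; apply: (@continuousD R R R (fun t => k t - 2 * k (t - 2^-1)) (fun t => k (t - 1)));
  last exact: sh.
apply: (@continuousB R R R k (fun t => 2 * k (t - 2^-1))); first exact: kc.
by apply: (@continuousM R R); [exact: cst_continuous|exact: sh].
Qed.

Lemma derive_continuous k dk : (forall t, is_derive t 1 k (dk t)) -> continuous k.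
Proof.
by move=> kd t; apply/differentiable_continuous/derivable1_diffP; have [] := kd t.
Qed.

Lemma step_continuous : continuous step.
Proof. exact: derive_continuous is_derive_step. Qed.

Lemma dstep_continuous : continuous dstep.
Proof.
have rc : continuous (fun s : R => 2 * ramp s).
  move=> t; apply: (@continuousM R R (cst 2) ramp); first exact: cst_continuous.
  exact: ramp_continuous.
move=> s; apply: (@continuousM R R (cst 2) (second_diff (fun s => 2 * ramp s))).
  exact: cst_continuous.
exact: second_diff_continuous.
Qed.

Lemma step_le0 t : t <= 0 -> step t = 0.
Proof.
move=> t0; rewrite /step /second_diff !ramp_neg; try lra.
Qed.

Lemma step_ge1 t : 1 <= t -> step t = 1.
Proof.
move=> t0; rewrite /step /second_diff !ramp_pos; try lra.
Qed.

Lemma dstep_le0 t : t <= 0 -> dstep t = 0.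
Proof.
move=> t0; rewrite /dstep /second_diff !ramp_neg; lra.
Qed.

Lemma istep_le0 t : t <= 0 -> istep t = 0.
Proof.
move=> t0; rewrite /istep /second_diff !ramp_neg; lra.
Qed.

Lemma dstep_ge0 t : 0 <= dstep t.
Proof.
rewrite /dstep /second_diff.
have [t0|t0] := leP t 0; first by rewrite !ramp_neg; lra.
have [t1|t1] := leP t 2^-1.
  by rewrite (ramp_pos (ltW t0)) !ramp_neg; lra.
have [t2|t2] := leP t 1; last by rewrite !ramp_pos; lra.
by rewrite (ramp_pos (ltW t0)) ramp_pos ?ramp_neg; lra.
Qed.

Lemma step_bounds t : 0 <= step t <= 1.
Proof.
rewrite /step /second_diff.
have [t0|t0] := leP t 0; first by rewrite !ramp_neg; lra.
have [t1|t1] := leP t 2^-1.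
  by rewrite (ramp_pos (ltW t0)) !ramp_neg; nra.
have [t2|t2] := leP t 1; last by rewrite !ramp_pos; nra.
by rewrite (ramp_pos (ltW t0)) ramp_pos ?ramp_neg; nra.
Qed.

End steps.

Section cutoff.
Context {R : realType} {n : nat}.
Local Notation V := 'rV[R]_n.+1.
Implicit Types (c x : V) (r m : R).

Lemma gradient_sub_coord c i :
  has_C1_gradient (fun x : V => (x - c) ord0 i) (fun j _ => (i == j)%:R).
Proof.
have := gradientB (gradient_coord i) (gradient_cst (c ord0 i)).
congr has_C1_gradient; first by apply/funext => x /=; rewrite !mxE.
by apply/funext => j; apply/funext => x; rewrite subr0.
Qed.

Lemma gradient_sqdist c :
  has_C1_gradient (fun x : V => dot (x - c) (x - c)) (fun j x => 2 * (x - c) ord0 j).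
Proof.
have := gradient_sum (fun i => gradientM (gradient_sub_coord c i) (gradient_sub_coord c i)).
congr has_C1_gradient; apply/funext => j; apply/funext => x.
rewrite (bigD1 j)//= eqxx big1 ?addr0; first by rewrite !mulr1 [RHS]mulr_natl mulr2n.
by move=> i /negPf ->; rewrite mulr0 addr0.
Qed.

Definition sqexcess c r x := dot (x - c) (x - c) - r ^+ 2.

(** Equal to 1 on the ball and to 0 where [sqexcess c r x] exceeds [m^-1], so that it
    decreases to the indicator of the ball as [m] grows. *)
Definition cutoff c r m x := 1 - step (m * sqexcess c r x).

Lemma gradient_cutoff c r m : has_C1_gradient (cutoff c r m)
  (fun j x => - (m * dstep (m * sqexcess c r x) * (2 * (x - c) ord0 j))).
Proof.
have kd (t : R) : is_derive t 1 (fun s => step (m * (s - r ^+ 2))) (m * dstep (m * (t - r ^+ 2))).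
  exact: is_derive_affine is_derive_step t.
have kc : continuous (fun t : R => m * dstep (m * (t - r ^+ 2))).
  move=> t; apply: (@continuousM R R (cst m) (fun t => dstep (m * (t - r ^+ 2)))).
    exact: cst_continuous.
  apply: (@continuous_comp _ _ _ (fun t => m * (t - r ^+ 2)) dstep); last exact: dstep_continuous.
  apply: (@continuousM R R (cst m) (fun t => t - r ^+ 2)); first exact: cst_continuous.
  by apply: (@continuousB R R R); [exact: cvg_id|exact: cst_continuous].
have := gradientB (gradient_cst 1) (gradient_chain (gradient_sqdist c) kd kc).
by congr has_C1_gradient; apply/funext => j; apply/funext => x; rewrite sub0r.
Qed.

Lemma cutoff_bounds c r m x : 0 <= cutoff c r m x <= 1.
Proof.
by have := step_bounds (m * sqexcess c r x); rewrite /cutoff => /andP[? ?];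
  apply/andP; split; lra.
Qed.

Lemma sqexcess_le0 c r x : 0 <= r -> (sqexcess c r x <= 0) = (enorm (x - c) <= r).
Proof.
by move=> r0; rewrite subr_le0 -enorm_sqr ler_pXn2r ?nnegrE ?enorm_ge0.
Qed.

Lemma cutoff_in c r m x : 0 <= r -> 0 <= m -> cball c r x -> cutoff c r m x = 1.
Proof.
move=> r0 m0; rewrite /cball/= -sqexcess_le0// => xc.
by rewrite /cutoff step_le0 ?subr0// mulr_ge0_le0.
Qed.

Lemma cutoff_out c r m x : 1 <= m * sqexcess c r x -> cutoff c r m x = 0.
Proof. by move=> h; rewrite /cutoff step_ge1// subrr. Qed.

End cutoff.

(** * Integration by parts *)

Section integrals.
Context {R : realType} {n : nat}.
Local Notation V := 'rV[R]_n.+1.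
Local Notation mu := (@lebesgue_outer R n).
Local Notation lam := (@lebesgue R n).
Local Notation M := (lebesgue_outer.-caratheodory).
Local Notation T := (caratheodory_type (@lebesgue_outer R n)).
Implicit Types (D : set V) (f g : V -> R).

Lemma integrable_bounded D (f : T -> R) (b : R) : M D -> (mu D < +oo)%E ->
  measurable_fun (D : set T) f -> (forall x, D x -> `|f x| <= b) ->
  lam.-integrable (D : set T) (EFin \o f).
Proof.
move=> mD Doo mf fb; apply: measurable_bounded_integrable => //.
exists b; split; first exact: num_real.
by move=> x bx t Dt; apply: le_trans (fb t Dt) _; exact: ltW.
Qed.

Lemma continuous_measurable D f : continuous f -> measurable_fun (D : set T) f.
Proof. by move=> fc; apply: measurable_funTS; exact: continuous_measurable_outer. Qed.

Lemma compact_bound D f : compact D -> continuous f ->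
  exists b : R, forall x, D x -> `|f x| <= b.
Proof.
move=> cD fc.
have /compact_bounded[b [_ hb]] : compact (f @` D).
  by apply: continuous_compact => //; exact: continuous_subspaceT.
by exists (b + 1) => x Dx; apply: hb; [rewrite ltrDl|exists x].
Qed.

Lemma compact_measurable_outer D : compact D -> M D /\ (mu D < +oo)%E.
Proof.
move=> cD; split.
  by apply: closed_measurable_outer; exact: (compact_closed (@norm_hausdorff _ V) cD).
by have [r Dr] := compact_fin cD; rewrite (le_lt_trans (outer_le Dr))// cball_fin.
Qed.

Lemma integrable_continuous D f : M D -> (exists2 K, compact K & D `<=` K) ->
  continuous f -> lam.-integrable (D : set T) (EFin \o f).
Proof.
move=> mD [K cK DK] fc; have [b fb] := compact_bound cK fc.
apply: (@integrable_bounded _ _ b) => //.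
- by rewrite (le_lt_trans (outer_le DK))//; have [] := compact_measurable_outer cK.
- exact: continuous_measurable.
- by move=> x /DK; exact: fb.
Qed.

Lemma cvg_integral_bounded D (F : nat -> T -> R) (f : T -> R) (b : R) :
  M D -> (mu D < +oo)%E -> (forall k, measurable_fun (D : set T) (F k)) ->
  (forall x, D x -> F k x @[k --> \oo] --> f x) ->
  (forall k x, D x -> `|F k x| <= b) ->
  (\int[lam]_(x in D) (F k x)%:E @[k --> \oo] --> \int[lam]_(x in D) (f x)%:E)%E.
Proof.
move=> mD Doo mF Ff Fb.
have mf : measurable_fun (D : set T) f by exact: measurable_fun_cvg mF Ff.
have [_ _] : [/\ lam.-integrable (D : set T) (EFin \o f),
  [sequence (\int[lam]_(x in D) `|(F k x)%:E - (f x)%:E|)%E]_k @ \oo --> 0%E &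
  [sequence (\int[lam]_(x in D) (F k x)%:E)%E]_k @ \oo --> (\int[lam]_(x in D) (f x)%:E)%E].
  apply: (@dominated_convergence _ T R lam D mD (fun k => EFin \o F k) (EFin \o f)
    (fun=> b%:E)).
  - by move=> k; exact/measurable_EFinP.
  - exact/measurable_EFinP.
  - apply: aeW => x Dx; apply: cvg_EFin; first exact: nearW.
    exact: Ff.
  - apply: (@integrable_bounded _ (cst b) `|b|) => //.
  - by apply: aeW => x k Dx /=; rewrite lee_fin; exact: Fb.
exact.
Qed.

Lemma measurable_shift (v : V) A : M A -> M ((fun x => x + v) @^-1` A).
Proof.
move=> mA X; have E B : mu B = mu [set x + v | x in B] by rewrite lebesgue_outer_shift.
rewrite E (mA [set x + v | x in X]) (E (X `&` _)) (E (X `&` ~` _)).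
congr adde; apply: (congr1 mu); apply/seteqP; split.
- by move=> _ [[x Xx <-] Ax]; exists x.
- by move=> _ [x [Xx Ax] <-]; split => //; exists x.
- by move=> _ [[x Xx <-] Ax]; exists x.
- by move=> _ [x [Xx Ax] <-]; split => //; exists x.
Qed.

Lemma integral_shift (f : T -> R) (v : V) : measurable_fun (setT : set T) f ->
  lam.-integrable (setT : set T) (fun x => (f (x + v))%:E) ->
  (\int[lam]_x (f (x + v))%:E = \int[lam]_x (f x)%:E)%E.
Proof.
move=> mf intf; pose phi : T -> T := fun x => (x : V) + v.
have mphi : measurable_fun (setT : set T) phi.
  by move=> _ A mA; rewrite setTI; exact: measurable_shift.
have mEf : measurable_fun (setT : set T) (EFin \o f) by exact/measurable_EFinP.
have := @integral_pushforward _ _ T T R phi mphi lam setT (EFin \o f) mEf.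
rewrite preimage_setT => /(_ intf measurableT) /= <-.
apply: eq_measure_integral => A mA _; change (mu (phi @^-1` A) = mu A).
rewrite -(lebesgue_outer_shift v (phi @^-1` A)); apply: (congr1 mu); apply/seteqP; split.
  by move=> _ [x Ax <-].
by move=> x Ax; exists (x - v); rewrite ?subrK// /preimage /phi/= subrK.
Qed.

Lemma integral_support D (f : T -> \bar R) : M D -> (forall x, ~ D x -> f x = 0%E) ->
  (\int[lam]_(x in D) f x = \int[lam]_x f x)%E.
Proof.
move=> mD f0; rewrite integral_mkcond; apply: eq_integral => x _.
by rewrite patchE; case: ifPn => // /negP xD; rewrite f0// => Dx; apply: xD; rewrite inE.
Qed.

Lemma integrable_support D f : compact D -> continuous f ->
  (forall x, ~ D x -> f x = 0) -> lam.-integrable (setT : set T) (EFin \o f).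
Proof.
move=> cD fc f0; have [mD _] := compact_measurable_outer cD.
have /integrable_mkcond : lam.-integrable (D : set T) (EFin \o f).
  by apply: integrable_continuous => //; exists D.
move=> /(_ mD); congr integrable; apply/funext => x.
by rewrite patchE; case: ifPn => // /negP xD /=; rewrite f0// => Dx; apply: xD; rewrite inE.
Qed.

(** The integral is translation invariant, so difference quotients integrate to zero. *)
Lemma integral_gradient0 (c : V) (r s : R) f df j : has_C1_gradient f df -> r < s ->
  (forall x, ~ cball c r x -> f x = 0) ->
  (\int[lam]_(x in cball c s) (df j x)%:E = 0)%E.
Proof.
move=> [fc fd dfc] rs f0; pose h k : R := (s - r) / k.+1%:R.
have h0 k : 0 < h k by rewrite divr_gt0// subr_gt0.
have hle k : h k <= s - r by rewrite ler_pdivrMr// ler_peMr ?ler1n// subr_ge0 ltW.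
pose e : V := delta_mx ord0 j.
have e1 : enorm e = 1 by rewrite /enorm dot_delta mxE !eqxx sqrtr1.
have f0s k x : ~ cball c s x -> f (x + h k *: e) = 0.
  move=> xc; apply: f0 => xhc; apply: xc.
  rewrite /cball/= -[x](addrK (h k *: e)) addrAC.
  rewrite (le_trans (ler_enormD _ _))// enormN enormZ e1 mulr1 gtr0_norm//.
  by have := hle k; have : enorm (x + h k *: e - c) <= r := xhc; lra.
have f0' x : ~ cball c s x -> f x = 0.
  by move=> xc; apply: f0 => xr; apply: xc; exact: le_trans xr (ltW rs).
have mK : M (cball c s) by apply: closed_measurable_outer; exact: cball_closed.
pose F k (x : V) := (h k)^-1 * (f (x + h k *: e) - f x).
have fhc k : continuous (fun x : V => f (x + h k *: e)).
  move=> x; apply: (@continuous_comp _ _ _ (fun x : V => x + h k *: e) f); last exact: fc.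
  by apply: (@continuousD R V V); [exact: cvg_id|exact: cst_continuous].
have Fc k : continuous (F k).
  move=> x; apply: (@continuousM R V); first exact: cst_continuous.
  by apply: (@continuousB R R V); [exact: fhc|exact: fc].
have [b fb] := compact_bound (@compact_cball R n.+1 c (s + (s - r))) (dfc j).
have Fb k x : cball c s x -> `|F k x| <= b.
  move=> xc; have [t th E] := MVT_line x (h k) (fd j).
  rewrite /F E mulKf ?gt_eqF//; apply: fb.
  rewrite /cball/= addrAC (le_trans (ler_enormD _ _))// lerD// enormZ e1 mulr1.
  by rewrite (le_trans th)// gtr0_norm.
have h_cvg : h k @[k --> \oo] --> 0.
  by rewrite -[X in _ --> X](mulr0 (s - r)); apply: cvgM; [exact: cvg_cst|exact: cvg_harmonic].
have Fcvg x : F k x @[k --> \oo] --> df j x.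
  have [dx dxE] := fd j x; move: dx; rewrite /derivable => dx.
  have hd : h k @[k --> \oo] --> 0^'.
    move=> A A0; apply: (@filterS nat \oo _ _ _ _ (h_cvg _ A0)) => k; apply.
    by rewrite /= gt_eqF.
  have := cvg_comp _ _ hd dx; rewrite -/(derive f x e) dxE.
  apply: cvg_trans; apply: near_eq_cvg; apply: nearW => k /=.
  by rewrite /F [x + _]addrC.
have F0 k : (\int[lam]_(x in cball c s) (F k x)%:E = 0)%E.
  rewrite integral_support//; last first.
    by move=> x xc; rewrite /F f0s// f0'// subrr mulr0.
  have intf : lam.-integrable (setT : set T) (EFin \o f).
    exact: (integrable_support (@compact_cball _ _ c s) fc f0').
  have intfh : lam.-integrable (setT : set T) (fun x => (f (x + h k *: e))%:E).
    exact: (integrable_support (@compact_cball _ _ c s) (fhc k) (f0s k)).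
  under eq_integral do rewrite EFinM EFinB.
  rewrite integralZl//; last exact: integrableB.
  rewrite integralB_EFin// integral_shift//; last exact: continuous_measurable.
  by rewrite subee ?mule0//; exact: integrable_fin_num.
have := cvg_integral_bounded mK (cball_fin c s) (fun k => continuous_measurable (Fc k))
  (fun x _ => Fcvg x) Fb.
by under eq_fun do rewrite F0; move/cvg_lim => <-//; rewrite lim_cst.
Qed.

End integrals.

(** * Perimeter of balls *)

Section ball_perimeter.
Context {R : realType} {n : nat}.
Local Notation V := 'rV[R]_n.+1.
Local Notation mu := (@lebesgue_outer R n).
Local Notation lam := (@lebesgue R n).
Local Notation M := (lebesgue_outer.-caratheodory).
Local Notation T := (caratheodory_type (@lebesgue_outer R n)).
Implicit Types (c x : V) (r m : R).

Lemma cball_measurable c r : M (cball c r).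
Proof. by apply: closed_measurable_outer; exact: cball_closed. Qed.

Lemma cutoff_support c r m x : 0 <= r -> 1 <= m -> ~ cball c (r + 1) x ->
  cutoff c r m x = 0.
Proof.
move=> r0 m1 /negP; rewrite -ltNge => xc; apply: cutoff_out.
have : (r + 1) ^+ 2 < dot (x - c) (x - c).
  by rewrite -enorm_sqr ltr_pXn2r ?nnegrE ?enorm_ge0// addr_ge0.
rewrite /sqexcess sqrrD mulr1 expr1n => h.
by rewrite mulr_ege1//; lra.
Qed.

Lemma cutoff_cvg c r x : 0 <= r ->
  cutoff c r k.+1%:R x @[k --> \oo] --> (if x \in cball c r then 1 else 0 : R).
Proof.
move=> r0; case: ifPn => [|/negP xc].
  rewrite inE => xc; under eq_fun do rewrite cutoff_in//.
  exact: cvg_cst.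
have qpos : 0 < sqexcess c r x.
  rewrite ltNge; apply/negP; rewrite sqexcess_le0// => h; apply: xc.
  by rewrite inE.
apply: cvg_near_cst; exists (Num.truncn (sqexcess c r x)^-1) => // k /= hk.
apply: cutoff_out; rewrite -ler_pdivrMr// div1r.
by rewrite (le_trans (ltW (truncnS_gt _)))// ler_nat ltnS.
Qed.

(** The components of [phi] minus the field [(x - c) / r], which calibrates the ball: it
    has constant divergence and is the outer normal on the boundary sphere. *)
Definition radial_defect c r (phi : V -> V) i x := phi x ord0 i - r^-1 * (x - c) ord0 i.

(** A cutoff of [phi - (x - c) / r] has a divergence of integral zero. Where the cutoff
    decreases, outside the ball, this field points inwards because [phi] has norm at most
    1; so the cutoff times [div phi - (n + 1) / r] has integral at most zero, and the
    cutoff can shrink to the ball. *)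
Lemma perimeter_cball_le c r : 0 < r ->
  (perimeter (cball c r) <= (n.+1%:R / r)%:E * mu (cball c r))%E.
Proof.
move=> r0; apply: ge_ereal_sup => _ [phi [phiC1 _ phi1] <-].
pose dphi i j x := 'D_(delta_mx ord0 j) (fun y => phi y ord0 i) x.
pose X := radial_defect c r phi.
have Xgrad i : has_C1_gradient (X i) (fun j x => dphi i j x - r^-1 * (i == j)%:R).
  exact: gradientB (C1_has_gradient (phiC1 i)) (gradientZ r^-1 (gradient_sub_coord c i)).
pose d x := divergence phi x - n.+1%:R / r.
have dE x : \sum_i (dphi i i x - r^-1 * (i == i)%:R) = d x.
  rewrite big_split/= /d /divergence; congr (_ + _).
  rewrite sumrN; congr (- _).
  under eq_bigr do rewrite eqxx mulr1.
  by rewrite sumr_const card_ord mulr_natl.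
have divc : continuous (divergence phi).
  by move=> x; apply: (@cvg_bigsum R V _ (nbhs x) _) => i _; exact: (phiC1 i i).2.
have dc : continuous d.
  by move=> x; apply: (@continuousB R R V); [exact: divc|exact: cst_continuous].
pose f k := cutoff c r k.+1%:R.
pose df k := fun j x => - (k.+1%:R * dstep (k.+1%:R * sqexcess c r x) * (2 * (x - c) ord0 j)).
have fgrad k : has_C1_gradient (f k) (df k) by exact: gradient_cutoff.
pose K := cball c (r + 2).
have mK : M K by exact: cball_measurable.
have KK : exists2 K' : set V, compact K' & K `<=` K'.
  by exists K => //; exact: compact_cball.
pose G k i x := f k x * (dphi i i x - r^-1 * (i == i)%:R) + X i x * df k i x.
have Gint k i : (\int[lam]_(x in K) (G k i x)%:E = 0)%E.
  apply: (@integral_gradient0 _ _ c (r + 1) (r + 2) _ _ i (gradientM (fgrad k) (Xgrad i))).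
    by rewrite ltrD2l ltr1n.
  by move=> x xc; rewrite /f/= cutoff_support ?mul0r ?ler1n ?ltW.
have Gc k i : continuous (G k i).
  by have [_ _] := gradientM (fgrad k) (Xgrad i); apply.
have Gle k x : f k x * d x <= \sum_i G k i x.
  rewrite big_split/= -mulr_sumr dE lerDl.
  have -> : \sum_i X i x * df k i x =
      - (2 * k.+1%:R * dstep (k.+1%:R * sqexcess c r x)) *
      (dot (phi x) (x - c) - r^-1 * dot (x - c) (x - c)).
    rewrite /dot mulr_sumr -sumrB mulr_sumr; apply: eq_bigr => i _.
    by rewrite /X /radial_defect /df; ring.
  have [q0|q0] := leP (sqexcess c r x) 0.
    by rewrite dstep_le0 ?mulr0 ?oppr0 ?mul0r// mulr_ge0_le0.
  rewrite mulNr oppr_ge0; apply: mulr_ge0_le0.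
    by apply: mulr_ge0; [exact: mulr_ge0|exact: dstep_ge0].
  rewrite subr_le0 (le_trans (cauchy_schwarz _ _))//.
  apply: (@le_trans _ _ (enorm (x - c))); first by rewrite ler_piMl ?enorm_ge0.
  rewrite -enorm_sqr expr2 mulrA ler_peMl ?enorm_ge0// mulrC ler_pdivlMr// mul1r.
  rewrite leNgt; apply/negP => /ltW; rewrite -(sqexcess_le0 _ _ (ltW r0)).
  by rewrite leNgt q0.
have fdle k : (\int[lam]_(x in K) (f k x * d x)%:E <= 0)%E.
  have intG i : lam.-integrable (K : set T) (fun x => (G k i x)%:E).
    exact: integrable_continuous mK KK (Gc k i).
  apply: (@le_trans _ _ (\int[lam]_(x in K) (\sum_i (G k i x)%:E))%E).
    apply: le_integral => //.
    - apply: integrable_continuous => // x; apply: (@continuousM R V); last exact: dc.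
      by have [fc _ _] := fgrad k; exact: fc.
    - exact: integrable_sum.
    - by move=> x _; rewrite sumEFin lee_fin.
  rewrite integral_sum//.
  by rewrite big1// => i _; exact: Gint.
have [b db] := compact_bound (@compact_cball R n.+1 c (r + 2)) dc.
pose F x := (if x \in cball c r then 1 else 0) * d x.
have lim : (\int[lam]_(x in K) (f k x * d x)%:E @[k --> \oo] --> \int[lam]_(x in K) (F x)%:E)%E.
  apply: (@cvg_integral_bounded _ _ _ _ _ b mK (cball_fin _ _)).
  - move=> k; apply: continuous_measurable => x; apply: (@continuousM R V); last exact: dc.
    by have [fc _ _] := fgrad k; exact: fc.
  - move=> x _; apply: cvgM; last exact: cvg_cst.
    by apply: cutoff_cvg; exact: ltW.
  - move=> k x Kx; rewrite normrM; apply: le_trans (db x Kx).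
    have /andP[f0 f1] := cutoff_bounds c r k.+1%:R x.
    by rewrite ler_piMl// ger0_norm.
have : (\int[lam]_(x in K) (F x)%:E <= 0)%E.
  by apply: (cvge_to_le lim); exact: nearW.
have -> : (\int[lam]_(x in K) (F x)%:E = \int[lam]_(x in cball c r) (d x)%:E)%E.
  rewrite [LHS]integral_mkcond [RHS]integral_mkcond; apply: eq_integral => x _.
  rewrite !patchE /F; case: (boolP (x \in cball c r)) => [|_]; last by rewrite mul0r; case: ifP.
  rewrite inE => xB; rewrite mul1r ifT// inE.
  by apply: le_trans (xB : (_ <= r)) _; rewrite lerDl.
have BB : exists2 K' : set V, compact K' & cball c r `<=` K'.
  by exists (cball c r) => //; exact: compact_cball.
have mB := cball_measurable c r.
rewrite /d; under eq_integral do rewrite EFinB.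
rewrite integralB_EFin//; last 2 first.
- exact: integrable_continuous.
- exact: (integrable_continuous mB BB (@cst_continuous _ _ _)).
rewrite [X in (_ - X <= _)%E](integral_cst lam mB (n.+1%:R / r)%:E).
by rewrite sube_le0.
Qed.

End ball_perimeter.

(** * First variation of the perimeter inside two balls *)

Lemma dstep_ge1 {R : realType} (t : R) : 1 <= t -> dstep t = 0.
Proof. by move=> t0; rewrite /dstep /second_diff !ramp_pos; lra. Qed.

Section two_balls.
Context {R : realType} {n : nat}.
Local Notation V := 'rV[R]_n.+1.
Local Notation mu := (@lebesgue_outer R n).
Local Notation lam := (@lebesgue R n).
Local Notation M := (lebesgue_outer.-caratheodory).
Local Notation T := (caratheodory_type (@lebesgue_outer R n)).
Local Notation e_ j := (delta_mx ord0 j : V).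
Implicit Types (c x : V) (r m : R) (A : set V).

Lemma integral_null_diff A A0 (f : V -> R) : M A -> M A0 -> A0 `<=` A ->
  mu (A `\` A0) = 0%E -> continuous f ->
  (\int[lam]_(x in A) (f x)%:E = \int[lam]_(x in A0) (f x)%:E)%E.
Proof.
move=> mA mA0 AA0 null fc.
have mf : measurable_fun (setT : set T) (fun x => (f x)%:E).
  by apply/measurable_EFinP; exact: continuous_measurable.
rewrite -[in RHS](setIidr AA0) integral_mkcondr; apply: ae_eq_integral => //.
- exact: measurable_funTS.
- apply/(measurable_restrict _ _) => //; exact: measurable_funTS.
- exists (A `\` A0); split => //; first exact: measurableD.
  move=> x /= h; apply: contrapT => nx; apply: h => Ax.
  by rewrite patchE; case: ifPn => // /negP xA0; exfalso; apply: nx; split => // A0x;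
    apply: xA0; rewrite inE.
Qed.

Lemma divergence_continuous (phi : V -> V) : (forall i, C1 (fun x => phi x ord0 i)) ->
  continuous (divergence phi).
Proof.
by move=> phiC1 x; apply: (@cvg_bigsum R V _ (nbhs x) _) => i _; exact: (phiC1 i i).2.
Qed.

Lemma perimeter_null_diff A A0 : M A -> M A0 -> A0 `<=` A ->
  mu (A `\` A0) = 0%E -> perimeter A = perimeter A0.
Proof.
move=> mA mA0 AA0 null; rewrite /perimeter; congr ereal_sup.
by apply: eq_imagel => phi [phiC1 _ _]; apply: integral_null_diff => //;
  exact: divergence_continuous.
Qed.

Lemma sqexcess_far c r m x d : 0 <= r -> 0 < d -> d ^- 2 <= m -> 
  r + d <= enorm (x - c) -> 1 <= m * sqexcess c r x.
Proof.
move=> r0 d0 md h; have d2 : 0 < d ^+ 2 by rewrite exprn_gt0.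
have h2 : (r + d) ^+ 2 <= dot (x - c) (x - c).
  by rewrite -enorm_sqr ler_pXn2r ?nnegrE ?enorm_ge0// addr_ge0// ltW.
have h3 : d ^+ 2 <= sqexcess c r x.
  have rd : 0 <= r * d by rewrite mulr_ge0// ltW.
  by move: h2; rewrite /sqexcess sqrrD; lra.
have d20 : 0 <= d ^- 2 by rewrite invr_ge0 ltW.
apply: le_trans (ler_pM d20 (ltW d2) md h3).
by rewrite mulVf// gt_eqF.
Qed.

(** The calibrating fields of two balls and a perturbation [psi] along axis [i0]; the
    factor [s] compensates for the radii beyond [r] that the cutoffs let in. *)
Definition two_ball_field c c' r m (s : R) (i0 : 'I_n.+1) (psi : V -> R) x : V :=
  (s / r) *: (cutoff c r m x *: (x - c) + cutoff c' r m x *: (x - c')) + psi x *: e_ i0.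

Lemma gradient_two_ball_field c c' r m s i0 psi dpsi i : has_C1_gradient psi dpsi ->
  has_C1_gradient (fun x => two_ball_field c c' r m s i0 psi x ord0 i)
    (fun j x => s / r *
       ((cutoff c r m x * (i == j)%:R +
          (x - c) ord0 i * - (m * dstep (m * sqexcess c r x) * (2 * (x - c) ord0 j))) +
        (cutoff c' r m x * (i == j)%:R +
          (x - c') ord0 i * - (m * dstep (m * sqexcess c' r x) * (2 * (x - c') ord0 j)))) +
       (i == i0)%:R * dpsi j x).
Proof.
move=> psiC.
have g a := gradientM (gradient_cutoff a r m) (gradient_sub_coord a i).
have := gradientD (gradientZ (s / r) (gradientD (g c) (g c'))) (gradientZ (i == i0)%:R psiC).
by congr has_C1_gradient; apply/funext => x; rewrite /= !mxE eqxx /= (mulrC (psi x)).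
Qed.

Lemma divergence_two_ball_field c c' r m s i0 psi dpsi x : has_C1_gradient psi dpsi ->
  0 <= r -> 0 <= m -> (cball c r x /\ 1 <= m * sqexcess c' r x) \/
                      (cball c' r x /\ 1 <= m * sqexcess c r x) ->
  divergence (two_ball_field c c' r m s i0 psi) x = s / r * n.+1%:R + dpsi i0 x.
Proof.
move=> psiC r0 m0 xB.
have dE i : 'D_(e_ i) (fun y => two_ball_field c c' r m s i0 psi y ord0 i) x =
    s / r + (i == i0)%:R * dpsi i x.
  have [_ /(_ i x) [_ ->] _] := gradient_two_ball_field c c' r m s i0 i psiC.
  have inE a : cball a r x -> dstep (m * sqexcess a r x) = 0.
    rewrite /cball/= -sqexcess_le0// => h.
    by rewrite dstep_le0// mulr_ge0_le0.
  rewrite eqxx; case: xB => [[xc xc']|[xc' xc]].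
    rewrite (inE c xc) (dstep_ge1 xc') (cutoff_in r0 m0 xc) (cutoff_out xc').
    by rewrite !(mulr0, mul0r, oppr0, addr0) !mulr1.
  rewrite (inE c' xc') (dstep_ge1 xc) (cutoff_in r0 m0 xc') (cutoff_out xc).
  by rewrite !(mulr0, mul0r, oppr0, addr0, add0r) !mulr1.
rewrite /divergence (eq_bigr _ (fun i _ => dE i)) big_split/=.
rewrite sumr_const card_ord -[_ *+ _]mulr_natr; congr (_ + _).
rewrite (bigD1 i0)//= eqxx mul1r big1 ?addr0// => i /negPf ->.
by rewrite mul0r.
Qed.

(** On both balls the divergence of the test field is [s * (n + 1) / r] plus
    [eps * dpsi i0]. Its norm is at most 1 because [psi] lives where the calibrating field
    has norm at most [rho / r]. As [m] grows, [s] tends to 1, and the bound on the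
    perimeter leaves no room for a positive integral of [dpsi i0]. *)
Lemma split_ball_stationary_le c c' r rho A i0 psi dpsi : 0 < r ->
  2 * r < enorm (c - c') -> A `<=` cball c r `|` cball c' r -> M A ->
  (perimeter A <= (n.+1%:R / r)%:E * mu A)%E ->
  has_C1_gradient psi dpsi -> 0 < rho < r ->
  (forall x, ~ cball c rho x -> psi x = 0) ->
  (\int[lam]_(x in A) (dpsi i0 x)%:E <= 0)%E.
Proof.
move=> r0 cc' AB mA perA psiC /andP[rho0 rhor] psi0.
have [psic _ dpsic] := psiC.
have [b b0 psib] : exists2 b : R, 0 < b & forall x, `|psi x| <= b.
  have [b hb] := compact_bound (@compact_cball R n.+1 c rho) psic.
  exists (`|b| + 1) => [|x]; first by rewrite ltr_wpDl.
  have [xc|xc] := pselect (cball c rho x).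
    by rewrite (le_trans (hb x xc))// (le_trans (ler_norm _))// lerDl.
  by rewrite psi0// normr0 addr_ge0.
pose eps := (1 - rho / r) / b.
have eps0 : 0 < eps by rewrite divr_gt0// subr_gt0 ltr_pdivrMr// mul1r.
pose d := (enorm (c - c') - 2 * r) / 2.
have d0 : 0 < d by rewrite divr_gt0// subr_gt0.
(* the supports of the two cutoffs are disjoint *)
have far m x : d ^- 2 <= m -> 1 <= m * sqexcess c r x \/ 1 <= m * sqexcess c' r x.
  move=> md; have [h|h] := leP (r + d) (enorm (x - c)).
    by left; exact: sqexcess_far (ltW r0) d0 md h.
  right; apply: (sqexcess_far (ltW r0) d0 md).
  have : enorm (c - c') <= enorm (c - x) + enorm (x - c').
    by rewrite -(subrKA x) ler_enormD.
  rewrite (enormB c x) /d in h *; lra.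
have ABK : exists2 K, compact K & A `<=` K.
  exists (cball c r `|` cball c' r) => //.
  by apply: compactU; exact: compact_cball.
have Aoo : (mu A < +oo)%E.
  rewrite (le_lt_trans (outer_le AB))// (le_lt_trans (outerU _ _))//.
  by rewrite lte_add_pinfty// cball_fin.
(* [s m] tends to 1, and [s m ^+ 2 * (r ^+ 2 + m^-1)] is at most [r ^+ 2] *)
pose s m := m * r ^+ 2 / (m * r ^+ 2 + 1).
have main m : 0 < m -> d ^- 2 <= m ->
    (\int[lam]_(x in A) (s m / r * n.+1%:R + eps * dpsi i0 x)%:E <= perimeter A)%E.
  move=> m0 md.
  have mr0 : 0 < m * r ^+ 2 by rewrite mulr_gt0// exprn_gt0.
  have s0 : 0 <= s m by rewrite divr_ge0// ltW// addr_gt0.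
  have s1 : s m <= 1 by rewrite ler_pdivrMr ?addr_gt0// mul1r lerDl.
  have sE : s m * (m * r ^+ 2 + 1) = m * r ^+ 2 by rewrite divfK// gt_eqF// addr_gt0.
  have sr0 : 0 <= s m / r by rewrite divr_ge0// ltW.
  have inside a x : cball a r x -> ~ 1 <= m * sqexcess a r x.
    rewrite /cball/= -sqexcess_le0 ?(ltW r0)// => h; apply/negP; rewrite -ltNge.
    by rewrite (le_lt_trans _ ltr01)// mulr_ge0_le0// ltW.
  have radial1 a x : s m / r * (cutoff a r m x * enorm (x - a)) <= 1.
    have [h|h] := leP 1 (m * sqexcess a r x); first by rewrite cutoff_out// mul0r mulr0.
    have /andP[f0 f1] := cutoff_bounds a r m x.
    apply: (@le_trans _ _ (s m / r * enorm (x - a))).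
      by rewrite ler_wpM2l// ler_piMl ?enorm_ge0.
    rewrite mulrAC ler_pdivrMr// mul1r.
    have sy0 : 0 <= s m * enorm (x - a) by rewrite mulr_ge0 ?enorm_ge0.
    rewrite -(ler_pXn2r (ltn0Sn 1)) ?nnegrE//; last exact: ltW.
    rewrite exprMn enorm_sqr; set q := dot _ _ in h *.
    have q0 : 0 <= q by exact: dot_ge0.
    have hq : s m * q <= r ^+ 2.
      rewrite -(ler_pM2l m0) -sE mulrCA ler_wpM2l//.
      by move: h; rewrite /sqexcess -/q; lra.
    apply: le_trans hq; rewrite ler_wpM2r//.
    by rewrite expr2 ler_piMl.
  have epsC := gradientZ eps psiC.
  pose Phi := two_ball_field c c' r m (s m) i0 (fun x => eps * psi x).
  have tPhi : test_field Phi.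
    split.
    - by move=> i; exact: has_C1_gradient_C1 (gradient_two_ball_field c c' r m (s m) i0 i epsC).
    - pose K := cball c (r + d) `|` cball c' (r + d).
      have cK : compact K by apply: compactU; exact: compact_cball.
      have PK : [set x | Phi x != 0] `<=` K.
        move=> x /eqP Px; apply: contrapT => /not_orP[/negP xc /negP xc']; apply: Px.
        move: xc xc'; rewrite -!ltNge => xc xc'.
        rewrite /Phi /two_ball_field (cutoff_out (sqexcess_far (ltW r0) d0 md (ltW xc))).
        rewrite (cutoff_out (sqexcess_far (ltW r0) d0 md (ltW xc'))) !scale0r addr0 scaler0.
        rewrite psi0 ?mulr0 ?scale0r ?addr0// => xrho.
        have : enorm (x - c) <= rho := xrho.
        by lra.
      have clK : closed K by apply: closedU; exact: cball_closed.
      apply: subclosed_compact cK _; first exact: closed_closure.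
      by rewrite (closure_id K).1//; exact: closureS.
    - move=> x; rewrite /Phi /two_ball_field.
      have [xrho|xrho] := pselect (cball c rho x).
        have xc : cball c r x by exact: le_trans (xrho : (_ <= rho)) (ltW rhor).
        have [/(inside c x xc)//|xc'] := far m x md.
        rewrite (cutoff_out xc') scale0r addr0 (cutoff_in (ltW r0) (ltW m0) xc) scale1r.
        rewrite (le_trans (ler_enormD _ _))// !enormZ.
        have -> : enorm (e_ i0) = 1 by rewrite /enorm dot_delta mxE !eqxx sqrtr1.
        rewrite mulr1 (normrM eps) (gtr0_norm eps0) (ger0_norm sr0).
        have h1 : s m / r * enorm (x - c) <= rho / r.
          rewrite mulrAC ler_pM2r ?invr_gt0//.
          by rewrite (le_trans _ (xrho : (_ <= rho)))// ler_piMl ?enorm_ge0.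
        have h2 : eps * `|psi x| <= 1 - rho / r.
          have <- : eps * b = 1 - rho / r by rewrite divfK// gt_eqF.
          exact: (ler_wpM2l (ltW eps0) (psib x)).
        by apply: le_trans (lerD h1 h2) _; rewrite addrC subrK.
      rewrite (psi0 x xrho) mulr0 scale0r addr0 enormZ (ger0_norm sr0).
      have := radial1 c x; have := radial1 c' x.
      have /andP[f0 _] := cutoff_bounds c r m x.
      have /andP[f0' _] := cutoff_bounds c' r m x.
      by have [h|h] := far m x md; rewrite (cutoff_out h) scale0r ?add0r ?addr0 enormZ ger0_norm.
  have -> : (\int[lam]_(x in A) (s m / r * n.+1%:R + eps * dpsi i0 x)%:E =
      \int[lam]_(x in A) (divergence Phi x)%:E)%E.
    apply: eq_integral => x; rewrite inE => /AB xB; congr EFin.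
    rewrite (divergence_two_ball_field (s m) i0 epsC (ltW r0) (ltW m0))//.
    by case: xB => xB; [left|right]; split => //; have [|] := far m x md => // /(inside _ _ xB).
  by apply: ereal_sup_ubound; exists Phi.
have mu_fin : mu A \is a fin_num by rewrite ge0_fin_numE ?outer_ge0.
have intd : lam.-integrable (A : set T) (EFin \o dpsi i0).
  exact: integrable_continuous.
have I_fin : (\int[lam]_(x in A) (dpsi i0 x)%:E)%E \is a fin_num by exact: integrable_fin_num.
set a := fine (mu A); set I := fine (\int[lam]_(x in A) (dpsi i0 x)%:E)%E.
pose K := n.+1%:R / r * a; pose eI := eps * I.
have main2 m : 0 < m -> d ^- 2 <= m -> eI * (m * r ^+ 2 + 1) <= K.
  move=> m0 md; have := le_trans (main m m0 md) perA.
  have w0 : 0 < m * r ^+ 2 + 1 by rewrite addr_gt0// mulr_gt0// exprn_gt0.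
  have sE : s m * (m * r ^+ 2 + 1) = m * r ^+ 2 by rewrite divfK// gt_eqF.
  have -> : (\int[lam]_(x in A) (s m / r * n.+1%:R + eps * dpsi i0 x)%:E =
      (s m * K + eI)%:E)%E.
    transitivity (\int[lam]_(x in A) ((cst (s m / r * n.+1%:R)%:E \+
        (fun x => eps%:E * (dpsi i0 x)%:E)) x))%E.
      by apply: eq_integral => x _; rewrite /= -EFinM -EFinD.
    rewrite integralD//; last 2 first.
    - exact: (integrable_continuous mA ABK (@cst_continuous _ _ _)).
    - exact: integrableZl.
    rewrite [X in (X + _)%E](integral_cst lam mA (s m / r * n.+1%:R)%:E) integralZl//.
    rewrite -[X in (_ * X + _)%E](fineK mu_fin) -[X in (_ + _ * X)%E](fineK I_fin).
    by rewrite -!EFinM -EFinD /K /eI /a /I; congr EFin; ring.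
  rewrite -(fineK mu_fin) -EFinM lee_fin -/a -/K => h.
  have := ler_wpM2r (ltW w0) h; rewrite mulrDl mulrAC sE; lra.
rewrite -(fineK I_fin) lee_fin -/I leNgt; apply/negP => I0.
have eI0 : 0 < eI by rewrite mulr_gt0.
have a0 : 0 <= a by rewrite fine_ge0 ?outer_ge0.
have K0 : 0 <= K by rewrite mulr_ge0// divr_ge0// ltW.
have r20 : 0 < r ^+ 2 by rewrite exprn_gt0.
have dm0 : 0 < d ^- 2 by rewrite invr_gt0 exprn_gt0.
(* large enough to contradict [main2] *)
pose m := d ^- 2 + K / eI / r ^+ 2.
have t0 : 0 <= K / eI / r ^+ 2 by rewrite !divr_ge0//; exact: ltW.
have m0 : 0 < m by rewrite ltr_wpDr.
have := main2 m m0; rewrite lerDl => /(_ t0).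
have -> : eI * (m * r ^+ 2 + 1) = eI * (d ^- 2 * r ^+ 2 + 1) + K.
  have h : K / eI / r ^+ 2 * r ^+ 2 = K / eI by rewrite divfK// gt_eqF.
  have h' : eI * (K / eI) = K by rewrite mulrC divfK// gt_eqF.
  by rewrite /m [_ * r ^+ 2]mulrDl h -[in RHS]h'; ring.
rewrite gerDr leNgt mulr_gt0//.
by rewrite ltr_wpDl// mulr_ge0// ltW.
Qed.

(** Both [psi] and [- psi] are admissible perturbations. *)
Lemma split_ball_stationary c c' r rho A i0 psi dpsi : 0 < r ->
  2 * r < enorm (c - c') -> A `<=` cball c r `|` cball c' r -> M A ->
  (perimeter A <= (n.+1%:R / r)%:E * mu A)%E ->
  has_C1_gradient psi dpsi -> 0 < rho < r ->
  (forall x, ~ cball c rho x -> psi x = 0) ->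
  (\int[lam]_(x in A) (dpsi i0 x)%:E = 0)%E.
Proof.
move=> r0 cc' AB mA perA psiC rhor psi0.
have ABK : exists2 K, compact K & A `<=` K.
  exists (cball c r `|` cball c' r) => //.
  by apply: compactU; exact: compact_cball.
apply/eqP; rewrite eq_le (split_ball_stationary_le i0 r0 cc' AB mA perA psiC rhor psi0)/=.
have nC := gradientZ (-1) psiC.
have := split_ball_stationary_le i0 r0 cc' AB mA perA nC rhor.
have h x : ~ cball c rho x -> -1 * psi x = 0 by move=> /psi0 ->; rewrite mulr0.
move=> /(_ h); under eq_integral do rewrite EFinM.
rewrite integralZl//; last by apply: integrable_continuous => //; have [_ _] := psiC; apply.
by rewrite EFinN mulN1e oppe_le0.
Qed.

End two_balls.

(** * Stationary sets are null or full *)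

Lemma istep_ge1 {R : realType} (t : R) : 1 <= t -> istep t = t - 2^-1.
Proof. by move=> t0; rewrite /istep /second_diff !ramp_pos; lra. Qed.

Section products.
Context {R : realType} {n : nat}.
Local Notation V := 'rV[R]_n.+1.
Local Notation e_ j := (delta_mx ord0 j : V).

Lemma gradient_prod (k dk : 'I_n.+1 -> R -> R) :
  (forall i (t : R), is_derive t 1 (k i) (dk i t)) -> (forall i, continuous (dk i)) ->
  has_C1_gradient (fun x : V => \prod_i k i (x ord0 i))
    (fun j x => dk j (x ord0 j) * \prod_(i | i != j) k i (x ord0 i)).
Proof.
move=> kd dkc.
have [df fC] : exists df, has_C1_gradient (fun x : V => \prod_i k i (x ord0 i)) df.
  elim: (index_enum _) => [|i s [df IH]].
    exists (fun _ _ => 0); have := @gradient_cst R n 1.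
    by congr has_C1_gradient; apply/funext => x; rewrite big_nil.
  have h := gradientM (gradient_chain (gradient_coord i) (kd i) (dkc i)) IH.
  have E : (fun x : V => \prod_(j <- i :: s) k j (x ord0 j)) =
      (fun x : V => k i (x ord0 i)) \* (fun x : V => \prod_(j <- s) k j (x ord0 j)).
    by apply/funext => x; rewrite big_cons.
  by rewrite E; eexists; exact: h.
suff <- : df = (fun j x => dk j (x ord0 j) * \prod_(i | i != j) k i (x ord0 i)) by [].
apply/funext => j; apply/funext => x; have [_ /(_ j x) [_ <-] _] := fC.
suff [_ ->] : is_derive x (e_ j) (fun x : V => \prod_i k i (x ord0 i))
  (dk j (x ord0 j) * \prod_(i | i != j) k i (x ord0 i)) by [].
apply: is_derive_of_line; set P := \prod_(i | i != j) _.
have -> : (fun s : R => \prod_i k i ((x + s *: e_ j) ord0 i)) =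
    P \*: (fun s : R => k j (1 * (s - - x ord0 j))).
  apply/funext => s; rewrite /= -[RHS]/(P * _) mulrC (bigD1 j)//= !mxE !eqxx/= mulr1.
  rewrite mul1r opprK (addrC s); congr (_ * _); apply: eq_bigr => i /negPf ij.
  by rewrite !mxE ij mulr0 addr0.
have := is_deriveZ P (is_derive_affine 1 (- x ord0 j) (kd j) 0).
by rewrite sub0r opprK !mul1r -[_ *: _]/(_ * _) mulrC.
Qed.

End products.

Section plateaus.
Context {R : realType}.
Implicit Types (m s t a : R).

(** A smooth version of the indicator of the interval from 0 to [s], sharper as [m] grows.
    Its explicit primitive makes the difference of two plateaus the derivative of a
    function of bounded support. *)
Definition plateau m s t := step (m * t) - step (m * (t - s)).
Definition plateau_prim m s t := m^-1 * (istep (m * t) - istep (m * (t - s))).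

Lemma is_derive_plateau_prim m s t : m != 0 -> is_derive t 1 (plateau_prim m s) (plateau m s t).
Proof.
move=> m0.
have h a : is_derive t 1 (fun t => istep (m * (t - a))) (m * step (m * (t - a))).
  exact: is_derive_affine is_derive_istep t.
have := is_deriveZ m^-1 (is_deriveB (h 0) (h s)).
rewrite (_ : m^-1 *: _ = plateau m s t); last first.
  by rewrite -[LHS]/(m^-1 * _) -mulrBr mulKf// subr0.
congr is_derive; apply/funext => x.
by rewrite -[LHS]/(m^-1 * (istep (m * (x - 0)) - istep (m * (x - s)))) subr0.
Qed.

Lemma affine_continuous (k : R -> R) m a : continuous k ->
  continuous (fun t => k (m * (t - a))).
Proof.
move=> kc t; apply: (@continuous_comp _ _ _ (fun t => m * (t - a)) k); last exact: kc.
apply: (@continuousM R R (cst m) (fun t => t - a)); first exact: cst_continuous.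
by apply: (@continuousB R R R); [exact: cvg_id|exact: cst_continuous].
Qed.

Lemma scaled_continuous (k : R -> R) m : continuous k -> continuous (fun t => k (m * t)).
Proof.
move=> kc; rewrite (_ : (fun t => _) = (fun t => k (m * (t - 0)))).
  exact: affine_continuous.
by apply/funext => t; rewrite subr0.
Qed.

Lemma plateau_continuous m s : continuous (plateau m s).
Proof.
move=> t; apply: (@continuousB R R R (fun t => step (m * t))).
  exact: (@scaled_continuous step m step_continuous t).
exact: (@affine_continuous step m s step_continuous t).
Qed.

Lemma is_derive_plateau m s t :
  is_derive t 1 (plateau m s) (m * dstep (m * t) - m * dstep (m * (t - s))).
Proof.
have h a : is_derive t 1 (fun t => step (m * (t - a))) (m * dstep (m * (t - a))).
  exact: is_derive_affine is_derive_step t.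
have := is_deriveB (h 0) (h s); rewrite subr0.
congr is_derive; apply/funext => x.
by rewrite -[LHS]/(step (m * (x - 0)) - step (m * (x - s))) subr0.
Qed.

Lemma dplateau_continuous m s :
  continuous (fun t => m * dstep (m * t) - m * dstep (m * (t - s))).
Proof.
move=> t; apply: (@continuousB R R R (fun t => m * dstep (m * t))
  (fun t => m * dstep (m * (t - s)))).
  apply: (@continuousM R R (cst m) (fun t => dstep (m * t))); first exact: cst_continuous.
  exact: (@scaled_continuous dstep m (@dstep_continuous R) t).
apply: (@continuousM R R (cst m) (fun t => dstep (m * (t - s)))); first exact: cst_continuous.
exact: (@affine_continuous dstep m s (@dstep_continuous R) t).
Qed.

Lemma plateau_left m s t : 0 < m -> 0 < s -> t <= 0 -> plateau m s t = 0.
Proof.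
by move=> m0 s0 t0; rewrite /plateau !step_le0 ?subrr//; apply: mulr_ge0_le0; lra.
Qed.

Lemma plateau_right m s t : 0 < m -> 0 < s -> s + m^-1 <= t -> plateau m s t = 0.
Proof.
move=> m0 s0 t0; have h : 1 <= m * (t - s) by rewrite -ler_pdivrMl// mulr1; lra.
rewrite /plateau !step_ge1 ?subrr//; apply: (le_trans h).
by rewrite ler_pM2l//; lra.
Qed.

Lemma plateau_prim_left m s t : 0 < m -> 0 < s -> t <= 0 -> plateau_prim m s t = 0.
Proof.
by move=> m0 s0 t0; rewrite /plateau_prim !istep_le0 ?subrr ?mulr0//; apply: mulr_ge0_le0; lra.
Qed.

Lemma plateau_prim_right m s t : 0 < m -> 0 < s -> s + m^-1 <= t -> plateau_prim m s t = s.
Proof.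
move=> m0 s0 t0; have h : 1 <= m * (t - s) by rewrite -ler_pdivrMl// mulr1; lra.
rewrite /plateau_prim !istep_ge1//; first by field; rewrite gt_eqF.
by apply: (le_trans h); rewrite ler_pM2l//; lra.
Qed.

Lemma plateau_norm m s t : `|plateau m s t| <= 1.
Proof.
have /andP[? ?] := step_bounds (m * t); have /andP[? ?] := step_bounds (m * (t - s)).
by rewrite /plateau ler_norml; apply/andP; split; lra.
Qed.

Lemma plateau_cvg s t : 0 < s -> plateau k.+1%:R s t @[k --> \oo] --> ((0 < t <= s)%R%:R : R).
Proof.
have st x : step (k.+1%:R * x) @[k --> \oo] --> ((0 < x)%R%:R : R).
  have [x0|x0] := ltP 0 x; last first.
    under eq_fun do rewrite step_le0 ?mulr_ge0_le0//.
    exact: cvg_cst.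
  apply: cvg_near_cst; exists (Num.truncn x^-1) => // k /= hk.
  apply: step_ge1; rewrite -ler_pdivrMr// div1r.
  by rewrite (le_trans (ltW (truncnS_gt _)))// ler_nat ltnS.
move=> s0; rewrite (_ : (0 < t <= s)%R%:R = (0 < t)%R%:R - (0 < t - s)%R%:R :> R); first exact: cvgB.
rewrite subr_gt0; have [t0|t0] := ltP 0 t; have [ts|ts] := ltP s t; rewrite /= ?subrr ?subr0//.
by exfalso; lra.
Qed.

End plateaus.

Section stationary_sets.
Context {R : realType} {n : nat}.
Local Notation V := 'rV[R]_n.+1.
Local Notation mu := (@lebesgue_outer R n).
Local Notation lam := (@lebesgue R n).
Local Notation M := (lebesgue_outer.-caratheodory).
Local Notation T := (caratheodory_type (@lebesgue_outer R n)).
Local Notation e_ j := (delta_mx ord0 j : V).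
Implicit Types (c x a b : V) (A : set V).

(** The indicator of [A] has zero distributional gradient in the open ball. *)
Definition stationary A c (r : R) := forall i psi dpsi (rho : R),
  has_C1_gradient psi dpsi -> 0 < rho < r ->
  (forall x, ~ cball c rho x -> psi x = 0) ->
  (\int[lam]_(x in A) (dpsi i x)%:E = 0)%E.

Lemma indic_hcube a (s : R) x :
  \1_(hcube a s) x = \prod_j (0 < x ord0 j - a ord0 j <= s)%R%:R :> R.
Proof.
rewrite indicE; have [|/negP xQ] := boolP (x \in hcube a s).
  rewrite inE => /hcubeP xQ; rewrite big1// => j _.
  by have /andP[h1 h2] := xQ j; rewrite subr_gt0 lerBlDl h1 h2.
have /existsNP[j hj] : ~ forall j, a ord0 j < x ord0 j <= a ord0 j + s.
  by move=> h; apply: xQ; rewrite inE; apply/hcubeP.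
rewrite (bigD1 j)//= subr_gt0 lerBlDl.
by case: (_ && _) hj => //; rewrite mul0r.
Qed.

(** The smoothed indicator of a cube minus that of its translate along axis [i] is an [i]-th
    partial derivative of a product of functions of one variable, supported in the box
    [ab]; so its integral over [A] is zero. *)
Lemma outer_translate_pos A c (r rho : R) (ab : V * V) a (s d t : R) i :
  M A -> (mu A < +oo)%E -> stationary A c r ->
  0 < rho < r -> box ab `<=` cball c rho -> 0 < s -> 0 < d -> 0 < t ->
  (forall j, ab.1 ord0 j <= a ord0 j /\ a ord0 j + s + d <= ab.2 ord0 j) ->
  a ord0 i + t + s + d <= ab.2 ord0 i ->
  mu (A `&` hcube a s) = mu (A `&` hcube (a + t *: e_ i) s).
Proof.
move=> mA Aoo statA rhor boxB s0 d0 t0 hab habi.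
pose k0 := Num.truncn d^-1; pose m k : R := (k + k0).+1%:R.
have m0 k : 0 < m k by [].
have md k : (m k)^-1 <= d.
  rewrite -[leRHS]invrK lef_pV2 ?posrE ?invr_gt0// (le_trans (ltW (truncnS_gt _)))//.
  by rewrite ler_nat ltnS leq_addl.
pose f k j tau := if j == i then plateau_prim (m k) s (1 * (tau - a ord0 i)) -
    plateau_prim (m k) s (1 * (tau - (a ord0 i + t))) else plateau (m k) s (1 * (tau - a ord0 j)).
pose df k j tau := if j == i then 1 * plateau (m k) s (1 * (tau - a ord0 i)) -
    1 * plateau (m k) s (1 * (tau - (a ord0 i + t))) else
    1 * (m k * dstep (m k * (1 * (tau - a ord0 j))) -
         m k * dstep (m k * (1 * (tau - a ord0 j) - s))).
have fd k j (tau : R) : is_derive tau 1 (f k j) (df k j tau).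
  rewrite /f /df; case: eqP => _.
    have mk0 : m k != 0 by rewrite gt_eqF.
    apply: is_deriveB; exact: (@is_derive_affine _ (plateau_prim (m k) s) (plateau (m k) s) 1 _
      (fun t => @is_derive_plateau_prim R (m k) s t mk0)).
  exact: (@is_derive_affine _ (plateau (m k) s) _ 1 _ (@is_derive_plateau R (m k) s)).
have dfc k j : continuous (df k j).
  rewrite /df; case: eqP => _ tau.
    have pc (b : R) : continuous (fun tau : R => 1 * plateau (m k) s (1 * (tau - b))).
      move=> tau'; apply: (@continuousM R R (cst 1) (fun tau => plateau (m k) s (1 * (tau - b)))).
        exact: cst_continuous.
      exact: (@affine_continuous _ _ 1 b (@plateau_continuous R (m k) s)).
    exact: (@continuousB R R R _ _ tau (pc _ tau) (pc _ tau)).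
  apply: (@continuousM R R (cst 1) (fun tau => (m k * dstep (m k * (1 * (tau - a ord0 j))) -
         m k * dstep (m k * (1 * (tau - a ord0 j) - s))))); first exact: cst_continuous.
  exact: (@affine_continuous _ (fun y => m k * dstep (m k * y) - m k * dstep (m k * (y - s)))
    1 _ (@dplateau_continuous R (m k) s)).
have grad k := gradient_prod (fd k) (dfc k).
have supp k x : ~ cball c rho x -> \prod_j f k j (x ord0 j) = 0.
  move=> xB; have /existsNP[j xj] : ~ forall j, ab.1 ord0 j <= x ord0 j <= ab.2 ord0 j.
    by move=> h; apply: xB; exact: boxB.
  have [h1 h2] := hab j; have mdk := md k.
  have {}xj : x ord0 j < ab.1 ord0 j \/ ab.2 ord0 j < x ord0 j.
    by case: (ltP (x ord0 j)) => [|h3]; [left|right]; rewrite // ltNge; apply/negP => h4;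
      apply: xj; rewrite h3 h4.
  rewrite (bigD1 j)//= /f; move: (m k) (m0 k) mdk => mk mk0 mdk; case: eqP => [ji|_].
    subst j; case: xj => xj.
      by rewrite !plateau_prim_left ?subrr ?mul0r//; lra.
    by rewrite !plateau_prim_right ?subrr ?mul0r//; lra.
  case: xj => xj.
    by rewrite plateau_left ?mul0r//; lra.
  by rewrite plateau_right ?mul0r//; lra.
have zero k : (\int[lam]_(x in A)
    (df k i (x ord0 i) * \prod_(j | j != i) f k j (x ord0 j))%:E = 0)%E.
  exact: (statA i _ _ rho (grad k) rhor (supp k)).
have lim : (\int[lam]_(x in A) (df k i (x ord0 i) * \prod_(j | j != i) f k j (x ord0 j))%:E
    @[k --> \oo] --> \int[lam]_(x in A) (\1_(hcube a s) x - \1_(hcube (a + t *: e_ i) s) x)%:E)%E.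
  apply: (@cvg_integral_bounded _ _ _ _ _ 2) => //.
  - by move=> k; apply: continuous_measurable; have [_ _] := grad k; apply.
  - move=> x _; have bc tau : plateau (m k) s tau @[k --> \oo] --> ((0 < tau <= s)%R%:R : R).
      by have := @plateau_cvg R s tau s0; rewrite -(cvg_shiftn k0).
    rewrite !indic_hcube (bigD1 i)//= [X in _ - X](bigD1 i)//=.
    rewrite [X in _ - _ * X](_ : _ = \prod_(j | j != i) (0 < x ord0 j - a ord0 j <= s)%R%:R); last first.
      by apply: eq_bigr => j /negPf ji; rewrite !mxE ji mulr0 addr0.
    rewrite -mulrBl; apply: cvgM.
      rewrite /df eqxx !mul1r !mxE !eqxx mulr1.
      by under eq_fun do rewrite !mul1r; apply: cvgB; exact: bc.
    apply: (@cvg_bigprod _ _ _ \oo _) => j /negPf ji.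
    by rewrite /f ji mul1r; exact: bc.
  - move=> k x _; rewrite normrM normr_prod -[2]mulr1 ler_pM ?prodr_ge0//.
      rewrite /df eqxx !mul1r (le_trans (ler_normB _ _))// (le_trans (lerD (plateau_norm _ _ _) (plateau_norm _ _ _)))//.
    apply: prodr_ile1 => j /negPf ji; rewrite normr_ge0/= /f ji; exact: plateau_norm.
have mQ b : M (hcube b s) by exact: hbox_measurable.
have : (\int[lam]_(x in A) (\1_(hcube a s) x - \1_(hcube (a + t *: e_ i) s) x)%:E = 0)%E.
  by rewrite -(cvg_lim _ lim)//; under eq_fun do rewrite zero; rewrite lim_cst.
under eq_integral do rewrite EFinB.
have intQ b : lam.-integrable (A : set T) (EFin \o \1_(hcube b s)).
  apply: (@integrable_bounded _ _ _ _ 1) => //.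
  - by apply: measurable_indic; exact: mQ.
  - by move=> x _; rewrite ger0_norm ?indicE// lern1 leq_b1.
rewrite integralB_EFin// !integral_indic//; try exact: mQ.
have fin b : mu (hcube b s `&` A) \is a fin_num by exact: (outer_fin (@subIsetr _ _ _) Aoo).
rewrite !(setIC A) -[X in (X - _)%E](fineK (fin a)) -[X in (_ - X)%E](fineK (fin _)).
move=> /eqP; rewrite -EFinB eqe subr_eq0 => /eqP h.
by rewrite -(fineK (fin a)) h (fineK (fin _)).
Qed.

Lemma outer_translate A c (r rho : R) (ab : V * V) a (s d t : R) i :
  M A -> (mu A < +oo)%E -> stationary A c r ->
  0 < rho < r -> box ab `<=` cball c rho -> 0 < s -> 0 < d ->
  (forall j, ab.1 ord0 j <= a ord0 j /\ a ord0 j + s + d <= ab.2 ord0 j) ->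
  ab.1 ord0 i <= a ord0 i + t -> a ord0 i + t + s + d <= ab.2 ord0 i ->
  mu (A `&` hcube a s) = mu (A `&` hcube (a + t *: e_ i) s).
Proof.
move=> mA Aoo statA rhor boxB s0 d0 hab habi habi'.
have [t0|t0|->] := ltgtP t 0; last by rewrite scale0r addr0.
- rewrite [RHS](outer_translate_pos mA Aoo statA rhor boxB s0 d0 (t := - t) (i := i)).
  + by rewrite scaleNr addrK.
  + by rewrite oppr_gt0.
  + move=> j; have [h1 h2] := hab j; rewrite !mxE eqxx/=.
    by have [->|_] := eqVneq j i; rewrite ?mulr1 ?mulr0 ?addr0.
  + by rewrite !mxE !eqxx mulr1 addrK; have [] := hab i.
- exact: (outer_translate_pos mA Aoo statA rhor boxB s0 d0 t0 hab habi').
Qed.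

(** The corner moves from [a] to [b] along a staircase inside the box. *)
Lemma outer_translate_box A c (r rho : R) (ab : V * V) a b (s d : R) :
  M A -> (mu A < +oo)%E -> stationary A c r ->
  0 < rho < r -> box ab `<=` cball c rho -> 0 < s -> 0 < d ->
  (forall j, ab.1 ord0 j <= a ord0 j /\ a ord0 j + s + d <= ab.2 ord0 j) ->
  (forall j, ab.1 ord0 j <= b ord0 j /\ b ord0 j + s + d <= ab.2 ord0 j) ->
  mu (A `&` hcube a s) = mu (A `&` hcube b s).
Proof.
move=> mA Aoo statA rhor boxB s0 d0 ha hb.
suff H k : (k <= n.+1)%N -> mu (A `&` hcube a s) = mu (A `&` hcube (stair a b k) s).
  by rewrite -[in RHS](stair_end a b); exact: H.
elim: k => [_|k IH kn]; first by rewrite stair0.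
rewrite (IH (ltnW kn)).
have := stairS a b (Ordinal kn); rewrite /= => ->.
have hs j : ab.1 ord0 j <= stair a b k ord0 j /\ stair a b k ord0 j + s + d <= ab.2 ord0 j.
  by rewrite mxE; case: ifP.
have E : stair a b k ord0 (Ordinal kn) = a ord0 (Ordinal kn) by rewrite mxE ltnn.
apply: (outer_translate mA Aoo statA rhor boxB s0 d0 hs); rewrite E addrCA subrr addr0;
  by have [] := hb (Ordinal kn).
Qed.

(** Small cubes of one size meet [A] in the same measure, so [A] takes up in each of them
    at most its share [th] of the cube of side [L], and hence at most this share of every
    set. The part of [A] in the cube of side [L] takes up all of itself, so the share is 1
    unless this part is null. *)
Lemma cube_dichotomy A c (r rho : R) g (L : R) :
  M A -> (mu A < +oo)%E -> stationary A c r -> 0 < rho < r -> 0 < L ->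
  box (g - const_mx L, g + const_mx (3 * L)) `<=` cball c rho ->
  mu (A `&` hcube g L) = 0%E \/ mu (hcube g L `\` A) = 0%E.
Proof.
move=> mA Aoo statA rhor L0 boxB; set G := hcube g L; set ab := (_, _) in boxB.
pose s k : R := L / k.+1%:R.
have s0 k : 0 < s k by rewrite divr_gt0.
have sL k : s k <= L by rewrite ler_pdivrMr// ler_peMr ?ler1n// ltW.
have region k b : (forall j, g ord0 j - s k <= b ord0 j /\ b ord0 j <= g ord0 j + L) ->
    forall j, ab.1 ord0 j <= b ord0 j /\ b ord0 j + s k + L <= ab.2 ord0 j.
  by move=> h j; have [h1 h2] := h j; have := sL k; rewrite !mxE; split; lra.
have hg k : forall j, ab.1 ord0 j <= g ord0 j /\ g ord0 j + s k + L <= ab.2 ord0 j.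
  by apply: region => j; have := s0 k; split; lra.
have same k b : (forall j, g ord0 j - s k <= b ord0 j /\ b ord0 j <= g ord0 j + L) ->
    mu (A `&` hcube b (s k)) = mu (A `&` hcube g (s k)).
  move=> h; apply: esym.
  exact: (outer_translate_box mA Aoo statA rhor boxB (s0 k) L0 (hg k) (region k b h)).
have fin X : mu (A `&` X) \is a fin_num by exact: (outer_fin (@subIsetl _ _ _) Aoo).
have GE k : grid_box g (s k) (fun=> k.+1) = G.
  by rewrite /G /hcube /grid_box; congr hbox; apply/rowP => i; rewrite !mxE divfK.
pose th := fine (mu (A `&` G)) / L ^+ n.+1.
have L0n : 0 < L ^+ n.+1 by rewrite exprn_gt0.
have th0 : 0 <= th by rewrite divr_ge0 ?fine_ge0 ?outer_ge0// ltW.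
have cell k : fine (mu (A `&` hcube g (s k))) <= th * s k ^+ n.+1.
  have kn0 : 0 < (k.+1%:R : R) ^+ n.+1 by rewrite exprn_gt0.
  have := @grid_box_ge _ _ A (s k) (fine (mu (A `&` hcube g (s k)))) g (fun=> k.+1) (ltW (s0 k)).
  rewrite GE prod_nat_const card_ord -[mu (A `&` G)](fineK (fin G)) lee_fin natrX => h.
  rewrite /th /s expr_div_n mulrA divfK ?gt_eqF// ler_pdivlMr// mulrC.
  apply: h => b bG; rewrite fineK ?fin// same// => j.
  have : hcube b (s k) (b + const_mx (s k)).
    by apply/hcubeP => i; rewrite !mxE ltrDl s0 lexx.
  move=> /bG /hcubeP /(_ j); rewrite !mxE => /andP[? ?].
  by have := s0 k; split; lra.
pose nu (S : set V) := mu (A `&` G `&` S).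
have nu0 : nu set0 = 0%E by rewrite /nu setI0 lebesgue_outer0.
have nu_ge0 S : (0 <= nu S)%E by exact: outer_ge0.
have le_nu : {homo nu : S S' / S `<=` S' >-> (S <= S')%E}.
  by move=> S S' SS; apply: outer_le; exact: setIS.
have nu_sub : sigma_subadditive nu.
  by move=> F; rewrite /nu setI_bigcupr; exact: lebesgue_outer_sigma_subadditive.
pose nuM : {outer_measure set V -> \bar R} :=
  HB.pack nu (isOuterMeasure.Build R V nu nu0 nu_ge0 le_nu nu_sub).
have dom S : (nu S <= th%:E * mu S)%E.
  apply: (@lebesgue_outer_dominates _ _ nuM th L 0%N th0 L0) => k b _.
  rewrite -[X in (X <= _)%E]/(mu (A `&` G `&` hcube b (s k))).
  have [h|/existsNP[j hj]] :=
      pselect (forall j, g ord0 j - s k <= b ord0 j /\ b ord0 j <= g ord0 j + L).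
    apply: (@le_trans _ _ (mu (A `&` hcube b (s k)))).
      by apply: outer_le => x [[Ax _] bx].
    by rewrite same// -[X in (X <= _)%E](fineK (fin _)) lee_fin; exact: cell.
  rewrite (_ : _ `&` hcube b (s k) = set0).
    by rewrite lebesgue_outer0 lee_fin (mulr_ge0 th0 (exprn_ge0 _ (ltW (s0 k)))).
  apply/seteqP; split => // x [[_ /hcubeP /(_ j)/andP[h1 h2]] /hcubeP /(_ j)/andP[h3 h4]].
  by apply: hj; split; lra.
have [->|Gn0] := eqVneq (mu (A `&` G)) 0%E; [by left|right].
have mG : M G by exact: hbox_measurable.
have GL : (mu G <= (L ^+ n.+1)%:E)%E.
  apply: (@le_trans _ _ (mu (box (g, g + const_mx L)))).
    apply: outer_le => x Gx i; have /andP[h1 h2] := Gx i.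
    by rewrite /= h2 (ltW h1).
  rewrite (le_trans (lebesgue_outer_box _))// lee_fin /box_volume/=.
  rewrite (eq_bigr (fun=> L)) ?prodr_const ?card_ord// => i _.
  by rewrite !mxE addrAC subrr add0r; apply/max_idPr; exact: ltW.
have := dom (A `&` G); rewrite /nu setIid -(fineK (fin G)) -EFinM lee_fin => h.
have f0 : 0 < fine (mu (A `&` G)).
  by rewrite -lte_fin fineK ?fin// lt_neqAle eq_sym Gn0 outer_ge0.
move: h; rewrite -ler_pdivrMr// divff ?gt_eqF// ler_pdivlMr// mul1r => h.
have : ((L ^+ n.+1)%:E + mu (G `\` A) <= (L ^+ n.+1)%:E)%E.
  apply: le_trans GL; rewrite (outer_split G mA) (setIC G) leeD2r//.
  by rewrite -(fineK (fin G)) lee_fin.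
rewrite -[leRHS]adde0 leeD2lE// => h'.
by apply/eqP; rewrite eq_le h' outer_ge0.
Qed.

End stationary_sets.

Section ball_dichotomy.
Context {R : realType} {n : nat}.
Local Notation V := 'rV[R]_n.+1.
Local Notation mu := (@lebesgue_outer R n).
Local Notation M := (lebesgue_outer.-caratheodory).
Implicit Types (c x y : V) (A U X S : set V).

Lemma locally_null X U : (forall y, U y -> exists W, [/\ open W, W y & mu (X `&` W) = 0%E]) ->
  mu (X `&` U) = 0%E.
Proof.
move=> loc; have [F basis] := @hbox_basis R n.
pose G k := if `[< mu (X `&` hbox (F k).1 (F k).2) = 0%E >]
  then X `&` hbox (F k).1 (F k).2 else set0.
apply: (@null_subset _ _ _ (\bigcup_k G k)).
  move=> y [Xy /loc[W [oW Wy W0]]]; have [k Fy FW] := basis W y oW Wy.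
  exists k => //; rewrite /G asboolT//.
  by apply: null_subset W0; exact: setIS.
by apply: null_bigcup => k; rewrite /G; case: asboolP => // _; exact: lebesgue_outer0.
Qed.

(** The segment from the centre to any point of the ball is connected. *)
Lemma oball_connected c (r : R) S S' : open S -> open S' ->
  oball c r `<=` S `|` S' -> S `&` S' = set0 -> S c -> oball c r `<=` S.
Proof.
move=> oS oS' cover disj Sc y yr; pose g (t : R) : V := c + t *: (y - c).
have gc : continuous g.
  move=> t; apply: (@continuousD R V R (cst c) (fun t => t *: (y - c))).
    exact: cst_continuous.
  exact: scalel_continuous.
have gB t : `[0, 1]%classic t -> oball c r (g t).
  rewrite /= in_itv/= => /andP[t0 t1]; rewrite /oball/= /g addrAC subrr add0r enormZ.
  by rewrite ger0_norm// (le_lt_trans _ yr)// ler_piMl ?enorm_ge0.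
pose B := `[0, 1]%classic `&` g @^-1` S.
have BE : B = `[0, 1]%classic.
  have := @segment_connected R 0 1; apply.
  - exists 0; split; first by rewrite /= in_itv/= lexx ler01.
    by rewrite /preimage/= /g scale0r addr0.
  - exists (g @^-1` S) => //; apply: open_comp => // t _; exact: gc.
  - exists (~` (g @^-1` S')).
      by apply: open_closedC; apply: open_comp => // t _; exact: gc.
    apply/seteqP; split => t [t01 h]; split => //.
      by move=> h'; have : (S `&` S') (g t) by []; rewrite disj.
    by have [] := cover _ (gB t t01).
have : B 1 by rewrite BE /= in_itv/= lexx ler01.
by case=> _; rewrite /preimage/= /g scale1r addrC subrK.
Qed.

(** In a small cube around each point of the open ball, [A] is null or full. The points of
    either kind form an open set, and the ball is connected. *)
Lemma ball_dichotomy A c (r : R) : M A -> (mu A < +oo)%E -> 0 < r -> stationary A c r ->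
  mu (A `&` cball c r) = 0%E \/ mu (cball c r `\` A) = 0%E.
Proof.
move=> mA Aoo r0 statA.
have [nul|pos] := eqVneq (mu (cball (0 : V) 1)) 0%E.
  by left; apply: null_ball_all nul.
have openpos U x : open U -> U x -> mu U <> 0%E.
  move=> oU Ux U0; have /nbhs_ballinf[e e0 eU] : nbhs x U by exact: open_nbhs_nbhs.
  move/eqP: pos; apply; apply: (@null_ball_all _ _ x (e / 2)); first by rewrite divr_gt0.
  apply: null_subset U0 => z xz; apply: eU => i.
  have := le_trans (le_coord_enorm (z - x) i) xz; rewrite !mxE distrC => h.
  by apply: (le_lt_trans h); rewrite ltr_pdivrMr// ltr_pMr// ltr1n.
pose S X := [set y | exists W, [/\ open W, W y & mu (X `&` W) = 0%E]].
have oS X : open (S X).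
  rewrite openE => y [W [oW Wy W0]]; apply: filterS (open_nbhs_nbhs (conj oW Wy)).
  by move=> z Wz; exists W.
have disj : S A `&` S (~` A) = set0.
  apply/seteqP; split => // y [[W [oW Wy W0]] [W' [oW' Wy' W0']]].
  apply: (openpos (W `&` W') y (openI oW oW')) => //.
  apply: (@null_subset _ _ _ ((A `&` W) `|` (~` A `&` W'))); last exact: nullU.
  by move=> z [Wz Wz']; have [Az|Az] := pselect (A z); [left|right].
have cover : oball c r `<=` S A `|` S (~` A).
  move=> y yr; pose d := r - enorm (y - c).
  have d0 : 0 < d by rewrite subr_gt0.
  have N0 : 0 < n.+1%:R :> R by [].
  (* the box of side [4 * L] around the cube must stay within [d / 2] of [y] *)
  pose L := d / (5 * n.+1%:R); have L0 : 0 < L by rewrite divr_gt0// mulr_gt0.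
  have dE : n.+1%:R * (5 / 2 * L) = d / 2.
    by rewrite /L; field; rewrite gt_eqF.
  pose g := y - const_mx (L / 2).
  pose rho := enorm (y - c) + d / 2.
  have rhor : 0 < rho < r.
    rewrite ltr_wpDl ?enorm_ge0 ?divr_gt0//=.
    by rewrite /rho /d; have := d0; rewrite /d; lra.
  have boxB : box (g - const_mx L, g + const_mx (3 * L)) `<=` cball c rho.
    move=> x xb; rewrite /cball/= -(subrKA y) (le_trans (ler_enormD _ _))//.
    rewrite /rho addrC lerD2l -dE (le_trans (enorm_le_sum _))//.
    rewrite mulr_natl -[X in _ *+ X](card_ord n.+1) -sumr_const.
    apply: ler_sum => i _; have := xb i; rewrite !mxE => /andP[h1 h2].
    by rewrite ler_norml; apply/andP; split; lra.
  have Gy : (hcube g L)° y.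
    apply/nbhs_ballinf; exists (L / 2) => [|x xy]; first by rewrite divr_gt0.
    apply/hcubeP => i; have := xy i; rewrite !mxE ltr_norml => /andP[h1 h2].
    by apply/andP; split; lra.
  have sub : (hcube g L)° `<=` hcube g L by exact: interior_subset.
  have [h|h] := cube_dichotomy mA Aoo statA rhor L0 boxB; [left|right];
    exists (hcube g L)°; split => //; try exact: open_interior.
    by apply: null_subset h; exact: setIS.
  by apply: null_subset h => z [Az Gz]; split => //; exact: sub.
have sph := null_sphere c r0.
have split_sphere X : mu (X `&` oball c r) = 0%E -> mu (X `&` cball c r) = 0%E.
  move=> X0; apply: null_subset (nullU X0 sph) => z [Xz zc].
  by have [zo|zo] := pselect (oball c r z); [left|right].
have [Sc|Sc] := cover c (oball_center c r0).
- left; apply: split_sphere; apply: locally_null => y.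
  by apply: (oball_connected (oS A) (oS (~` A))).
- right; rewrite setDE setIC; apply: split_sphere; apply: locally_null => y.
  apply: (oball_connected (oS (~` A)) (oS A)) => //.
    by rewrite setUC.
  by rewrite setIC.
Qed.

(** This stands in for the equality case of the isoperimetric inequality. The calibrating
    fields alone bound the perimeter of [A] below by that of a single ball, so no
    perturbation of them inside the balls can do better. *)
Lemma two_balls_dichotomy A c c' (r : R) : 0 < r -> 2 * r < enorm (c - c') ->
  M A -> mu (A `\` (cball c r `|` cball c' r)) = 0%E -> mu A = mu (cball c r) ->
  (perimeter A <= perimeter (cball c r))%E ->
  mu (A `&` cball c r) = 0%E \/ mu (cball c r `\` A) = 0%E.
Proof.
move=> r0 cc' mA null muA perA.
pose A0 := A `&` (cball c r `|` cball c' r).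
have mU : M (cball c r `|` cball c' r).
  by apply: closed_measurable_outer; apply: closedU; exact: cball_closed.
have mA0 : M A0 by exact: caratheodory_measurable_setI.
have nullA0 : mu (A `\` A0) = 0%E by rewrite setDIr setDv set0U.
have A0A : A0 `<=` A by exact: subIsetl.
have muA0 : mu A0 = mu A by rewrite [RHS](outer_split A mU) null adde0.
have A0oo : (mu A0 < +oo)%E by rewrite muA0 muA cball_fin.
have stat : stationary A0 c r.
  move=> i psi dpsi rho psiC rhor psi0.
  apply: (split_ball_stationary i r0 cc' _ mA0 _ psiC rhor psi0).
    exact: subIsetr.
  rewrite -(perimeter_null_diff mA mA0 A0A nullA0) muA0 muA.
  exact: le_trans perA (perimeter_cball_le c r0).
have [h|h] := ball_dichotomy mA0 A0oo r0 stat; [left|right].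
  by apply: null_subset h => x [Ax xc]; split => //; split => //; left.
by apply: null_subset h => x [xc nAx]; split => // -[].
Qed.

End ball_dichotomy.

(** * Inclusion up to null sets *)

Section essential.
Context {R : realType} {n : nat}.
Local Notation V := 'rV[R]_n.+1.
Local Notation mu := (@lebesgue_outer R n).
Local Notation M := (lebesgue_outer.-caratheodory).
Implicit Types (A B C X : set V).

Lemma ess_subset_incl A B : A `<=` B -> ess_subset A B.
Proof.
by move=> AB; rewrite /ess_subset (_ : _ `\` _ = set0) ?lebesgue_outer0// setD_eq0.
Qed.

Lemma ess_subset_trans B A C : ess_subset A B -> ess_subset B C -> ess_subset A C.
Proof.
move=> AB BC; apply: null_subset (nullU AB BC) => x [Ax nCx].
by have [Bx|Bx] := pselect (B x); [right|left].
Qed.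

Lemma ess_eq_subset A B : ess_eq A B -> ess_subset A B.
Proof. by move=> AB; apply: null_subset AB => x; left. Qed.

Lemma ess_eq_sym A B : ess_eq A B -> ess_eq B A.
Proof. by rewrite /ess_eq setUC. Qed.

Lemma ess_subset_bigcup (F : nat -> set V) B :
  (forall k, ess_subset (F k) B) -> ess_subset (\bigcup_k F k) B.
Proof.
move=> FB; apply: null_subset (null_bigcup FB) => x [[k _ Fx] nBx].
by exists k.
Qed.

Lemma ess_subset_bigcap A (F : nat -> set V) :
  (forall k, ess_subset A (F k)) -> ess_subset A (\bigcap_k F k).
Proof.
move=> AF; apply: null_subset (null_bigcup AF) => x [Ax nx].
by move/existsNP : nx => [k /not_implyP[_ nFx]]; exists k.
Qed.

Lemma ess_subsetU A B C : ess_subset A C -> ess_subset B C -> ess_subset (A `|` B) C.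
Proof. by move=> hA hB; apply: null_subset (nullU hA hB) => x [[Ax|Bx] nCx]; [left|right]. Qed.

Lemma ess_subset_null A B : mu A = 0%E -> ess_subset A B.
Proof. exact: null_subset (@subDsetl _ _ _). Qed.

Lemma ess_subset_eq A B : M A -> (mu B < +oo)%E -> (mu B <= mu A)%E ->
  ess_subset A B -> ess_eq A B.
Proof.
move=> mA Boo BA AB; apply: nullU => //.
have Afin : mu A \is a fin_num.
  by rewrite ge0_fin_numE ?outer_ge0// (le_lt_trans _ Boo)//; exact: outer_null_diff.
have AleB : (mu A <= mu (B `&` A))%E.
  apply: outer_null_diff; apply: null_subset AB => x [Ax h]; split => // Bx; exact: h.
have : (mu A + mu (B `\` A) <= mu A)%E.
  by apply: (le_trans _ BA); rewrite [leRHS](outer_split B mA) leeD2r.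
rewrite -[leRHS]adde0 leeD2lE// => h.
by apply/eqP; rewrite eq_le h outer_ge0.
Qed.

End essential.

(** * Balls and their reflections *)

Section mirror_balls.
Context {R : realType} {n : nat} (u : 'rV[R]_n.+1) (u1 : enorm u = 1).
Local Notation V := 'rV[R]_n.+1.
Local Notation mu := (@lebesgue_outer R n).
Implicit Types (c x : V) (r : R).

Definition open_half : set V := [set x | 0 < dot x u].

Lemma cball_open_half c r : r < dot c u -> cball c r `<=` open_half.
Proof.
move=> rc x xc; have := cauchy_schwarz (c - x) u.
rewrite u1 mulr1 !dotE => h; have : enorm (c - x) <= r by rewrite enormB.
by rewrite /open_half/=; lra.
Qed.

Lemma hrefl_open_half x : open_half x -> ~ open_half (hrefl u x).
Proof. by rewrite /open_half/= dot_hrefl// oppr_gt0 => h1 h2; lra. Qed.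

Lemma dist_mirror c : 0 <= dot c u -> enorm (c - hrefl u c) = 2 * dot c u.
Proof.
move=> cu; rewrite /hrefl opprB addrC subrK enormZ u1 mulr1.
by rewrite ger0_norm// mulr_ge0.
Qed.

Lemma convex_body_cball c r : 0 < r -> convex_body (cball c r).
Proof.
move=> r0; split; first exact: compact_cball.
- move=> x y lambda; rewrite !inE /cball/= => xc yc.
  have l0 : 0 <= lambda%:num by [].
  have l1 : lambda%:num <= 1 by [].
  pose l := lambda%:num; rewrite -/l in l0 l1.
  have -> : conv lambda x y - c = l *: (x - c) + (1 - l) *: (y - c).
    rewrite -[conv lambda x y]/(l *: (x : V) + (1 - l) *: (y : V)).
    by apply/rowP => i; rewrite !mxE; ring.
  rewrite (le_trans (ler_enormD _ _))// !enormZ !ger0_norm ?subr_ge0//.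
  have := ler_wpM2l l0 xc; have : (1 - l) * enorm (y - c) <= (1 - l) * r.
    by rewrite ler_wpM2l// subr_ge0.
  lra.
- exists c; rewrite /interior; apply: filterS (@oball_sub_cball _ _ c r) _.
  by apply: open_nbhs_nbhs; split; [exact: oball_open|exact: oball_center].
Qed.

Lemma big_ball c1 r1 c2 r2 : r1 < dot c1 u -> r2 < dot c2 u ->
  exists c r, [/\ 0 < r, r < dot c u, cball c1 r1 `<=` cball c r & cball c2 r2 `<=` cball c r].
Proof.
move=> h1 h2; have uu : dot u u = 1 by rewrite -enorm_sqr u1 expr1n.
(* the ball centred at [t u] with radius [t - d] fills the half-space [d < dot x u] as [t] grows *)
pose d := Num.min (dot c1 u - r1) (dot c2 u - r2) / 2.
have d0 : 0 < d by rewrite divr_gt0// lt_min !subr_gt0 h1.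
have [d1 d2] : 2 * d <= dot c1 u - r1 /\ 2 * d <= dot c2 u - r2.
  have -> : 2 * d = Num.min (dot c1 u - r1) (dot c2 u - r2).
    by rewrite mulrC divfK// pnatr_eq0.
  by split; rewrite ge_min lexx ?orbT.
pose t := (dot c1 c1 + dot c2 c2) / (2 * d) + `|r1| + `|r2| + 2 * d.
have t0 : 0 <= (dot c1 c1 + dot c2 c2) / (2 * d).
  apply: divr_ge0; first by rewrite addr_ge0 ?dot_ge0.
  by rewrite mulr_ge0// ltW.
have key c r : 2 * d <= dot c u - r -> dot c c <= dot c1 c1 + dot c2 c2 ->
    r <= `|r1| + `|r2| -> cball c r `<=` cball (t *: u) (t - d).
  move=> dr cc rr; apply: cball_subset; rewrite -lerBrDr.
  have tdr : 0 <= t - d - r by rewrite /t; lra.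
  rewrite -(ler_pXn2r (ltn0Sn 1)) ?nnegrE ?enorm_ge0// enorm_sqr !dotE uu (dotC u c).
  have h3 : 2 * d * t >= dot c c.
    have e : 2 * d * ((dot c1 c1 + dot c2 c2) / (2 * d)) = dot c1 c1 + dot c2 c2.
      by rewrite mulrC divfK// gt_eqF// mulr_gt0.
    apply: (le_trans cc); rewrite -[leLHS]e ler_wpM2l//; first by rewrite mulr_ge0// ltW.
    by rewrite /t -!addrA lerDl !addr_ge0// mulr_ge0// ltW.
  have h4 : 0 <= (dot c u - r - 2 * d) * t.
    rewrite mulr_ge0 ?subr_ge0//; have := normr_ge0 r1; have := normr_ge0 r2.
    by rewrite /t; lra.
  have h5 := sqr_ge0 (d + r).
  nra.
exists (t *: u), (t - d); split.
- by have := normr_ge0 r1; have := normr_ge0 r2; rewrite /t; lra.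
- by rewrite dotZl uu mulr1 gtrBl.
- apply: key => //; first by rewrite lerDl dot_ge0.
  by have := ler_norm r1; have := normr_ge0 r2; lra.
- apply: key => //; first by rewrite lerDr dot_ge0.
  by have := ler_norm r2; have := normr_ge0 r1; lra.
Qed.

End mirror_balls.

(** * Approximation by finite unions of balls *)

Section ball_unions.
Context {R : realType} {n : nat}.
Local Notation V := 'rV[R]_n.+1.
Implicit Types (C : set V) (x : V) (s : seq V) (e : R).

Definition ball_union s e : set V := [set x | exists2 c, c \in s & cball c e x].

Lemma ball_union_nil e : ball_union [::] e = set0.
Proof. by apply/seteqP; split => // x [c]. Qed.

Lemma ball_union_cons c s e : ball_union (c :: s) e = cball c e `|` ball_union s e.
Proof.
apply/seteqP; split => [x [d]|x [xc|[d ds xd]]].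
- by rewrite inE => /orP[/eqP ->|ds] xd; [left|right; exists d].
- by exists c; rewrite ?inE ?eqxx.
- by exists d; rewrite // inE ds orbT.
Qed.

Lemma ball_union_compact s e : compact (ball_union s e).
Proof.
elim: s => [|c s IH]; first by rewrite ball_union_nil; exact: compact0.
by rewrite ball_union_cons; apply: compactU => //; exact: compact_cball.
Qed.

Lemma compact_ball_cover C e : compact C -> 0 < e -> exists s,
  (forall c, c \in s -> C c) /\ C `<=` ball_union s e.
Proof.
rewrite compact_cover => cC e0.
have [||s sC Cs] := cC V C (fun c => oball c e).
- by move=> c _; exact: oball_open.
- by move=> x Cx; exists x => //; exact: oball_center.
exists (finmap.enum_fset s); split => [c /sC|x /Cs[c cs xc]]; first by rewrite inE.
by exists c => //; exact: ltW.
Qed.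

Lemma compact_margin C u : compact C -> C !=set0 -> C `<=` open_half u ->
  exists2 e, 0 < e & forall x, C x -> e < dot x u.
Proof.
move=> cC C0 Cu; have fc : {within C, continuous (fun x => dot x u)}.
  by apply: continuous_subspaceT; exact: dot_continuous.
have [c + cmin] := compact_EVT_min C0 cC fc; rewrite inE => /Cu cu.
exists (dot c u / 2); first by rewrite divr_gt0.
move=> x Cx; have := cmin x; rewrite inE => /(_ Cx) h.
apply: lt_le_trans h; rewrite ltr_pdivrMr// ltr_pMr// ?ltr1n//.
Qed.

End ball_unions.

(** * Monotone measure preserving set maps *)

Section mirror_sets.
Context {R : realType} {n : nat} (u : 'rV[R]_n.+1) (u1 : enorm u = 1).
Local Notation V := 'rV[R]_n.+1.
Local Notation mu := (@lebesgue_outer R n).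
Local Notation M := (lebesgue_outer.-caratheodory).
Local Notation T := (hrefl u).
Implicit Types (a b : bool * bool) (S : set V).

(** The identity, the reflection and the union of both in one form, so that a single
    approximation argument treats all of them. *)
Definition copies a S : set V := [set x | (a.1 /\ S x) \/ (a.2 /\ S (T x))].

Lemma copies_id S : copies (true, false) S = S.
Proof. by apply/seteqP; split => x; [case=> [[]|[]]|left]. Qed.

Lemma copies_mirror S : copies (false, true) S = hrefl_set u S.
Proof. by rewrite hrefl_setE//; apply/seteqP; split => x; [case=> [[]|[]]|right]. Qed.

Lemma copies_both S : copies (true, true) S = S `|` hrefl_set u S.
Proof.
by rewrite hrefl_setE//; apply/seteqP; split => x;
  [case=> [[]|[]]; [left|right]|case; [left|right]].
Qed.

Lemma copies_none S : copies (false, false) S = set0.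
Proof. by apply/seteqP; split => // x [[]|[]]. Qed.

Lemma copies_subset a S S' : S `<=` S' -> copies a S `<=` copies a S'.
Proof. by move=> SS x [[h /SS Sx]|[h /SS Sx]]; [left|right]. Qed.

Lemma copiesU a S S' : copies a (S `|` S') = copies a S `|` copies a S'.
Proof.
apply/seteqP; split => x.
- by move=> [[h [Sx|Sx]]|[h [Sx|Sx]]]; [left; left|right; left|left; right|right; right].
- by move=> [[[h Sx]|[h Sx]]|[[h Sx]|[h Sx]]];
    [left; split => //; left|right; split => //; left
    |left; split => //; right|right; split => //; right].
Qed.

Lemma copies_set0 a : copies a set0 = set0.
Proof. by apply/seteqP; split => // x [[]|[]]. Qed.

Lemma copies_setE a S : copies a S =
  (if a.1 then S else set0) `|` (if a.2 then hrefl_set u S else set0).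
Proof.
case: a => [[] []]; rewrite ?copies_id ?copies_mirror ?copies_both ?copies_none //=;
  by rewrite ?setU0 ?set0U.
Qed.

Lemma copies_compact a S : compact S -> compact (copies a S).
Proof.
move=> cS; have cT : compact (hrefl_set u S).
  apply: continuous_compact => //; apply: continuous_subspaceT => x.
  apply: (@continuousB R V V id (fun x => (2 * dot x u) *: u)); first exact: cvg_id.
  apply: (@continuous_comp _ _ _ (fun x => 2 * dot x u) (fun t => t *: u)).
    by apply: (@continuousM R V); [exact: cst_continuous|exact: dot_continuous].
  exact: scalel_continuous.
rewrite copies_setE; apply: compactU; by case: ifP => _ //; exact: compact0.
Qed.

Lemma copies_measurable a S : M S -> M (copies a S).
Proof.
move=> mS; rewrite copies_setE; apply: caratheodory_measurable_setU; case: ifP => _ //;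
  by [exact: caratheodory_measurable_set0|exact: hrefl_set_measurable].
Qed.

Lemma copies_null a S : mu S = 0%E -> mu (copies a S) = 0%E.
Proof.
move=> S0; rewrite copies_setE; apply: nullU; case: ifP => _ //;
  by [exact: lebesgue_outer0|rewrite lebesgue_outer_hrefl].
Qed.

Lemma outer_copies a b S : (a.1 + a.2 = b.1 + b.2)%N -> mu (copies a S) = mu (copies b S).
Proof.
by case: a b => [[] []] [[] []]//= _;
  rewrite ?copies_id ?copies_mirror ?copies_both ?copies_none ?lebesgue_outer_hrefl.
Qed.

End mirror_sets.

Section set_maps.
Context {R : realType} {n : nat} (E : set (set 'rV[R]_n.+1)).
Local Notation V := 'rV[R]_n.+1.
Local Notation mu := (@lebesgue_outer R n).
Local Notation M := (lebesgue_outer.-caratheodory).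
Context (hE : E = compact_class \/ E = measurable_class).
Context (D : set 'rV[R]_n.+1 -> set 'rV[R]_n.+1).
Context (hD : maps_into E D) (hmono : monotonic E D) (hmeas : measure_preserving E D).
Implicit Types (C K L S : set V).

Lemma class_compact C : compact C -> C !=set0 -> E C.
Proof.
by move=> cC C0; case: hE => ->; [split|exact: compact_measurable_outer].
Qed.

Lemma class_measurable K : E K -> M K /\ (mu K < +oo)%E.
Proof.
by case: hE => -> // -[cK _]; exact: compact_measurable_outer.
Qed.

(** Monotonicity only yields inclusions; the measures turn them into equalities. *)
Lemma map_eq_source K S : E K -> M S -> (mu K <= mu S)%E -> ess_subset S (D K) ->
  ess_eq (D K) S.
Proof.
move=> EK mS KS SD; apply: ess_eq_sym; apply: ess_subset_eq => //.
- by have [] := hD EK.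
- by rewrite hmeas.
Qed.

Lemma map_eq_target K S : E K -> (mu S <= mu K)%E -> ess_subset (D K) S -> ess_eq (D K) S.
Proof.
move=> EK SK DS; have [mD _] := hD EK; have [_ Koo] := class_measurable EK.
by apply: ess_subset_eq => //; [exact: le_lt_trans SK Koo|rewrite hmeas].
Qed.

Lemma map_mono K L : E K -> E L -> K `<=` L -> ess_subset (D K) (D L).
Proof. by move=> EK EL KL; apply: hmono => //; exact: ess_subset_incl. Qed.

Section from_balls.
Context (u : V) (u1 : enorm u = 1).
Local Notation copies := (copies u).

(** The image of a finite union of balls contains the images of the balls, and its measure
    allows no more. A compact set is an intersection of such unions, which bounds its
    image from above, and the measure gives equality again. *)
Lemma image_compact (a b : bool * bool) : (a.1 + a.2 = b.1 + b.2)%N -> (0 < a.1 + a.2)%N ->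
  (forall c r, 0 < r -> r < dot c u -> ess_eq (D (copies a (cball c r))) (copies b (cball c r))) ->
  forall C, compact C -> C !=set0 -> C `<=` open_half u ->
    ess_eq (D (copies a C)) (copies b C).
Proof.
move=> ab a0 hball.
have EC C : compact C -> C !=set0 -> E (copies a C).
  move=> cC [x Cx]; apply: class_compact; first exact: copies_compact.
  case: (a) a0 => [[] a2] /=.
    by move=> _; exists x; left.
  by case: a2 => // _; exists (hrefl u x); right; rewrite hreflK.
have hunion s e : 0 < e -> (forall c, c \in s -> e < dot c u) -> ball_union s e !=set0 ->
    ess_eq (D (copies a (ball_union s e))) (copies b (ball_union s e)).
  move=> e0 su s0; have cU := @ball_union_compact _ _ s e.
  have EU := EC _ cU s0.
  apply: map_eq_source => //.
  - by apply: copies_measurable => //; have [] := compact_measurable_outer cU.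
  - by rewrite (outer_copies u1 _ ab).
  set X := D _.
  have : forall c, c \in s -> ess_subset (copies b (cball c e)) X.
    move=> c cs; apply: ess_subset_trans (ess_eq_subset (ess_eq_sym (hball c e e0 (su c cs)))) _.
    apply: map_mono => //.
      by apply: EC; [exact: compact_cball|exists c; exact: cball_center (ltW e0)].
    by apply: copies_subset => x xc; exists c.
  move: X => X; elim: (s) => [_|c s' IH hs].
    by rewrite ball_union_nil copies_set0; exact: ess_subset_incl.
  rewrite ball_union_cons copiesU; apply: ess_subsetU.
    by apply: hs; rewrite inE eqxx.
  by apply: IH => d ds; apply: hs; rewrite inE ds orbT.
move=> C cC C0 Cu; have [e e0 Ce] := compact_margin cC C0 Cu.
pose ek k : R := e / k.+1%:R.
have ek0 k : 0 < ek k by rewrite divr_gt0.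
have eke k : ek k <= e by rewrite ler_pdivrMr// ler_peMr ?ler1n// ltW.
have /choice[s hs] k := compact_ball_cover cC (ek0 k).
pose U k := ball_union (s k) (ek k).
have Us k c : c \in s k -> ek k < dot c u.
  by move=> cs; apply: (le_lt_trans (eke k)); apply: Ce; have [+ _] := hs k; apply.
have UH k x : U k x -> open_half u x.
  by move=> [c cs xc]; exact: (cball_open_half u1 (Us k c cs)).
have CU k : C `<=` U k by have [] := hs k.
have U0 k : U k !=set0 by have [x Cx] := C0; exists x; exact: CU.
have UC x : (forall k, U k x) -> C x.
  move=> Ux; have := compact_closed (@norm_hausdorff _ V) cC; rewrite closure_id => ->.
  move=> W /nbhs_ballinf[d d0 dW].
  have [k hk] : exists k, ek k < d.
    exists (Num.truncn (e / d)); rewrite /ek ltr_pdivrMr// mulrC -ltr_pdivrMr//.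
    exact: truncnS_gt.
  have [c cs xc] := Ux k; exists c; split; first by have [+ _] := hs k; apply.
  apply: dW => i; have := le_trans (le_coord_enorm (x - c) i) xc.
  by rewrite !mxE => h; exact: le_lt_trans hk.
apply: map_eq_target.
- exact: EC.
- by rewrite (outer_copies u1 _ ab).
apply: (@ess_subset_trans _ _ (\bigcap_k copies b (U k))).
  apply: ess_subset_bigcap => k.
  apply: ess_subset_trans (ess_eq_subset (hunion (s k) (ek k) (ek0 k) (@Us k) (U0 k))).
  apply: map_mono; [exact: EC|exact: EC _ (@ball_union_compact _ _ _ _) (U0 k)|].
  by apply: copies_subset; exact: CU.
apply: ess_subset_incl => x hx.
have [xu|xu] := pselect (open_half u x).
  left; have hk k : b.1 /\ U k x.
    have [[hb Ux]|[_ /UH h]] := hx k I; first by split.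
    by case: (hrefl_open_half u1 xu h).
  by split; [exact: (hk 0%N).1|apply: UC => k; exact: (hk k).2].
right; have hk k : b.2 /\ U k (hrefl u x).
  by have [[_ /UH h]|[hb Ux]] := hx k I; [case: (xu h)|split].
by split; [exact: (hk 0%N).1|apply: UC => k; exact: (hk k).2].
Qed.

(** Compact subsets exhaust [S] up to a null set, and their images lie in that of [K]. *)
Lemma image_lower (a b : bool * bool) :
  (forall C, compact C -> C !=set0 -> C `<=` open_half u ->
    E (copies a C) /\ ess_eq (D (copies a C)) (copies b C)) ->
  forall K S, E K -> M S -> S `<=` open_half u -> copies a S `<=` K ->
    ess_subset (copies b S) (D K).
Proof.
move=> hC K S EK mS Su SK.
have [C [cC CS null]] := inner_regular mS.
have CD j k : ess_subset (copies b (C j k)) (D K).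
  have [C0|/set0P C0] := eqVneq (C j k) set0.
    by rewrite C0 copies_set0; exact: ess_subset_incl.
  have [EC h] := hC _ (cC j k) C0 (subset_trans (CS j k) Su).
  apply: ess_subset_trans (ess_eq_subset (ess_eq_sym h)) _.
  apply: map_mono => //; apply: subset_trans SK; exact: copies_subset.
have -> : S = (\bigcup_j \bigcup_k C j k) `|` (S `\` \bigcup_j \bigcup_k C j k).
  apply/seteqP; split => x; last by case=> [[j _ [k _ /CS]]//|[]].
  by move=> Sx; have [h|h] := pselect ((\bigcup_j \bigcup_k C j k) x); [left|right].
rewrite copiesU; apply: ess_subsetU; last first.
  by apply: ess_subset_null; exact: copies_null.
apply: (@ess_subset_trans _ _ (\bigcup_j \bigcup_k copies b (C j k))).
  apply: ess_subset_incl => x [[h [j _ [k _ Cx]]]|[h [j _ [k _ Cx]]]];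
    exists j => //; exists k => //; first by left.
  by right.
by apply: ess_subset_bigcup => j; exact: ess_subset_bigcup.
Qed.

End from_balls.

End set_maps.

(** * Polarization *)

Section polarization_measure.
Context {R : realType} {n : nat}.
Local Notation V := 'rV[R]_n.+1.
Local Notation mu := (@lebesgue_outer R n).
Local Notation M := (lebesgue_outer.-caratheodory).
Implicit Types (K A B : set V) (u x : V).

Lemma ess_eq_outer A B : ess_eq A B -> mu A = mu B.
Proof.
move=> AB; apply/eqP; rewrite eq_le; apply/andP; split; apply: outer_null_diff.
  exact: ess_eq_subset.
exact: ess_eq_subset (ess_eq_sym AB).
Qed.

Lemma polarizationE u K x : polarization u K x <->
  (0 <= dot x u /\ (K x \/ K (hrefl u x))) \/
  (dot x u <= 0 /\ K x /\ K (hrefl u x)).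
Proof.
split=> [[[xu [y [[->|->] Ky]]]|[xu h]]|[[xu [Kx|Kx]]|[xu [Kx KTx]]]].
- by left; split => //; left.
- by left; split => //; right.
- by right; split => //; split; apply: h; [left|right].
- by left; split => //; exists x; split => //; left.
- by left; split => //; exists (hrefl u x); split => //; right.
- by right; split => // y [->|->].
Qed.

Lemma open_half_measurable u : M (open_half u).
Proof.
apply: open_measurable_outer.
rewrite (_ : open_half u = (fun x => dot x u) @^-1` [set t | 0 < t])//.
by apply: open_comp => [x _|]; [exact: dot_continuous|exact: open_gt].
Qed.

Lemma open_halfNE u x : open_half (- u) x <-> dot x u < 0.
Proof. by rewrite /open_half/= dotNr oppr_gt0. Qed.

Lemma mirror_polarization u K : enorm u = 1 ->
  hrefl_set u (polarization u K) = polarization (- u) K.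
Proof.
move=> u1; rewrite hrefl_setE//; apply/seteqP; split => x; rewrite /preimage/=.
  move=> /polarizationE; rewrite dot_hrefl// hreflK// => h.
  apply/polarizationE; rewrite dotNr hreflNu.
  by case: h => [[? []]|[? []]]; [left; split => //; right|left; split => //; left|right].
move=> /polarizationE; rewrite dotNr hreflNu => h.
apply/polarizationE; rewrite dot_hrefl// hreflK//.
by case: h => [[? []]|[? []]]; [left; split => //; right|left; split => //; left|right].
Qed.

Lemma open_half_or u x : dot x u <> 0 -> open_half u x \/ open_half (- u) x.
Proof.
by move/eqP; rewrite neq_lt => /orP[h|h]; [right; apply/open_halfNE|left].
Qed.

Lemma diff_side u A : enorm u = 1 -> ess_eq (A `\` open_half u) (A `&` open_half (- u)).
Proof.
move=> u1; apply: null_subset (null_hyperplane u1) => x [[[Ax xu] h]|[[Ax xu] h]];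
  apply: contrapT => x0.
- by have [//|xu'] := open_half_or x0; apply: h.
- by apply: h; split => // xu'; move/open_halfNE : xu; rewrite ltNge ltW.
Qed.

Lemma ess_subset_sides u A B : enorm u = 1 -> ess_subset (A `&` open_half u) B ->
  ess_subset (A `&` open_half (- u)) B -> ess_subset A B.
Proof.
move=> u1 h1 h2.
apply: null_subset (nullU (null_hyperplane u1) (nullU h1 h2)) => x [Ax nBx].
by have [x0|/open_half_or[xu|xu]] := pselect (dot x u = 0); [left|right; left|right; right].
Qed.

Lemma polarization_measurable u K : enorm u = 1 -> M K -> M (polarization u K).
Proof.
move=> u1 mK; have mT : M (hrefl_set u K) by exact: hrefl_set_measurable.
have cH (v : V) : closed [set x | 0 <= dot x v].
  rewrite (_ : [set x | _] = (fun x => dot x v) @^-1` [set t | 0 <= t])//.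
  by apply: closed_comp => [x _|]; [exact: dot_continuous|exact: closed_ge].
have -> : polarization u K = ([set x | 0 <= dot x u] `&` (K `|` hrefl_set u K)) `|`
    ([set x | 0 <= dot x (- u)] `&` (K `&` hrefl_set u K)).
  rewrite hrefl_setE//; apply/seteqP; split => x.
    by move/polarizationE => [h|[h1 h2]]; [left|right]; rewrite //= dotNr oppr_ge0.
  case=> [h|[/= h1 h2]]; apply/polarizationE; [by left|right].
  by rewrite dotNr oppr_ge0 in h1.
by apply: caratheodory_measurable_setU; apply: caratheodory_measurable_setI;
  try (apply: closed_measurable_outer; exact: cH);
  [exact: caratheodory_measurable_setU|exact: caratheodory_measurable_setI].
Qed.

(** What the polarization adds on the positive side is the mirror image of what it removes
    on the negative side. *)
Lemma outer_polarization u K : enorm u = 1 -> M K -> mu (polarization u K) = mu K.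
Proof.
move=> u1 mK; have mT : M (hrefl_set u K) by exact: hrefl_set_measurable.
have mH := open_half_measurable u.
rewrite [LHS](outer_split _ mH) (ess_eq_outer (diff_side (polarization u K) u1)).
rewrite [in LHS](@outer_split _ _ K (polarization u K `&` open_half u))//.
rewrite [RHS](outer_split _ mH) (ess_eq_outer (diff_side K u1)).
rewrite [in RHS](@outer_split _ _ (hrefl_set u K) (K `&` open_half (- u)))//.
rewrite -addeA; congr (_ + _)%E.
  congr (mu _); apply/seteqP; split => x.
    by move=> [[_ xu] Kx].
  move=> [Kx xu]; split => //; split => //; apply/polarizationE; left.
  by split; [exact: ltW|left].
rewrite addeC; congr (_ + _)%E.
  congr (mu _); rewrite hrefl_setE//; apply/seteqP; split => x.
    move=> [/polarizationE [[x0 _]|[_ [Kx KTx]]] xu]; last by [].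
    by move/open_halfNE : xu; rewrite ltNge x0.
  move=> [[Kx xu] KTx]; split => //; apply/polarizationE; right.
  by split => //; apply/ltW/open_halfNE.
rewrite -(lebesgue_outer_hrefl u1); congr (mu _).
rewrite !hrefl_setE//; apply/seteqP; split => x; rewrite /preimage/=.
  move=> [[/polarizationE h xu] nK]; rewrite hreflK// dot_hrefl// in h xu nK *.
  have {}xu : dot x u < 0 by have := xu; rewrite /open_half/= dot_hrefl// oppr_gt0.
  split; last by rewrite /preimage/= => ?; apply: nK.
  split; last exact/open_halfNE.
  by case: h => [[_ []//]|[_ []]].
move=> [[Kx /open_halfNE xu] nK]; split => //; split; last first.
  by rewrite /open_half/= dot_hrefl// oppr_gt0.
apply/polarizationE; left; rewrite dot_hrefl// hreflK// oppr_ge0 ltW//.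
by split => //; right.
Qed.

End polarization_measure.

(** * The classification *)

Section classification.
Context {R : realType} {n : nat} (E : set (set 'rV[R]_n.+1)).
Local Notation V := 'rV[R]_n.+1.
Local Notation mu := (@lebesgue_outer R n).
Local Notation M := (lebesgue_outer.-caratheodory).
Context (hE : E = compact_class \/ E = measurable_class).
Context (D : set 'rV[R]_n.+1 -> set 'rV[R]_n.+1).
Context (hD : maps_into E D) (hmono : monotonic E D) (hmeas : measure_preserving E D).
Context (hper : perimeter_preserving_on_convex_bodies E D).
Implicit Types (K S C : set V) (c : V) (r : R).

Section one_side.
Context (u : V) (u1 : enorm u = 1) (hinv : invariant_on_symmetric_ball_pairs E u D).

Lemma class_cball c r : 0 <= r -> E (cball c r).
Proof.
move=> r0; apply: (class_compact hE); first exact: compact_cball.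
by exists c; exact: cball_center.
Qed.

Lemma pair_fixed c r : 0 < r -> r < dot c u ->
  E (cball c r `|` hrefl_set u (cball c r)) /\
  ess_eq (D (cball c r `|` hrefl_set u (cball c r))) (cball c r `|` hrefl_set u (cball c r)).
Proof.
move=> r0 rc; have EK : E (cball c r `|` hrefl_set u (cball c r)).
  apply: (class_compact hE).
    by rewrite hrefl_set_cball//; apply: compactU; exact: compact_cball.
  by exists c; left; apply: cball_center; exact: ltW.
split => //; apply: (hinv EK (B1 := cball c r) (B2 := hrefl_set u (cball c r))) => //.
- by exists c, r.
- by rewrite hrefl_set_cball//; exists (hrefl u c), r.
- rewrite hrefl_setE//; apply/seteqP; split => // x [/(cball_open_half u1 rc) h].
  by move=> /(cball_open_half u1 rc); exact: (hrefl_open_half u1 h).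
- by rewrite {1}/hrefl_set image_setU -!/(hrefl_set u _) hrefl_setK// setUC.
Qed.

(** The image lies in the invariant pair made of the ball and its mirror image, with the
    measure and the perimeter of one ball. *)
Lemma ball_image c r : 0 < r -> r < dot c u ->
  ess_eq (D (cball c r)) (cball c r) \/ ess_eq (D (cball c r)) (hrefl_set u (cball c r)).
Proof.
move=> r0 rc; have EB : E (cball c r) by apply: class_cball; exact: ltW.
have [EP hP] := pair_fixed r0 rc.
have cu : 0 <= dot c u by rewrite ltW// (lt_trans r0).
have [mD _] := hD EB.
have DP : ess_subset (D (cball c r)) (cball c r `|` hrefl_set u (cball c r)).
  apply: ess_subset_trans (ess_eq_subset hP).
  by apply: (map_mono hmono) => //; exact: subsetUl.
have [_ per] := hper EB (convex_body_cball c r0).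
have cc' : 2 * r < enorm (c - hrefl u c) by rewrite dist_mirror// ltr_pM2l.
have null : mu (D (cball c r) `\` (cball c r `|` cball (hrefl u c) r)) = 0%E.
  by rewrite -hrefl_set_cball.
have perle : (perimeter (D (cball c r)) <= perimeter (cball c r))%E by rewrite per.
have [h|h] := two_balls_dichotomy r0 cc' mD null (hmeas EB) perle; [right|left].
- apply: (map_eq_target hE hD hmeas) => //; first by rewrite lebesgue_outer_hrefl.
  apply: null_subset (nullU h DP) => x [Dx nx].
  have [xB|xB] := pselect (cball c r x); [by left|right].
  by split => // -[].
- by apply: (map_eq_source hD hmeas) => //; exact: cball_measurable.
Qed.

(** Two balls in the half-space lie in a third one, so all make the same choice. *)
Lemma half_choice : exists b : bool, forall c r, 0 < r -> r < dot c u ->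
  ess_eq (D (cball c r)) (copies u (~~ b, b) (cball c r)).
Proof.
have [nul|pos] := eqVneq (mu (cball (0 : V) 1)) 0%E.
  by exists false => c r r0 rc; apply: nullU; exact: null_ball_all nul.
have [h|/existsNP[c1 /existsNP[r1 /not_implyP[r10 /not_implyP[rc1 h1]]]]] :=
  pselect (forall c r, 0 < r -> r < dot c u -> ess_eq (D (cball c r)) (cball c r)).
  by exists false => c r r0 rc; rewrite copies_id; exact: h.
exists true => c r r0 rc; rewrite copies_mirror//.
have [h2|//] := ball_image r0 rc.
exfalso; have [/h1//|h1'] := ball_image r10 rc1.
have [c3 [r3 [r30 rc3 sub1 sub]]] := big_ball u1 rc1 rc.
have E1 := class_cball c1 (ltW r10); have E3 := class_cball c3 (ltW r30).
have E2 := class_cball c (ltW r0).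
have clash A B : A `&` B = set0 -> ess_subset A B -> mu A = 0%E.
  move=> AB; apply: null_subset => x Ax; split => // Bx.
  by have : (A `&` B) x by []; rewrite AB.
have far B B' : B `<=` open_half u -> B' `<=` open_half u ->
    B `&` hrefl_set u B' = set0.
  move=> hB hB'; rewrite hrefl_setE//; apply/seteqP; split => // x [/hB xu /hB'].
  exact: hrefl_open_half.
have Bu d s : s < dot d u -> cball d s `<=` open_half u by exact: cball_open_half.
have nz d s : 0 < s -> mu (cball d s) <> 0%E.
  by move=> s0 h0; move/eqP: pos; apply; exact: null_ball_all s0 h0.
have [h3|h3] := ball_image r30 rc3.
- apply: (nz c1 r1 r10); rewrite -(lebesgue_outer_hrefl u1).
  apply: (@clash _ (cball c3 r3)).
    by rewrite setIC; apply: far; exact: Bu.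
  apply: ess_subset_trans (ess_eq_subset (ess_eq_sym h1')) _.
  by apply: ess_subset_trans (ess_eq_subset h3); exact: (map_mono hmono).
- apply: (nz c r r0); apply: (@clash _ (hrefl_set u (cball c3 r3))).
    by apply: far; exact: Bu.
  apply: ess_subset_trans (ess_eq_subset (ess_eq_sym h2)) _.
  by apply: ess_subset_trans (ess_eq_subset h3); exact: (map_mono hmono).
Qed.

Lemma half_image : exists b : bool, forall K S, E K -> M S -> S `<=` open_half u ->
  S `<=` K -> ess_subset (copies u (~~ b, b) S) (D K).
Proof.
have [b hb] := half_choice; exists b => K S EK mS Su SK.
apply: (image_lower hmono u1 (a := (true, false)) _ EK mS Su); last first.
  by rewrite copies_id.
move=> C cC C0 Cu; split; first by rewrite copies_id; exact: (class_compact hE).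
apply: (image_compact hE hD hmono hmeas u1) => //; first by case: (b).
by move=> c r r0 rc; rewrite copies_id; exact: hb.
Qed.

(** The part of [K] whose mirror image is also in [K] stays in the image on both sides. *)
Lemma symmetric_lower K S : E K -> M S -> S `<=` open_half u ->
  S `|` hrefl_set u S `<=` K -> ess_subset (S `|` hrefl_set u S) (D K).
Proof.
rewrite -copies_both// => EK mS Su SK.
apply: (image_lower hmono u1 (a := (true, true)) _ EK mS Su) => // C cC C0 Cu.
split.
  apply: (class_compact hE); first exact: copies_compact.
  by have [x Cx] := C0; exists x; left.
apply: (image_compact hE hD hmono hmeas u1) => //.
by move=> c r r0 rc; rewrite copies_both//; have [] := pair_fixed r0 rc.
Qed.

(** The image contains [K] on the positive side, the mirror image of [K] from the negative
    side, and the symmetric part of [K]: together they make up the polarization, which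
    has the measure of [K]. *)
Lemma polarization_case :
  (forall K S, E K -> M S -> S `<=` open_half u -> S `<=` K -> ess_subset S (D K)) ->
  (forall K S, E K -> M S -> S `<=` open_half (- u) -> S `<=` K ->
     ess_subset (hrefl_set u S) (D K)) ->
  ess_equal_maps E D (polarization u).
Proof.
move=> hplus hminus K EK; have [mK _] := class_measurable hE EK.
apply: (map_eq_source hD hmeas) => //; [exact: polarization_measurable| |].
  by rewrite outer_polarization.
have mH (v : V) := open_half_measurable v.
have mT : M (hrefl_set u K) by exact: hrefl_set_measurable.
apply: (ess_subset_sides u1).
  apply: (@ess_subset_trans _ _ ((K `&` open_half u) `|` hrefl_set u (K `&` open_half (- u)))).
    apply: ess_subset_incl => x [/polarizationE h xu].
    have [Kx|KTx] : K x \/ K (hrefl u x) by case: h => [[_ h]|[_ [Kx _]]] //; left.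
      by left.
    right; rewrite hrefl_setE//; split => //.
    by apply/open_halfNE; rewrite dot_hrefl// oppr_lt0.
  apply: ess_subsetU.
    by apply: (hplus K _ EK); [exact: caratheodory_measurable_setI|exact: subIsetr|exact: subIsetl].
  by apply: (hminus K _ EK); [exact: caratheodory_measurable_setI|exact: subIsetr|exact: subIsetl].
pose S := K `&` hrefl_set u K `&` open_half u.
apply: (@ess_subset_trans _ _ (S `|` hrefl_set u S)).
  apply: ess_subset_incl => x [/polarizationE h /open_halfNE xu]; right.
  have [Kx KTx] : K x /\ K (hrefl u x) by case: h => [[x0 _]|[_ h]] //; lra.
  rewrite hrefl_setE// /S hrefl_setE//; split; first by split => //; rewrite /preimage/= hreflK.
  by rewrite /open_half/= dot_hrefl// oppr_gt0.
apply: symmetric_lower => //.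
- by do ! apply: caratheodory_measurable_setI.
- exact: subIsetr.
- move=> x [[[Kx _] _]//|]; rewrite hrefl_setE// /S hrefl_setE// /preimage/=.
  by move=> [[_]]; rewrite /preimage/= hreflK.
Qed.

End one_side.

End classification.

Theorem theorem6p16 (R : realType) (n : nat) (hn : (2 <= n.+1)%N)
    (u : 'rV[R]_n.+1) (hu : enorm u = 1)
    (E : set (set 'rV[R]_n.+1))
    (hE : E = compact_class \/ E = measurable_class)
    (D : set 'rV[R]_n.+1 -> set 'rV[R]_n.+1)
    (hD : maps_into E D)
    (hmono : monotonic E D)
    (hmeas : measure_preserving E D)
    (hper : perimeter_preserving_on_convex_bodies E D)
    (hinv : invariant_on_symmetric_ball_pairs E u D) :
  [\/ ess_equal_maps E D id,
      ess_equal_maps E D (hrefl_set u),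
      ess_equal_maps E D (polarization u) |
      ess_equal_maps E D (hrefl_set u \o polarization u)].
Proof.
have hNu : enorm (- u) = 1 by rewrite enormN.
have mirrorN (A : set 'rV[R]_n.+1) : hrefl_set (- u) A = hrefl_set u A.
  by rewrite /hrefl_set hreflNu.
have hinvN : invariant_on_symmetric_ball_pairs E (- u) D.
  by move=> K B1 B2 EK bB1 bB2 B12 KE; rewrite mirrorN; exact: hinv KE.
have [b hb] := half_image hE hD hmono hmeas hper hu hinv.
have [b' hb'] := half_image hE hD hmono hmeas hper hNu hinvN.
have side K v : E K -> [/\ lebesgue_outer.-caratheodory (K `&` open_half v),
    K `&` open_half v `<=` open_half v & K `&` open_half v `<=` K].
  move=> EK; have [mK _] := class_measurable hE EK; split.
  - by apply: caratheodory_measurable_setI => //; exact: open_half_measurable.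
  - exact: subIsetr.
  - exact: subIsetl.
case: b b' hb hb' => [] [] hb hb'.
- apply: Or42 => K EK; have [mK _] := class_measurable hE EK.
  apply: (map_eq_source hD hmeas) => //; [exact: hrefl_set_measurable| |].
    by rewrite lebesgue_outer_hrefl.
  apply: (ess_subset_sides hu).
    have [m s1 s2] := side K (- u) EK; have := hb' K _ EK m s1 s2.
    rewrite copies_mirror// mirrorN; apply: ess_subset_trans; apply: ess_subset_incl.
    rewrite !hrefl_setE// => x [Kx xu]; split => //.
    by apply/open_halfNE; rewrite dot_hrefl// oppr_lt0.
  have [m s1 s2] := side K u EK; have := hb K _ EK m s1 s2.
  rewrite copies_mirror//; apply: ess_subset_trans; apply: ess_subset_incl.
  rewrite !hrefl_setE// => x [Kx /open_halfNE xu]; split => //.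
  by rewrite /open_half/= dot_hrefl// oppr_gt0.
- apply: Or44; have pol := @polarization_case _ _ E hE D hD hmono hmeas (- u) hNu hinvN.
  rewrite (_ : hrefl_set u \o polarization u = polarization (- u)); last first.
    by apply/funext => K; exact: mirror_polarization.
  apply: pol => K S EK mS Su SK.
    by have := hb' K S EK mS Su SK; rewrite copies_id.
  by rewrite opprK in Su; have := hb K S EK mS Su SK; rewrite copies_mirror// mirrorN.
- apply: Or43; apply: (polarization_case hE hD hmono hmeas hu hinv) => K S EK mS Su SK.
    by have := hb K S EK mS Su SK; rewrite copies_id.
  by have := hb' K S EK mS Su SK; rewrite copies_mirror// mirrorN.
- apply: Or41 => K EK; have [mK _] := class_measurable hE EK.
  apply: (map_eq_source hD hmeas) => //.
  apply: (ess_subset_sides hu).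
    by have [m s1 s2] := side K u EK; have := hb K _ EK m s1 s2; rewrite copies_id.
  by have [m s1 s2] := side K (- u) EK; have := hb' K _ EK m s1 s2; rewrite copies_id.
Qed.
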